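(* Let $\psi\in\mathcal S(\mathbb R)$ be a Schwartz function whose Fourier transform is supported in the ball of radius $0.1$ around $0$. Then for any $s\geq0$ and any sequence $(c_k)_{k\ge1}\in\ell^2(\mathbb N)$ the function $$f(t,x,v)=\Re\sum_{k\geq1}c_k(1+k^2)^{-\frac s2}e^{ikx}e^{i(-k-kt)v}\psi(v)$$ is an element of the Sobolev space $H^s(\mathbb T\times\mathbb R)$ for all times $t>0$ and is a solution of the Vlasov-Poisson equations for $t\in(0,\infty)$. Moreover, $f(t,x+tv,v)=f(0,x,v)$ is independent of time and $F(t,x)=0$.
   Context: The Vlasov-Poisson equations on $\mathbb T\times\mathbb R$ (with $\mathbb T=\mathbb R/2\pi\mathbb Z$) are $$\partial_t f+v\,\partial_x f+F\,\partial_v f=0,\qquad \rho(t,x)=\int_{\mathbb R} f(t,x,v)\,dv,\qquad F(t,x)=\partial_x\Delta^{-1}\rho(t,x),$$ where in terms of Fourier coefficients in $x$, $\hat F(t,l)=\frac{1}{il}\hat\rho(t,l)$ for $l\ne0$ and $\hat F(t,0)=0$. Solutions of low regularity are understood in the sense of distributions. The Fourier transform in $v$ is taken with respect to the characters $e^{i\xi v}$, $\xi\in\mathbb R$ (angular frequency). $\Re$ denotes the real part. *)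

(* Defs.v *)
From HB Require Import structures.
From mathcomp Require Import all_boot all_order all_algebra.
From mathcomp Require Import complex.
From mathcomp Require Import all_classical all_reals all_analysis.
Import Order.TTheory GRing.Theory Num.Theory.
Import numFieldNormedType.Exports.

Set Implicit Arguments.
Unset Strict Implicit.
Unset Printing Implicit Defensive.

Local Open Scope classical_set_scope.
Local Open Scope ring_scope.
Local Open Scope complex_scope.

(* Functions on the torus T = R / 2 pi Z are represented by 2 pi-periodic
   functions on R, and integrals over T by integrals over [0, 2 pi]. *)

Section Complex.
Variable R : realType.
Implicit Types z : R[i].

Definition expi (y : R) : R[i] := cos y +i* sin y.

Definition sqnorm z : R := complex.Re z ^+ 2 + complex.Im z ^+ 2.

Definition Cintegral (D : set R) (u : R -> R[i]) : R[i] :=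
  (\int[@lebesgue_measure R]_(x in D) complex.Re (u x)) +i*
  (\int[@lebesgue_measure R]_(x in D) complex.Im (u x)).

Definition Cmeasurable d (T : measurableType d) (D : set T) (u : T -> R[i]) :=
  measurable_fun D (fun x => complex.Re (u x)) /\
  measurable_fun D (fun x => complex.Im (u x)).

Definition square_summable (c : nat -> R[i]) : Prop :=
  (\sum_(1 <= k <oo) (sqnorm (c k))%:E < +oo)%E.

End Complex.

Section Fourier.
Variable R : realType.
Local Notation mu := (@lebesgue_measure R).

Definition Rschwartz (u : R -> R) : Prop :=
  (forall n x, derivable (derive1n n u) x 1) /\
  (forall m n, exists C, forall x, `|x| ^+ m * `|derive1n n u x| <= C).

Definition schwartz (u : R -> R[i]) : Prop :=
  Rschwartz (fun x => complex.Re (u x)) /\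
  Rschwartz (fun x => complex.Im (u x)).

Definition fourier (u : R -> R[i]) (xi : R) : R[i] :=
  Cintegral setT (fun v => u v * expi (- (xi * v))).

(* [h] is the Fourier transform of [u] as a tempered distribution; this also
   makes sense for [u] in L^2 that is not integrable. *)
Definition is_fourier (u h : R -> R[i]) : Prop :=
  forall phi : R -> R[i], schwartz phi ->
    Cintegral setT (fun xi => h xi * phi xi) =
    Cintegral setT (fun v => u v * fourier phi v).

Definition torus : set R := `[0, 2 * pi].

Definition periodic T (u : R -> T) : Prop := forall x, u (x + 2 * pi) = u x.

Definition fourier_coef (u : R -> R) (l : int) : R[i] :=
  ((2 * pi)^-1)%:C * Cintegral torus (fun x => (u x)%:C * expi (- (l%:~R * x))).

(* The elements of H^s(T x R), for s >= 0: functions of L^2(T x R) whose Fourier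
   transform [h] (Fourier coefficients in x, Fourier transform in v) satisfies
   sum_l int (1 + l^2 + xi^2)^s |h(l, xi)|^2 dxi < oo. *)
Definition sobolev (s : R) (g : R -> R -> R) : Prop :=
  [/\ forall v, periodic (g^~ v),
      measurable_fun setT (fun p : R * R => g p.1 p.2),
      (\int[mu \x mu]_(p in torus `*` setT) (g p.1 p.2 ^+ 2)%:E < +oo)%E &
      exists h : int -> R -> R[i],
        [/\ forall l, Cmeasurable setT (h l),
            forall l, is_fourier (fun v => fourier_coef (g^~ v) l) (h l) &
            (esum [set: int] (fun l => \int[mu]_xi
               ((1 + l%:~R ^+ 2 + xi ^+ 2) `^ s * sqnorm (h l xi))%:E)
             < +oo)%E]].

End Fourier.

Section VlasovPoisson.
Variable R : realType.
Local Notation mu := (@lebesgue_measure R).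
Implicit Types (f phi : R -> R -> R -> R) (F : R -> R -> R).

Definition density f (t x : R) : R := \int[mu]_v f t x v.

(* [F] represents d_x Delta^-1 rho, with rho the density of [f], on (0, oo) x T.
   The first two integrability clauses make rho(t, .) an element of L^1(T). *)
Definition is_force f F : Prop :=
  measurable_fun [set p : R * R | 0 < p.1] (fun p => F p.1 p.2) /\
  forall t, 0 < t ->
    [/\ {ae mu, forall x, mu.-integrable setT (fun v => (f t x v)%:E)},
        mu.-integrable (@torus R) (fun x => (density f t x)%:E),
        periodic (F t),
        mu.-integrable (@torus R) (fun x => (F t x)%:E) &
        forall l : int, fourier_coef (F t) l =
          if l == 0 then 0 else (0 +i* l%:~R)^-1 * fourier_coef (density f t) l].

Definition dt phi : R -> R -> R -> R :=
  fun t x v => derive1 (fun t' => phi t' x v) t.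
Definition dx phi : R -> R -> R -> R :=
  fun t x v => derive1 (fun x' => phi t x' v) x.
Definition dv phi : R -> R -> R -> R :=
  fun t x v => derive1 (fun v' => phi t x v') v.

Fixpoint Cn (n : nat) phi : Prop :=
  continuous (fun p : R * R * R => phi p.1.1 p.1.2 p.2) /\
  if n is m.+1 then
    (forall t x v, [/\ derivable (fun t' => phi t' x v) t 1,
                       derivable (fun x' => phi t x' v) x 1 &
                       derivable (fun v' => phi t x v') v 1]) /\
    [/\ Cn m (dt phi), Cn m (dx phi) & Cn m (dv phi)]
  else True.

(* Test functions: smooth and compactly supported in (0, oo) x T x R. *)
Definition test_function phi : Prop :=
  [/\ forall n, Cn n phi,
      forall t v, periodic (fun x => phi t x v) &
      exists a b M : R, 0 < a /\
        forall t x v, ~ (a <= t <= b /\ `|v| <= M) -> phi t x v = 0].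

Definition locally_integrable_tor f : Prop :=
  forall a b M : R, 0 < a ->
    ((mu \x mu) \x mu)%E.-integrable (`[a, b] `*` @torus R `*` `[- M, M])
      (fun p : R * R * R => (f p.1.1 p.1.2 p.2)%:E).

(* d_t f + v d_x f + F d_v f = 0 in the sense of distributions on
   (0, oo) x T x R; since F does not depend on v, F d_v f = d_v (F f). *)
Definition weak_transport f F : Prop :=
  [/\ forall t v, 0 < t -> periodic (fun x => f t x v),
      locally_integrable_tor f,
      locally_integrable_tor (fun t x v => F t x * f t x v) &
      forall phi, test_function phi ->
        \int[((mu \x mu) \x mu)%E]_(p in `]0, +oo[ `*` @torus R `*` setT)
          (let: (t, x, v) := p in
           f t x v * dt phi t x v + v * f t x v * dx phi t x v
           + F t x * f t x v * dv phi t x v) = 0].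

Definition vlasov_poisson f F : Prop := is_force f F /\ weak_transport f F.

End VlasovPoisson.

Section Series.
Variables (R : realType) (psi : R -> R[i]) (s : R) (c : nat -> R[i]).
Local Notation mu := (@lebesgue_measure R).

Definition wave (k : nat) (t x v : R) : R[i] :=
  c k * ((1 + k%:R ^+ 2) `^ (- (s / 2)))%:C * expi (k%:R * x)
  * expi ((- k%:R - k%:R * t) * v) * psi v.

(* [g] represents the sum of the waves for k >= 1, as a measurable function
   of (t, x, v), the series converging in L^2(T x R) for each time t >= 0. *)
Definition is_wave_sum (g : R -> R -> R -> R[i]) : Prop :=
  [/\ forall t v, 0 <= t -> periodic (fun x => g t x v),
      Cmeasurable [set p : R * R * R | 0 <= p.1.1]
        (fun p => g p.1.1 p.1.2 p.2) &
      forall t, 0 <= t ->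
        (fun N : nat => \int[mu \x mu]_(p in @torus R `*` setT)
           (sqnorm (g t p.1 p.2 - \sum_(1 <= k < N.+1) wave k t p.1 p.2))%:E)%E
        @ \oo --> 0%E].

End Series.

(* Main.v *)
From HB Require Import structures.
Require Import Defs.
From mathcomp Require Import all_boot all_order all_algebra.
From mathcomp Require Import complex ring lra zify.
From mathcomp Require Import all_classical all_reals all_analysis measurable_realfun.
Import Order.TTheory GRing.Theory Num.Theory.
Import numFieldNormedType.Exports.
Local Open Scope classical_set_scope.
Local Open Scope ring_scope.
Local Open Scope complex_scope.

(** Put y = x - (1 + t) v. The phases of the k-th wave combine into k y, so that
    at time t the series is the Fourier series of one function G of L^2(T),
    evaluated at y and multiplied by psi(v). Such a G exists because its
    coefficients c_k (1 + k^2)^(-s/2) are square summable ([riesz_fischer]). For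
    fixed v the shear (x, v) |-> (y, v) is a translation of T, hence preserves
    the measure of T x R, and the profile G(y) psi(v) is a sum of the waves at
    all times ([wave_sum_profile]); every other sum agrees with it almost
    everywhere ([wave_sum_unique]). All the claims are read on the profile.

    Regularity. The l-th Fourier coefficient in x of the real part of the sum is
    half of d_l psi(v) e^{-il(1 + t)v} plus the conjugate of the same
    expression at - l, where d_l is the l-th coefficient of G
    ([fourier_coef_wave_sum]). Its Fourier transform in v is a translate of that
    of psi by l (1 + t), so it is supported in |xi + l (1 + t)| <= 1/10, where
    1 + l^2 + xi^2 is at most a constant depending on t times 1 + l^2. The
    weight (1 + l^2)^s cancels the factor (1 + k^2)^(-s) of |d_k|^2 and the sum
    of the |c_k|^2 remains ([wave_sum_sobolev]).

    Force. The l-th coefficient of the density is the value of that Fourier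
    transform at xi = 0. If l is not 0 then |l (1 + t)| >= 1 > 1/10, so it
    vanishes: the density is constant in x and 0 is a force
    ([wave_sum_force0]). It is the only one, since an integrable function is
    determined by its Fourier coefficients ([ae_eq0_fourier_coef]).

    Transport. The variable y is constant along the characteristics
    t |-> (t, y + (1 + t) v, v). Substituting x = y + (1 + t) v in the weak
    formulation leaves the integral over y and v of G(y) psi(v) times
    the integral in t of the derivative of phi(t, y + (1 + t) v, v), which is 0
    because phi has compact support in time ([integral_along_characteristic]).
    As the force vanishes, this is the Vlasov equation, and G may be as rough as
    an integrable function. The same formula for the profile gives
    f(t, x + t v, v) = f(0, x, v).

    Two classical facts are proved on the way: the completeness of L^2
    ([L2_complete]), in a form that keeps periodicity, and the uniqueness of
    Fourier coefficients, by approximating indicators of arcs boundedly by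
    polynomials in a cosine ([integral_arc_eq0]). *)

Set Implicit Arguments.
Unset Strict Implicit.
Unset Printing Implicit Defensive.

Local Notation periodic := Defs.periodic.

(** * Integration on products *)
Section Rectangles.
Local Open Scope ereal_scope.
Context d1 d2 (T1 : measurableType d1) (T2 : measurableType d2) (R : realType).
Variables (m1 : {sigma_finite_measure set T1 -> \bar R}).
Variables (m2 : {sigma_finite_measure set T2 -> \bar R}).
Variables (A : set T1) (B : set T2).
Hypotheses (mA : measurable A) (mB : measurable B).

(** Tonelli and Fubini are transferred from the whole product by extending f by
    0 outside A x B; the extension is compatible with taking sections. *)
Let patch_rect (f : T1 * T2 -> \bar R) x y :
  (f \_ (A `*` B)) (x, y) = ((fun y => f (x, y)) \_ B) y * (\1_A x)%:E.
Proof.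
rewrite !patchE indicE in_setX/=.
by case: (x \in A); case: (y \in B); rewrite /= ?mule1 ?mul0e ?mule0.
Qed.

Let patch_rect1 (f : T1 * T2 -> \bar R) x :
  \int[m2]_y (f \_ (A `*` B)) (x, y) =
  ((fun x => \int[m2]_(y in B) f (x, y)) \_ A) x.
Proof.
rewrite patchE; case: ifPn => xA.
  rewrite [RHS]integral_mkcond; apply: eq_integral => y _.
  by rewrite patch_rect indicE xA mule1.
by apply: integral0_eq => y _; rewrite patch_rect indicE (negbTE xA) mule0.
Qed.

Let patch_rect2 (f : T1 * T2 -> \bar R) y :
  \int[m1]_x (f \_ (A `*` B)) (x, y) =
  ((fun y => \int[m1]_(x in A) f (x, y)) \_ B) y.
Proof.
rewrite patchE; case: ifPn => yB.
  rewrite [RHS]integral_mkcond; apply: eq_integral => x _.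
  rewrite !patchE in_setX yB andbT//.
by apply: integral0_eq => x _; rewrite patchE in_setX (negbTE yB) andbF.
Qed.

Variable f : T1 * T2 -> \bar R.
Hypothesis mf : measurable_fun (A `*` B) f.

Let mAB : measurable (A `*` B). Proof. exact: measurableX. Qed.

Let mfr : measurable_fun setT (f \_ (A `*` B)).
Proof. exact: (measurable_restrictT _ mAB).1 mf. Qed.

Lemma measurable_section2 y : B y -> measurable_fun A (fun x => f (x, y)).
Proof.
move=> By; apply: (measurable_restrictT _ mA).2.
have -> : (fun x => f (x, y)) \_ A = (f \_ (A `*` B)) \o pair^~ y.
  by apply/funext => x; rewrite /= !patchE in_setX/= (mem_set By) andbT.
by apply: (measurableT_comp mfr); exact: pair2_measurable.
Qed.

Section tonelli.
Hypothesis f0 : forall p, (A `*` B) p -> 0 <= f p.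

Let fr0 p : 0 <= (f \_ (A `*` B)) p.
Proof. exact: erestrict_ge0. Qed.

Lemma tonelli1 : \int[m1 \x m2]_(p in A `*` B) f p =
  \int[m1]_(x in A) \int[m2]_(y in B) f (x, y).
Proof.
rewrite integral_mkcond (fubini_tonelli1 _ mfr fr0) [RHS]integral_mkcond.
by apply: eq_integral => x _; rewrite /fubini_F patch_rect1.
Qed.

Lemma tonelli2 : \int[m1 \x m2]_(p in A `*` B) f p =
  \int[m2]_(y in B) \int[m1]_(x in A) f (x, y).
Proof.
rewrite integral_mkcond (fubini_tonelli2 _ mfr fr0) [RHS]integral_mkcond.
by apply: eq_integral => y _; rewrite /fubini_G patch_rect2.
Qed.

Lemma measurable_tonelli1 :
  measurable_fun A (fun x => \int[m2]_(y in B) f (x, y)).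
Proof.
apply: (measurable_restrictT _ mA).2.
rewrite [X in measurable_fun _ X](_ : _ = fubini_F m2 (f \_ (A `*` B))); last first.
  by apply/funext => x; rewrite /fubini_F patch_rect1.
exact: measurable_fun_fubini_tonelli_F.
Qed.

Lemma measurable_tonelli2 :
  measurable_fun B (fun y => \int[m1]_(x in A) f (x, y)).
Proof.
apply: (measurable_restrictT _ mB).2.
rewrite [X in measurable_fun _ X](_ : _ = fubini_G m1 (f \_ (A `*` B))); last first.
  by apply/funext => x; rewrite /fubini_G patch_rect2.
exact: measurable_fun_fubini_tonelli_G.
Qed.

End tonelli.

Section fubini.
Hypothesis intf : (m1 \x m2).-integrable (A `*` B) f.

Let intfr : (m1 \x m2).-integrable setT (f \_ (A `*` B)).
Proof. exact: (integrable_mkcond _ mAB).1 intf. Qed.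

Lemma rect_fubini1 : \int[m1 \x m2]_(p in A `*` B) f p =
  \int[m1]_(x in A) \int[m2]_(y in B) f (x, y).
Proof.
rewrite integral_mkcond -(integral12_prod_meas1 intfr) [RHS]integral_mkcond.
by apply: eq_integral => x _; rewrite -patch_rect1.
Qed.

Lemma rect_fubini2 : \int[m1 \x m2]_(p in A `*` B) f p =
  \int[m2]_(y in B) \int[m1]_(x in A) f (x, y).
Proof.
rewrite integral_mkcond -(integral21_prod_meas1 intfr) [RHS]integral_mkcond.
by apply: eq_integral => y _; rewrite -patch_rect2.
Qed.

Lemma rect_ae_integrable1 :
  {ae m1, forall x, A x -> m2.-integrable B (fun y => f (x, y))}.
Proof.
have := ae_integrable1 intfr; apply: filterS => x + Ax.
move=> H; apply: (integrable_mkcond _ mB).2; apply: eq_integrable H => // y _.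
by rewrite patch_rect indicE mem_set// mule1.
Qed.

Lemma rect_integrable1 :
  m1.-integrable A (fun x => \int[m2]_(y in B) f (x, y)).
Proof.
apply: (integrable_mkcond _ mA).2.
apply: eq_integrable (integrable_fubini_F intfr) => // x _.
by rewrite -patch_rect1.
Qed.

Lemma measurable_rect_fubini2 :
  measurable_fun B (fun y => \int[m1]_(x in A) f (x, y)).
Proof.
apply: (measurable_restrictT _ mB).2.
rewrite [X in measurable_fun _ X](_ : _ = fubini_G m1 (f \_ (A `*` B))).
  exact: (measurable_fubini_G intfr).
by apply/funext => y; rewrite /fubini_G patch_rect2.
Qed.

End fubini.
End Rectangles.

Lemma rect_integrable2 d1 d2 (T1 : measurableType d1) (T2 : measurableType d2)
    (R : realType) (m1 : {sigma_finite_measure set T1 -> \bar R})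
    (m2 : {sigma_finite_measure set T2 -> \bar R}) (A : set T1) (B : set T2)
    (f : T1 * T2 -> \bar R) : measurable A -> measurable B ->
  (m1 \x m2)%E.-integrable (A `*` B) f ->
  m2.-integrable B (fun y => \int[m1]_(x in A) f (x, y))%E.
Proof.
move=> mA mB fi; have mf := measurable_int _ fi.
have mG := measurable_rect_fubini2 mA mB fi.
have maf : measurable_fun (A `*` B) (abse \o f) by exact: measurableT_comp.
have a0 p : (A `*` B) p -> (0 <= (abse \o f) p)%E by move=> _; exact: abse_ge0.
apply/integrableP; split => //.
have [_] := integrableP _ _ _ fi; apply: le_lt_trans.
rewrite (tonelli2 m1 m2 mA mB maf a0).
apply: ge0_le_integral => //.
- exact: measurableT_comp.
- exact: (measurable_tonelli2 m1 mA mB maf a0).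
- move=> y By; apply: le_abse_integral => //.
  exact: (measurable_section2 mA mB mf).
Qed.

Section ProductIntegrals.
Context d1 d2 (T1 : measurableType d1) (T2 : measurableType d2) (R : realType).
Variables (m1 : {sigma_finite_measure set T1 -> \bar R}).
Variables (m2 : {sigma_finite_measure set T2 -> \bar R}).
Variables (A : set T1) (B : set T2).
Hypotheses (mA : measurable A) (mB : measurable B).

Lemma measurable_fst_rect (p : T1 -> R) : measurable_fun A p ->
  measurable_fun (A `*` B) (fun z => p z.1).
Proof.
move=> mp; apply: (measurable_comp mA _ mp).
  by move=> _ [z [zA _]] <-.
by apply: measurable_funTS; exact: measurable_fst.
Qed.

Lemma measurable_snd_rect (q : T2 -> R) : measurable_fun B q ->
  measurable_fun (A `*` B) (fun z => q z.2).
Proof.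
move=> mq; apply: (measurable_comp mB _ mq).
  by move=> _ [z [_ zB]] <-.
by apply: measurable_funTS; exact: measurable_snd.
Qed.

Lemma integrable_tensor (p : T1 -> R) (q : T2 -> R) :
  m1.-integrable A (EFin \o p) -> m2.-integrable B (EFin \o q) ->
  (m1 \x m2)%E.-integrable (A `*` B) (fun z => (p z.1 * q z.2)%:E).
Proof.
move=> ip iq.
have mp : measurable_fun A p by apply/measurable_EFinP; exact: measurable_int ip.
have mq : measurable_fun B q by apply/measurable_EFinP; exact: measurable_int iq.
have mpq : measurable_fun (A `*` B) (fun z => p z.1 * q z.2).
  by apply: measurable_funM; [exact: measurable_fst_rect|exact: measurable_snd_rect].
apply/integrableP; split; first exact/measurable_EFinP.
rewrite (@tonelli1 _ _ T1 T2 R m1 m2 A B mA mB (fun z => `|(p z.1 * q z.2)%:E|)%E)//; last first.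
  by apply: measurableT_comp => //; exact/measurable_EFinP.
under eq_integral => x xA.
  under eq_integral do rewrite /= normrM EFinM.
  rewrite ge0_integralZl//; last first.
    by do 2 apply: measurableT_comp => //.
  over.
have [_ iq'] := integrableP _ _ _ iq; have [_ ip'] := integrableP _ _ _ ip.
have fq : (\int[m2]_(y in B) (`|q y|)%:E)%E \is a fin_num.
  by rewrite ge0_fin_numE// integral_ge0.
under eq_integral do rewrite -(fineK fq) muleC.
rewrite ge0_integralZl//; last 2 first.
- by do 2 apply: measurableT_comp => //.
- by rewrite lee_fin fine_ge0// integral_ge0.
by rewrite lte_mul_pinfty// ?lee_fin ?fine_ge0 ?integral_ge0.
Qed.

Variable f : T1 -> T2 -> R.
Hypothesis fi : (m1 \x m2)%E.-integrable (A `*` B) (fun z => (f z.1 z.2)%:E).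

Let Efine (d : measure_display) (T : measurableType d) (m : {measure set T -> \bar R})
    (D : set T) (h : T -> \bar R) : measurable D -> m.-integrable D h ->
  \int[m]_(x in D) fine (h x) = fine (\int[m]_(x in D) h x)%E.
Proof.
move=> mD ih; congr fine; apply: ae_eq_integral => //.
- by apply/measurable_EFinP; apply: measurableT_comp (measurable_int _ ih).
- exact: measurable_int ih.
- by have := integrable_ae mD ih; apply: filterS => x /[apply] hx; rewrite fineK.
Qed.

Lemma Rfubini1 : \int[(m1 \x m2)%E]_(z in A `*` B) f z.1 z.2 =
  \int[m1]_(x in A) \int[m2]_(y in B) f x y.
Proof.
by rewrite [LHS](congr1 fine (rect_fubini1 mA mB fi)) -Efine//; exact: (rect_integrable1 mA mB fi).
Qed.

Lemma Rfubini2 : \int[(m1 \x m2)%E]_(z in A `*` B) f z.1 z.2 =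
  \int[m2]_(y in B) \int[m1]_(x in A) f x y.
Proof.
by rewrite [LHS](congr1 fine (rect_fubini2 mA mB fi)) -Efine//; exact: (rect_integrable2 mA mB fi).
Qed.

Lemma Rfubini : \int[m1]_(x in A) \int[m2]_(y in B) f x y =
  \int[m2]_(y in B) \int[m1]_(x in A) f x y.
Proof. by rewrite -Rfubini1 Rfubini2. Qed.

Lemma integrable_Rfubini1 :
  m1.-integrable A (fun x => (\int[m2]_(y in B) f x y)%:E).
Proof.
have I := rect_integrable1 mA mB fi.
have mI : measurable_fun A (fun x => (\int[m2]_(y in B) f x y)%:E).
  by apply/measurable_EFinP; apply: measurableT_comp (measurable_int _ I).
apply: (le_integrable mA mI _ I) => x xA.
rewrite /Rintegral; case: (\int[m2]_(y in B) (f x y)%:E)%E => //=.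
- by rewrite normr0 leey.
- by rewrite normr0 leey.
Qed.

End ProductIntegrals.

Section SigmaFiniteProduct.
Context d1 d2 (T1 : measurableType d1) (T2 : measurableType d2) (R : realType).
Variable m1 : {sigma_finite_measure set T1 -> \bar R}.
Variable m2 : {sigma_finite_measure set T2 -> \bar R}.

Lemma sigma_finite_product : sigma_finite setT (m1 \x m2)%E.
Proof.
have /sigma_finiteP[F [TF ndF Foo]] := sigma_finiteT m1.
have /sigma_finiteP[G [TG ndG Goo]] := sigma_finiteT m2.
exists (fun n => F n `*` G n); last first.
  move=> n; have [mF fF] := Foo n; have [mG fG] := Goo n.
  by split; [exact: measurableX|rewrite product_measure1E// lte_mul_pinfty// ge0_fin_numE].
apply/seteqP; split=> // -[x y] _.
have [[i _ Fx] [j _ Gy]] : (\bigcup_n F n) x /\ (\bigcup_n G n) y by rewrite -TF -TG.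
by exists (maxn i j) => //; split; [move: Fx|move: Gy]; apply/subsetPset;
  [apply: ndF|apply: ndG]; rewrite ?leq_maxl ?leq_maxr.
Qed.

(** The product measure under a name that carries its sigma-finiteness, so that
    it can in turn be a factor of a product. *)
Definition product_measure := (m1 \x m2)%E.
HB.instance Definition _ := Measure.on product_measure.
HB.instance Definition _ :=
  Measure_isSigmaFinite.Build _ _ _ product_measure sigma_finite_product.

End SigmaFiniteProduct.

Section ProductNull.
Context d1 d2 (T1 : measurableType d1) (T2 : measurableType d2) (R : realType).
Variables (m1 : {sigma_finite_measure set T1 -> \bar R}).
Variables (m2 : {sigma_finite_measure set T2 -> \bar R}).

(** The measure of N is the integral of the measures of its sections, and a
    nonnegative function has integral 0 only if it vanishes almost everywhere.
    The series converges in L^2(T x R), which gives identities off a joint null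
    set; the arguments below work at almost every velocity, or position. *)
Lemma product_null2 (N : set (T1 * T2)) : measurable N ->
  (m1 \x m2)%E N = 0%E <-> {ae m2, forall y, m1 [set x | N (x, y)] = 0%E}.
Proof.
move=> mN.
have E : ((m1 \x m2) N = \int[m2]_y m1 (ysection N y))%E.
  transitivity (\int[(m1 \x m2)%E]_z (\1_N z)%:E)%E.
    by rewrite integral_indic// setIT.
  rewrite indic_fubini_tonelli1// indic_fubini_tonelli//.
  by apply: eq_integral => y _; rewrite -[LHS]/(_ y) indic_fubini_tonelli_GE.
have S y : ysection N y = [set x | N (x, y)].
  by apply/seteqP; split=> x; rewrite /ysection/= inE.
have mS : measurable_fun setT (fun y => m1 (ysection N y)).
  exact: measurable_fun_ysection.
rewrite E; split=> [H|H].
- have /(ae_eq_integral_abs _ measurableT mS) : (\int[m2]_y `|m1 (ysection N y)| = 0)%E.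
    by rewrite -[RHS]H; apply: eq_integral => y _; rewrite gee0_abs.
  by apply: filterS => y /(_ I) /=; rewrite S.
- rewrite (ae_eq_integral (cst 0%E))//; first exact: integral0.
  by move: H; apply: filterS => y + _; rewrite /= S.
Qed.

Lemma product_null1 (N : set (T1 * T2)) : measurable N ->
  (m1 \x m2)%E N = 0%E <-> {ae m1, forall x, m2 [set y | N (x, y)] = 0%E}.
Proof.
move=> mN.
have S x : xsection N x = [set y | N (x, y)].
  by apply/seteqP; split=> y; rewrite /xsection/= inE.
have E : ((m1 \x m2) N = \int[m1]_x m2 (xsection N x))%E by [].
have mS : measurable_fun setT (fun x => m2 (xsection N x)).
  exact: measurable_fun_xsection.
rewrite E; split=> [H|H].
- have /(ae_eq_integral_abs _ measurableT mS) : (\int[m1]_x `|m2 (xsection N x)| = 0)%E.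
    by rewrite -[RHS]H; apply: eq_integral => y _; rewrite gee0_abs.
  by apply: filterS => y /(_ I) /=; rewrite S.
- rewrite (ae_eq_integral (cst 0%E))//; first exact: integral0.
  by move: H; apply: filterS => y + _; rewrite /= S.
Qed.

(** The inner integral is the difference of those of the positive and negative
    parts, and each is measurable by Tonelli. *)
Lemma measurable_fun_param_Rintegral (B : set T2) (f : T1 -> T2 -> R) :
  measurable B -> measurable_fun (setT `*` B) (fun p => f p.1 p.2) ->
  measurable_fun setT (fun x => \int[m2]_(y in B) f x y).
Proof.
move=> mB mf; apply: measurableT_comp; first exact: fine_measurable.
have mE : measurable_fun (setT `*` B) (fun p => (f p.1 p.2)%:E).
  exact/measurable_EFinP.
have Hp : measurable_fun setT (fun x =>
    \int[m2]_(y in B) (fun p : T1 * T2 => (f p.1 p.2)%:E)^\+ (x, y))%E.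
  apply: (@measurable_tonelli1 _ _ T1 T2 R _ setT B) => //.
  by apply: measurable_funepos; exact: mE.
have Hn : measurable_fun setT (fun x =>
    \int[m2]_(y in B) (fun p : T1 * T2 => (f p.1 p.2)%:E)^\- (x, y))%E.
  apply: (@measurable_tonelli1 _ _ T1 T2 R _ setT B) => //.
  by apply: measurable_funeneg; exact: mE.
apply: eq_measurable_fun (emeasurable_funB Hp Hn) => x _ /=.
rewrite [RHS]integralE; congr (_ - _)%E; apply: eq_integral => y _.
- by rewrite !funeposE.
- by rewrite !funenegE.
Qed.
End ProductNull.

Section AlmostEverywhere.
Context d (T : measurableType d) (R : realType) (nu : {measure set T -> \bar R}).
Variables (D : set T) (f h : T -> R).
Hypotheses (mD : measurable D) (mf : measurable_fun D f).
Hypotheses (ih : nu.-integrable D (EFin \o h)).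
Hypothesis fh : {ae nu, forall x, D x -> f x = h x}.

Lemma ae_eq_integrable : nu.-integrable D (EFin \o f).
Proof.
have /integrableP[mh fin] := ih.
apply/integrableP; split; first exact/measurable_EFinP.
rewrite (ge0_ae_eq_integral (g := fun x => `|(EFin \o h) x|%E))//.
- by apply: measurableT_comp => //; exact/measurable_EFinP.
- exact: measurableT_comp.
- by apply: (@filterS _ _ (ae_filter_ringOfSetsType nu) _ _ _ fh) => x /= E Dx; rewrite E.
Qed.

Lemma ae_eq_Rintegral : \int[nu]_(x in D) f x = \int[nu]_(x in D) h x.
Proof.
have /integrableP[mh _] := ih.
rewrite /Rintegral; congr fine; apply: ae_eq_integral => //.
- exact/measurable_EFinP.
- by apply: (@filterS _ _ (ae_filter_ringOfSetsType nu) _ _ _ fh) => x /= E Dx; rewrite E.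
Qed.

End AlmostEverywhere.

Lemma integrable_mulr_bounded d (T : measurableType d) (R : realType)
    (nu : {measure set T -> \bar R}) (D : set T) (f h : T -> R) (M : R) :
  measurable D -> nu.-integrable D (EFin \o f) -> measurable_fun D h ->
  (forall x, D x -> `|h x| <= M) ->
  nu.-integrable D (fun x => (f x * h x)%:E).
Proof.
move=> mD fi mh hM.
have := integrableMl mD fi mh; apply.
exists M; split; first exact: num_real.
by move=> N MN x Dx; apply: (le_trans (hM x Dx)); exact: ltW.
Qed.

Section Caratheodory.
Context d (X : measurableType d) (R : realType).

Lemma cvg_floor_approx (v : R) :
  (Num.floor (n.+1%:R * v))%:~R / n.+1%:R @[n --> \oo] --> v.
Proof.
apply/cvgrPdist_le => e e0.
have [N _ HN] := near_infty_natSinv_lt (PosNum e0).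
exists N => // n /HN /= /ltW; apply: le_trans.
have n0 : 0 < n.+1%:R :> R by [].
have -> : v - (Num.floor (n.+1%:R * v))%:~R / n.+1%:R =
  (n.+1%:R * v - (Num.floor (n.+1%:R * v))%:~R) / n.+1%:R by field; rewrite gt_eqF.
rewrite normrM (ger0_norm (_ : 0 <= n.+1%:R^-1))// -[leRHS]mul1r ler_wpM2r//.
rewrite ger0_norm ?subr_ge0 ?floor_le// lerBlDl.
by have := ltW (floorD1_gt (n.+1%:R * v)); rewrite intrD addrC.
Qed.

Lemma measurable_floor_set (a : R) (k : int) :
  measurable [set v : R | Num.floor (a * v) = k].
Proof.
have -> : [set v : R | Num.floor (a * v) = k] =
  ( *%R a) @^-1` `[k%:~R, (k + 1)%:~R[.
  apply/seteqP; split=> v /=; rewrite in_itv/=.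
    by move=> <-; rewrite floor_le floorD1_gt.
  by move=> H; apply/floor_def.
by rewrite -[X in measurable X]setTI; apply: mulrl_measurable.
Qed.

(** Rounding the real variable down to a multiple of 1 / (n + 1) gives functions
    glued from countably many sections, hence measurable, and they converge to u
    by continuity in the real variable. *)
Lemma caratheodory_measurable (u : X * R -> R) :
  (forall v, measurable_fun setT (fun x => u (x, v))) ->
  (forall x, continuous (fun v => u (x, v))) ->
  measurable_fun setT u.
Proof.
move=> mu cu.
pose h n (p : X * R) := u (p.1, (Num.floor (n.+1%:R * p.2))%:~R / n.+1%:R).
apply: (@measurable_fun_cvg _ _ _ _ h); last first.
  move=> [x v] _; have := cu x v; rewrite /continuous_at/= => H.
  exact: (cvg_comp _ _ (cvg_floor_approx (v := v)) H).
move=> n _ /= B mB; rewrite setTI.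
have -> : h n @^-1` B = \bigcup_(k : int)
   (((fun x => u (x, k%:~R / n.+1%:R)) @^-1` B) `*`
    [set v | Num.floor (n.+1%:R * v) = k]).
  apply/seteqP; split=> [[x v] /= H|[x v] [k _ [/= H kE]]].
    by exists (Num.floor (n.+1%:R * v)).
  by rewrite /h/= kE.
apply: countable_bigcupT_measurable => // k.
apply: measurableX; last exact: measurable_floor_set.
by rewrite -[X in measurable X]setTI; exact: mu.
Qed.
End Caratheodory.

Lemma continuous_pair_at (T U V : topologicalType) (f : T -> U) (g : T -> V) t :
  {for t, continuous f} -> {for t, continuous g} ->
  {for t, continuous (fun t => (f t, g t))}.
Proof. by move=> cf cg; apply: (cvg_pair cf cg). Qed.

Lemma continuous_triple_at (T U V W : topologicalType)
    (f : T -> U) (g : T -> V) (h : T -> W) t :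
  {for t, continuous f} -> {for t, continuous g} -> {for t, continuous h} ->
  {for t, continuous (fun t => (f t, g t, h t))}.
Proof.
by move=> cf cg ch; apply: (continuous_pair_at (continuous_pair_at cf cg) ch).
Qed.

Lemma continuous_measurable_fun3 (R : realType) (u : R * R * R -> R) :
  continuous u -> measurable_fun setT u.
Proof.
move=> cu; have C := @cst_continuous R R.
have I : continuous (@id R) by move=> ?; exact: cvg_id.
have cu' (f g h : R -> R) : continuous f -> continuous g -> continuous h ->
    continuous (fun s => u (f s, g s, h s)).
  move=> cf cg ch s.
  apply: (@continuous_comp _ _ _ (fun s => (f s, g s, h s)) u); last exact: cu.
  exact: continuous_triple_at (cf s) (cg s) (ch s).
apply: caratheodory_measurable => [v|[t x]]; last exact: (cu' _ _ _ (C t) (C x) I).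
apply: (@caratheodory_measurable _ R R (fun p => u (p, v))) => [x|t].
- by apply: continuous_measurable_fun; apply: (cu' _ _ _ I (C x) (C v)).
- exact: (cu' _ _ _ (C t) I (C v)).
Qed.

(** * Translations and periodic functions *)
Section Translation.
Context (R : realType).
Local Notation mu := (@lebesgue_measure R).
Implicit Types (a : R) (f : R -> \bar R) (D N : set R).

Let sh a : measurableTypeR R -> measurableTypeR R := fun x => (x : R) + a.

Let msh a : measurable_fun setT (sh a).
Proof. by apply: measurable_funD => //; exact: measurable_cst. Qed.

Lemma lebesgue_measure_shift a D : measurable D ->
  mu ((fun x => x + a) @^-1` D) = mu D.
Proof.
move=> mD; apply/esym.
pose m : {measure set (measurableTypeR R) -> \bar R} := pushforward mu (sh a).
suff E X : ocitv X -> mu X = m (msh a) X.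
  exact: (lebesgue_measure_unique (mu := m (msh a)) E mD).
move=> [[x y]] _ <-; rewrite /m/= /pushforward.
have -> : sh a @^-1` `]x, y]%classic = `]x - a, y - a]%classic.
  by apply/seteqP; split=> z; rewrite /sh/= !in_itv/= ltrBlDr lerBrDr.
rewrite !lebesgue_measure_itv/= !lte_fin ltrD2r.
by case: ifP => // _; rewrite -!EFinB; congr (_%:E); ring.
Qed.

Lemma ge0_integral_shift a D f : measurable D -> measurable_fun D f ->
  (forall x, D x -> 0 <= f x)%E ->
  (\int[mu]_(x in (fun x => x + a)%R @^-1` D) f (x + a)%R = \int[mu]_(x in D) f x)%E.
Proof.
move=> mD mf f0.
rewrite -[LHS](@ge0_integral_pushforward _ _ _ _ _ _ (msh a) mu D f)//; last first.
  by move=> x /set_mem; exact: f0.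
apply: eq_measure_integral => A mA _.
exact: lebesgue_measure_shift.
Qed.

Lemma negligible_shift a N : mu.-negligible N ->
  mu.-negligible ((fun x => x + a) @^-1` N).
Proof.
move=> [Z [mZ Z0 NZ]]; exists ((fun x => x + a) @^-1` Z); split.
- by rewrite -[X in measurable X]setTI; exact: (msh a).
- by rewrite -[RHS]Z0; exact: lebesgue_measure_shift.
- by move=> x /=; exact: NZ.
Qed.

End Translation.

Section Periodic.
Context (R : realType).
Local Notation mu := (@lebesgue_measure R).
Local Notation torus := (@torus R).

Lemma two_pi_gt0 : 0 < 2 * pi :> R.
Proof. by rewrite mulr_gt0// pi_gt0. Qed.

Lemma measurable_torus : measurable torus.
Proof. exact: measurable_itv. Qed.

Lemma periodicDn T (u : R -> T) : periodic u ->
  forall (n : nat) x, u (x + n%:R * (2 * pi)) = u x.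
Proof.
move=> pu; elim=> [|n IH] x; first by rewrite mul0r addr0.
by rewrite -natr1 mulrDl mul1r addrA pu IH.
Qed.

Lemma periodicDz T (u : R -> T) : periodic u ->
  forall (k : int) x, u (x + k%:~R * (2 * pi)) = u x.
Proof.
move=> pu [n|n] x; first exact: periodicDn.
rewrite NegzE rmorphN/= -[RHS]/(u x) -[in RHS](subrK (n.+1%:R * (2 * pi)) x).
by rewrite periodicDn// mulNr.
Qed.

Lemma torus_decomp (x : R) : exists (k : int) (y : R),
  x = y + k%:~R * (2 * pi) /\ 0 <= y < 2 * pi.
Proof.
have p0 := two_pi_gt0.
exists (Num.floor (x / (2 * pi))), (x - (Num.floor (x / (2 * pi)))%:~R * (2 * pi)).
rewrite subrK; split=> //; rewrite subr_ge0 -ler_pdivlMr// floor_le/=.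
rewrite ltrBlDr -[X in _ < X + _]mul1r -mulrDl -ltr_pdivrMr// addrC.
by have := floorD1_gt (x / (2 * pi)); rewrite intrD.
Qed.

(** The line is a countable union of translates of the torus. *)
Lemma negligible_periodic (N : set R) : periodic N ->
  mu.-negligible (N `&` torus) -> mu.-negligible N.
Proof.
move=> pN nN.
have Hk (k : int) : mu.-negligible ((fun x => x + (- k)%:~R * (2 * pi)) @^-1` (N `&` torus)).
  exact: negligible_shift.
pose k_ n : int := odflt 0 (unpickle n).
have Hb : mu.-negligible (\bigcup_n
    ((fun x => x + (- k_ n)%:~R * (2 * pi)) @^-1` (N `&` torus))).
  by apply: negligible_bigcup => n; exact: Hk.
apply: negligibleS Hb => x Nx.
have [k [y [xy /andP[y0 y2]]]] := torus_decomp x.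
exists (pickle k) => //=; rewrite /k_ pickleK/= xy rmorphN/= mulNr addrK; split.
  by move: Nx; rewrite xy periodicDz.
by rewrite /torus/= in_itv/= y0 ltW.
Qed.

(** Half-open periods can be cut into disjoint pieces of the same kind. *)
Lemma integral_torus_bndo (f : R -> \bar R) : measurable_fun setT f ->
  (\int[mu]_(x in torus) f x = \int[mu]_(x in `[0%R, (2 * pi)%R[) f x)%E.
Proof.
move=> mf; rewrite /torus (@integral_itv_bndo_bndc _ _ (2 * pi)%R)//.
exact: measurable_funS mf.
Qed.

(** For 0 <= a < 2 pi the translated period [a, 2 pi + a) is cut at 2 pi; its
    last piece is the translate by 2 pi of the piece [0, a) that it lacks. *)
Lemma ge0_integral_periodic (f : R -> \bar R) (a : R) :
  measurable_fun setT f -> (forall x, 0 <= f x)%E -> periodic f ->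
  (\int[mu]_(x in torus) f (x + a)%R = \int[mu]_(x in torus) f x)%E.
Proof.
move=> mf f0 pf.
wlog /andP[a0 a2] : a / 0 <= a < 2 * pi.
  have [k [b [-> b2]]] := torus_decomp a.
  move=> /(_ b b2) <-; apply: eq_integral => x _.
  by rewrite addrA periodicDz.
have mfS D : measurable_fun D f by exact: measurable_funS mf.
have pimg c (x y : R) : (fun x => x + c) @^-1` `[x, y[%classic = `[x - c, y - c[%classic.
  by apply/seteqP; split=> z; rewrite /=!in_itv/= lerBlDr ltrBrDr.
rewrite !integral_torus_bndo//; last first.
  by apply: measurableT_comp => //; apply: measurable_funD => //; exact: measurable_cst.
have := @ge0_integral_shift R a `[a, 2 * pi + a[%classic f.
rewrite pimg subrr addrK => -> //.
have split_itv (x y z : R) : x <= y -> y <= z ->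
    (\int[mu]_(x in `[x, z[) f x = \int[mu]_(x in `[x, y[) f x + \int[mu]_(x in `[y, z[) f x)%E.
  move=> xy yz; rewrite (@itv_bndbnd_setU _ _ _ (BLeft y)) ?bnd_simp//.
  rewrite ge0_integral_setU //; first exact: mfS.
  apply/disj_setPS => w [/=].
  rewrite !in_itv/= => /andP[_ h] /andP[h' _].
  by move: (lt_le_trans h h'); rewrite ltxx.
have T : 2 * pi <= 2 * pi + a by rewrite lerDl.
rewrite (split_itv a (2 * pi) (2 * pi + a) (ltW a2) T).
rewrite [RHS](split_itv 0 a (2 * pi) a0 (ltW a2)) addeC; congr (_ + _)%E.
have := @ge0_integral_shift R (2 * pi) `[2 * pi, 2 * pi + a[%classic f.
rewrite pimg subrr addrAC subrr add0r => <- //.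
by apply: eq_integral => x _; rewrite pf.
Qed.

Lemma integral_periodic (f : R -> \bar R) (a : R) :
  measurable_fun setT f -> periodic f ->
  (\int[mu]_(x in torus) f (x + a)%R = \int[mu]_(x in torus) f x)%E.
Proof.
move=> mf pf; rewrite [LHS]integralE [RHS]integralE; congr (_ - _)%E.
- rewrite -[RHS](ge0_integral_periodic a)//; last 2 first.
    exact: measurable_funepos.
    by move=> x; rewrite !funeposE pf.
  by apply: eq_integral => x _; rewrite !funeposE.
- rewrite -[RHS](ge0_integral_periodic a)//; last 2 first.
    exact: measurable_funeneg.
    by move=> x; rewrite !funenegE pf.
  by apply: eq_integral => x _; rewrite !funenegE.
Qed.

Lemma Rintegral_periodic (f : R -> R) (a : R) :
  measurable_fun setT f -> periodic f ->
  \int[mu]_(x in torus) f (x + a) = \int[mu]_(x in torus) f x.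
Proof.
move=> mf pf; congr fine; apply: (integral_periodic (f := EFin \o f)).
  exact/measurable_EFinP.
by move=> x /=; rewrite pf.
Qed.

Lemma integrable_periodic (f : R -> R) (a : R) :
  measurable_fun setT f -> periodic f ->
  mu.-integrable torus (EFin \o f) ->
  mu.-integrable torus (fun x => (f (x + a))%:E).
Proof.
move=> mf pf /integrableP[_ fi]; apply/integrableP; split.
  apply/measurable_EFinP; apply: measurable_funS measurableT _ _ => //.
  by apply: measurableT_comp => //; apply: measurable_funD => //; exact: measurable_cst.
apply: le_lt_trans fi; rewrite -[leRHS](ge0_integral_periodic a)//.
- by apply: measurableT_comp => //; exact/measurable_EFinP.
- by move=> x /=; rewrite pf.
Qed.

End Periodic.

(** * Uniqueness of Fourier coefficients *)
Section CosinePolynomials.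
Context (R : realType).
Local Notation mu := (@lebesgue_measure R).
Local Notation torus := (@torus R).

Lemma measurable_cos_affine (a b : R) (D : set R) : measurable_fun D (fun x => cos (a * x + b)).
Proof.
apply: measurable_funTS; apply: continuous_measurable_fun => x.
apply: continuous_comp; last exact: continuous_cos.
by apply: cvgD; [apply: cvgM; [exact: cvg_cst|exact: cvg_id]|exact: cvg_cst].
Qed.

Lemma cos_norm_le1 (x : R) : `|cos x| <= 1.
Proof. by rewrite ler_norml cos_geN1 cos_le1. Qed.

Lemma poly_bounded (p : {poly R}) :
  exists M, forall z, `|z| <= 1 -> `|p.[z]| <= M.
Proof.
elim/poly_ind: p => [|p c [M HM]].
  by exists 0 => z _; rewrite horner0 normr0.
exists (M + `|c|) => z z1; rewrite hornerMXaddC.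
rewrite (le_trans (ler_normD _ _))// lerD2r normrM -[leRHS]mulr1.
by rewrite ler_pM// HM.
Qed.

Lemma measurable_horner_cos (p : {poly R}) (m : R) (D : set R) :
  measurable_fun D (fun x => p.[cos (x - m)]).
Proof.
elim/poly_ind: p => [|p c IH].
  by under eq_fun do rewrite horner0; exact: measurable_cst.
under eq_fun do rewrite hornerMXaddC.
apply: measurable_funD; last exact: measurable_cst.
apply: measurable_funM => //.
by under eq_fun do rewrite -[X in X - m]mul1r; exact: measurable_cos_affine.
Qed.

Section Orthogonality.
Variable u : R -> R.
Hypothesis iu : mu.-integrable torus (EFin \o u).
Hypothesis u0 : forall (l : int) (b : R),
  \int[mu]_(x in torus) (u x * cos (l%:~R * x + b)) = 0.

Let mT : measurable (torus : set (measurableTypeR R)) := @measurable_torus R.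

(** Induction on p: the product of two cosines is a sum of cosines, so that
    multiplication by cos (x - m) shifts the frequency l by one on both sides. *)
Lemma orthogonal_poly_cos (m : R) (p : {poly R}) (l : int) (b : R) :
  \int[mu]_(x in torus) (u x * (cos (l%:~R * x + b) * p.[cos (x - m)])) = 0.
Proof.
elim/poly_ind: p l b => [|p c IH] l b.
  by under eq_Rintegral do rewrite horner0 !mulr0; rewrite Rintegral_cst// mul0r.
have I (l' : int) (b' : R) : mu.-integrable torus
    (fun x => (u x * (cos (l'%:~R * x + b') * p.[cos (x - m)]))%:E).
  have [M HM] := poly_bounded p.
  apply: (integrable_mulr_bounded (M := M)) => //.
  - apply: measurable_funM; first exact: measurable_cos_affine.
    exact: measurable_horner_cos.
  - move=> x _; rewrite normrM -[leRHS]mul1r ler_pM ?cos_norm_le1// HM//.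
    exact: cos_norm_le1.
have I1 : mu.-integrable torus (fun x => (u x * cos (l%:~R * x + b))%:E).
  apply: (integrable_mulr_bounded (M := 1)) => //.
  - exact: measurable_cos_affine.
  - by move=> x _; exact: cos_norm_le1.
under eq_Rintegral => x _.
  rewrite hornerMXaddC (_ : u x * _ =
    2^-1 * (u x * (cos ((l + 1)%:~R * x + (b - m)) * p.[cos (x - m)]) +
     u x * (cos ((l - 1)%:~R * x + (b + m)) * p.[cos (x - m)])) +
    c * (u x * cos (l%:~R * x + b))); last first.
    have -> : (l + 1)%:~R * x + (b - m) = (l%:~R * x + b) + (x - m).
      by rewrite rmorphD/=; ring.
    have -> : (l - 1)%:~R * x + (b + m) = (l%:~R * x + b) - (x - m).
      by rewrite rmorphB/=; ring.
    rewrite (cosB (l%:~R * x + b) (x - m)) (cosD (l%:~R * x + b) (x - m)).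
    by field.
  over.
have J := integrableD mT (I (l + 1) (b - m)) (I (l - 1) (b + m)).
rewrite RintegralD//=; last 2 first.
- exact: (integrableZl mT 2^-1 J).
- exact: (integrableZl mT c I1).
rewrite (RintegralZl 2^-1 mT J) (RintegralZl c mT I1).
rewrite RintegralD//; last 2 first.
- exact: I.
- exact: I.
by rewrite !IH u0 !addr0 !mulr0 addr0.
Qed.

End Orthogonality.
End CosinePolynomials.

Section PeakPolynomials.
Context (R : realType).

Lemma bernoulli_ineq (x : R) n : -1 <= x -> 1 + n%:R * x <= (1 + x) ^+ n.
Proof.
move=> x1; elim: n => [|n IH]; first by rewrite mul0r addr0 expr0.
rewrite exprS -natr1 mulrDl mul1r.
apply: le_trans (ler_wpM2l _ IH); last by rewrite -lerBlDl sub0r.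
have : 0 <= n%:R * x ^+ 2 by rewrite mulr_ge0// sqr_ge0.
by rewrite expr2; nra.
Qed.

(** The polynomials of the elementary proof of the Stone-Weierstrass theorem: on
    [0, 1] they tend to 0 below 1/2 and to 1 above it. *)
Definition step_poly (n : nat) (a : R) : R := 1 - (1 - a ^+ n) ^+ (2 ^ n).

Lemma step_poly_itv n a : 0 <= a <= 1 -> 0 <= step_poly n a <= 1.
Proof.
move=> /andP[a0 a1]; rewrite /step_poly.
have b1 : 0 <= 1 - a ^+ n by rewrite subr_ge0 exprn_ile1.
have b2 : 1 - a ^+ n <= 1 by rewrite gerBl exprn_ge0.
by rewrite subr_ge0 exprn_ile1//= gerBl exprn_ge0.
Qed.

(** By Bernoulli's inequality (1 - a^n)^(2^n) >= 1 - (2 a)^n. *)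
Lemma step_poly_low a : 0 <= a < 2^-1 -> step_poly n a @[n --> \oo] --> (0 : R).
Proof.
move=> /andP[a0 a2].
have a21 : `|2 * a| < 1 by rewrite ger0_norm ?mulr_ge0//; lra.
apply: (squeeze_cvgr _ (cvg_cst 0) (cvg_expr a21)); near=> n.
have a01 : 0 <= a <= 1 by rewrite a0/=; lra.
have /andP[-> _] := step_poly_itv n a01.
rewrite /step_poly/= lerBlDr -lerBlDl exprMn.
apply: le_trans (bernoulli_ineq _ _).
  by rewrite natrX mulrN.
by rewrite lerN2 exprn_ile1//; lra.
Unshelve. all: by end_near. Qed.

(** With b = a^n one has (1 - b)^(2^n) (1 + b)^(2^n) <= 1, while Bernoulli's
    inequality gives (1 + b)^(2^n) >= (2 a)^n; so (1 - b)^(2^n) <= (2 a)^(-n). *)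
Lemma step_poly_high a : 2^-1 < a <= 1 -> step_poly n a @[n --> \oo] --> (1 : R).
Proof.
move=> /andP[a2 a1].
have a0 : 0 < a by lra.
have a21 : `|(2 * a)^-1| < 1.
  by rewrite ger0_norm ?invr_ge0 ?mulr_ge0 ?ltW// invf_lt1 ?mulr_gt0//; lra.
have H : 1 - (2 * a)^-1 ^+ n @[n --> \oo] --> (1 : R).
  by rewrite -[X in _ --> X]subr0; apply: cvgB; [exact: cvg_cst|exact: cvg_expr].
apply: squeeze_cvgr H (@cvg_cst _ (1 : R) _ _ _); near=> n.
have a01 : 0 <= a <= 1 by rewrite ltW.
have /andP[_ ->] := step_poly_itv n a01; rewrite andbT /step_poly lerD2l lerN2.
set b := a ^+ n; have b0 : 0 < b by rewrite exprn_gt0.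
have b1 : b <= 1 by rewrite exprn_ile1// ltW.
rewrite exprVn -[X in _ <= X]mul1r ler_pdivlMr ?exprn_gt0 ?mulr_gt0//.
rewrite exprMn -natrX -/b.
apply: le_trans (_ : (1 - b) ^+ (2 ^ n) * (1 + b) ^+ (2 ^ n) <= 1).
  apply: ler_wpM2l; first by rewrite exprn_ge0// subr_ge0.
  by apply: le_trans (bernoulli_ineq _ _); [rewrite lerDr|lra].
rewrite -exprMn exprn_ile1//; nra.
Unshelve. all: by end_near. Qed.

End PeakPolynomials.

Section Arcs.
Context (R : realType).
Local Notation mu := (@lebesgue_measure R).
Local Notation torus := (@torus R).
Let mT : measurable (torus : set (measurableTypeR R)) := @measurable_torus R.

(** For cos d >= 0, the affine function of cos x that vanishes at cos x = - 1 and
    is 1/2 at cos x = cos d; its values are in [0, 1]. *)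
Definition arc_param (d x : R) : R := (1 + cos x) / (2 * (1 + cos d)).

Lemma cos_normr (x : R) : cos `|x| = cos x.
Proof.
have [x0|x0] := lerP 0 x; first by rewrite ger0_norm.
by rewrite ltr0_norm// cosN.
Qed.

Lemma cos_lt_near (d x : R) : 0 <= d -> d <= pi -> `|x| < d -> cos d < cos x.
Proof.
move=> d0 dpi xd.
rewrite -(cos_normr x).
by rewrite ltr_cos ?in_itv/= ?d0//= normr_ge0/= (le_trans (ltW xd)).
Qed.

Lemma cos_lt_far (d x : R) : 0 <= d -> d <= pi -> d < `|x| < 2 * pi - d ->
  cos x < cos d.
Proof.
move=> d0 dpi /andP[xd x2].
rewrite -(cos_normr x).
have [xpi|xpi] := lerP `|x| pi.
  by rewrite ltr_cos ?in_itv/= ?d0//= normr_ge0.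
have -> : cos `|x| = cos (2 * pi - `|x|).
  by rewrite -cosN -(cosD2pi (- `|x|)) addrC mulr_natl.
by rewrite ltr_cos ?in_itv/= ?d0//=; lra.
Qed.

Variable u : R -> R.
Hypothesis iu : mu.-integrable torus (EFin \o u).
Hypothesis u0 : forall (l : int) (b : R),
  \int[mu]_(x in torus) (u x * cos (l%:~R * x + b)) = 0.

(** The functions [step_poly n (arc_param d (x - m))] are polynomials in
    cos (x - m), to which u is orthogonal, and they converge boundedly and almost
    everywhere to the indicator of the arc. *)
Lemma integral_arc_eq0 (m d : R) : 0 <= d <= pi / 2 -> d <= m <= 2 * pi - d ->
  \int[mu]_(x in `[m - d, m + d]) u x = 0.
Proof.
move=> /andP[d0 d2] /andP[md m2].
have pi0 := pi_gt0 R.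
have dpi : d <= pi by lra.
have cd0 : 0 <= cos d by rewrite cos_ge0_pihalf//; lra.
pose P x := arc_param d (x - m).
have P01 x : 0 <= P x <= 1.
  rewrite /P /arc_param; apply/andP; split.
    by rewrite divr_ge0//; have := cos_geN1 (x - m); lra.
  by rewrite ler_pdivrMr; have := cos_le1 (x - m); lra.
pose k := (2 * (1 + cos d))^-1.
pose p n : {poly R} := 1 - (1 - (k *: (1 + 'X)) ^+ n) ^+ (2 ^ n).
have pE n x : (p n).[cos (x - m)] = step_poly n (P x).
  rewrite /p /step_poly /P /arc_param !hornerE_comm/=.
  by rewrite !(hornerE, horner_exp) mulrC.
pose f_ n x := (u x * step_poly n (P x))%:E.
have f0 n : (\int[mu]_(x in torus) f_ n x = 0)%E.
  have := orthogonal_poly_cos iu u0 m (p n) 0 0.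
  under eq_Rintegral do rewrite mul0r addr0 cos0 mul1r pE.
  move=> H; rewrite -[LHS]fineK; last first.
    apply: integrable_fin_num => //.
    apply: (integrable_mulr_bounded (M := 1)) => //.
      by under eq_fun do rewrite -pE; exact: measurable_horner_cos.
    move=> x _; have /andP[q0 q1] := step_poly_itv n (P01 x).
    by rewrite ger0_norm.
  by congr (_%:E).
have mS n : measurable_fun (torus : set (measurableTypeR R)) (fun x => step_poly n (P x)).
  by under eq_fun do rewrite -pE; exact: measurable_horner_cos.
have mu_ : measurable_fun (torus : set (measurableTypeR R)) u.
  by apply/measurable_EFinP; exact: measurable_int iu.
have sub : `[m - d, m + d] `<=` torus.
  by move=> x /=; rewrite /torus/= !in_itv/=; lra.
have mA : measurable (`[m - d, m + d] : set (measurableTypeR R)) by exact: measurable_itv.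
have Hm n : measurable_fun (torus : set (measurableTypeR R)) (f_ n).
  by apply/measurable_EFinP; exact: (measurable_funM mu_ (mS n)).
have Hf : measurable_fun (torus : set (measurableTypeR R)) (EFin \o (u \_ `[m - d, m + d])).
  apply/measurable_EFinP/measurable_restrict => //.
  by apply: measurable_funS mu_ => //; exact: subIsetl.
have Hae : {ae mu, forall x, torus x ->
    f_ ^~ x @ \oo --> (EFin \o (u \_ `[m - d, m + d])) x}.
  (* Besides the ends of the arc, 0 and 2 pi are excluded: their distance to m
     may be 2 pi - d, and then cos (x - m) = cos d. *)
  have N0 : mu.-negligible [set m - d; m + d; 0; 2 * pi].
    apply/negligibleP; last first.
      apply: countable_lebesgue_measure0; apply: finite_set_countable.
      by rewrite !finite_setU; do !split; exact: finite_set1.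
    by rewrite -!setUA; do ?apply: measurableU; exact: measurable_set1.
  apply: negligibleS N0 => x /=; apply: contra_notP => Nx xT.
  have {xT} /andP[x0 x2] : 0 <= x <= 2 * pi by move: xT; rewrite /torus/= in_itv.
  have n1 : x != m - d by apply/eqP => E; apply: Nx; do 3 left.
  have n2 : x != m + d by apply/eqP => E; apply: Nx; do 2 left; right.
  have n3 : x != 0 by apply/eqP => E; apply: Nx; left; right.
  have n4 : x != 2 * pi by apply/eqP => E; apply: Nx; right.
  have x0' : 0 < x by rewrite lt_neqAle eq_sym n3.
  have x2' : x < 2 * pi by rewrite lt_neqAle n4.
  rewrite /f_ /=; apply/cvg_EFin; first by near=> n.
  rewrite /comp/= patchE; case: ifPn => [|].
    rewrite inE/= in_itv/= => /andP[h1 h2].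
    have : cos d < cos (x - m).
      apply: cos_lt_near => //; rewrite ltr_norml.
      have : m - d < x by rewrite lt_neqAle eq_sym n1.
      have : x < m + d by rewrite lt_neqAle n2.
      lra.
    move=> H; rewrite -[X in _ --> X]mulr1; apply: cvgM; first exact: cvg_cst.
    apply: step_poly_high; have /andP[_ ->] := P01 x; rewrite andbT.
    by rewrite /P /arc_param ltr_pdivlMr; lra.
  rewrite notin_setE/= in_itv/= => /negP h.
  have : cos (x - m) < cos d.
    apply: cos_lt_far => //; apply/andP; split.
      by rewrite ltNge ler_norml; apply/negP => h'; move: h; lra.
    by rewrite ltr_norml; lra.
  move=> H; rewrite -[X in _ --> X](mulr0 (u x)); apply: cvgM; first exact: cvg_cst.
  apply: step_poly_low; have /andP[-> _] := P01 x.
  by rewrite /P /arc_param ltr_pdivrMr; lra.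
have Hg : mu.-integrable torus (fun x => (`|u x|)%:E).
  exact: integrable_norm.
have Hb : {ae mu, forall x n, torus x -> (`|f_ n x| <= (`|u x|)%:E)%E}.
  apply: aeW => x n xT; rewrite /f_/= lee_fin normrM ler_piMr//.
  by have /andP[q0 q1] := step_poly_itv n (P01 x); rewrite ger0_norm.
have [_ _ H] := dominated_convergence mT Hm Hf Hae Hg Hb.
rewrite -(setIidr sub).
rewrite Rintegral_mkcondr /Rintegral.
have -> : (\int[mu]_(x in torus) ((u \_ `[m - d, m + d]) x)%:E = 0)%E.
  apply: (cvg_unique _ H) => //.
  by apply: cvg_near_cst; near=> n; exact: f0.
by [].
Unshelve. all: by end_near. Qed.

(** The interval [0, x] is an arc of radius at most pi / 2 if x <= pi, and else
    [x, 2 pi] is one and the integral over the torus is 0. So the primitive of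
    u is constant, and u vanishes by Lebesgue's differentiation theorem. *)
Theorem ae_eq0_cos_moments : {ae mu, forall x, torus x -> u x = 0}.
Proof.
pose w := u \_ torus.
have mw : mu.-integrable setT (EFin \o w).
  by rewrite /w -restrict_EFin; exact: (integrable_mkcond _ mT).1 iu.
have iw (x : R) : mu.-integrable `]-oo, x] (EFin \o w).
  by apply: integrableS mw => //; exact: measurable_itv.
have Iw x : 0 <= x <= 2 * pi -> \int[mu]_(t in `[0, x]) u t = 0.
  move=> /andP[x0 x2]; have pi0 := pi_gt0 R.
  have [xpi|xpi] := lerP x pi.
    have := @integral_arc_eq0 (x / 2) (x / 2).
    rewrite subrr -splitr; apply; lra.
  have T0 : \int[mu]_(t in torus) u t = 0.
    by rewrite -(u0 0 0); apply: eq_Rintegral => t _; rewrite mul0r addr0 cos0 mulr1.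
  have := @Rintegral_itvB R u (BLeft 0) (BRight (2 * pi)) x iu.
  rewrite -/torus T0 => /(_ _ _)/eqP; rewrite !bnd_simp => /(_ x0 x2).
  rewrite sub0r Rintegral_itv_obnd_cbnd//; last first.
    by apply: integrableS iu => //; apply: subset_itv; rewrite bnd_simp.
  have := @integral_arc_eq0 ((x + 2 * pi) / 2) ((2 * pi - x) / 2).
  rewrite (_ : (x + 2 * pi) / 2 - (2 * pi - x) / 2 = x); last lra.
  rewrite (_ : (x + 2 * pi) / 2 + (2 * pi - x) / 2 = 2 * pi); last lra.
  move=> -> //; [|lra|lra].
  by rewrite oppr_eq0 => /eqP.
have W0 x : \int[mu]_(t in `]-oo, x]) w t = 0.
  rewrite /w -Rintegral_mkcondr; have pi0 := pi_gt0 R.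
  have [x0|x0] := ltP x 0.
    rewrite (_ : _ `&` _ = set0) ?Rintegral_set0//.
    by apply/seteqP; split=> // t []/=; rewrite /torus/= !in_itv/=; lra.
  have [x2|x2] := lerP x (2 * pi).
    rewrite (_ : _ `&` _ = `[0, x]%classic); first by apply: Iw; rewrite x0.
    by apply/seteqP; split=> t /=; rewrite /torus/= !in_itv/=; lra.
  rewrite (_ : _ `&` _ = `[0, 2 * pi]%classic); first by apply: Iw; lra.
  by apply/seteqP; split=> t /=; rewrite /torus/= !in_itv/=; lra.
have := FTC1Ny iw (open_integrable_locally openT mw).
apply: filterS; first exact: (ae_filter_ringOfSetsType mu).
move=> x /= [_ +] xT.
rewrite (_ : (fun x => _) = cst 0); last by apply/funext => y; exact: W0.
by rewrite derive1_cst /w patchE mem_set.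
Qed.
End Arcs.

(** * Complex-valued functions *)
Section ComplexAlgebra.
Context (R : realType).
Implicit Types (z w : R[i]) (a b x : R).

Lemma cReD z w : complex.Re (z + w) = complex.Re z + complex.Re w.
Proof. by case: z; case: w. Qed.
Lemma cImD z w : complex.Im (z + w) = complex.Im z + complex.Im w.
Proof. by case: z; case: w. Qed.
Lemma cReN z : complex.Re (- z) = - complex.Re z.
Proof. by case: z. Qed.
Lemma cImN z : complex.Im (- z) = - complex.Im z.
Proof. by case: z. Qed.
Lemma cReM z w : complex.Re (z * w) =
  complex.Re z * complex.Re w - complex.Im z * complex.Im w.
Proof. by case: z; case: w. Qed.
Lemma cImM z w : complex.Im (z * w) =
  complex.Re z * complex.Im w + complex.Im z * complex.Re w.
Proof. by case: z; case: w. Qed.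
Lemma ReC a : complex.Re (a%:C) = a. Proof. by []. Qed.
Lemma complexP z w :
  complex.Re z = complex.Re w -> complex.Im z = complex.Im w -> z = w.
Proof. by case: z; case: w => a b c d /= -> ->. Qed.

Lemma Re_sum I (r : seq I) (P : pred I) (F : I -> R[i]) :
  complex.Re (\sum_(i <- r | P i) F i) = \sum_(i <- r | P i) complex.Re (F i).
Proof. exact: (big_morph _ cReD). Qed.
Lemma Im_sum I (r : seq I) (P : pred I) (F : I -> R[i]) :
  complex.Im (\sum_(i <- r | P i) F i) = \sum_(i <- r | P i) complex.Im (F i).
Proof. exact: (big_morph _ cImD). Qed.

Lemma sqnorm_ge0 z : 0 <= sqnorm z.
Proof. by rewrite addr_ge0// sqr_ge0. Qed.
Lemma sqnormM z w : sqnorm (z * w) = sqnorm z * sqnorm w.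
Proof. by rewrite /sqnorm cReM cImM; ring. Qed.
Lemma sqnormN z : sqnorm (- z) = sqnorm z.
Proof. by rewrite /sqnorm cReN cImN !sqrrN. Qed.
Lemma sqnormC a : sqnorm (a%:C) = a ^+ 2.
Proof. by rewrite /sqnorm/= expr0n/= addr0. Qed.
Lemma sqnorm_conj z : sqnorm (conjc z) = sqnorm z.
Proof. by case: z => a b; rewrite /sqnorm/= sqrrN. Qed.
Lemma sqnorm_expi x : sqnorm (expi x) = 1.
Proof. by rewrite /sqnorm/= cos2Dsin2. Qed.
Lemma sqnormE z : (sqnorm z)%:C = z * conjc z.
Proof. by case: z => a b; apply: complexP; rewrite /sqnorm ?cReM ?cImM/=; ring. Qed.
Lemma sqnormD_le z w : sqnorm (z + w) <= 2 * sqnorm z + 2 * sqnorm w.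
Proof.
rewrite -subr_ge0 (_ : _ - _ = sqnorm (z - w)) ?sqnorm_ge0//.
by rewrite /sqnorm !cReD !cImD cReN cImN; ring.
Qed.
Lemma sqnorm_eq0 z : sqnorm z = 0 -> z = 0.
Proof.
move=> /eqP; rewrite paddr_eq0 ?sqr_ge0// !sqrf_eq0 => /andP[/eqP a /eqP b].
exact: complexP.
Qed.
Lemma Re_sqr_le z : complex.Re z ^+ 2 <= sqnorm z.
Proof. by rewrite lerDl sqr_ge0. Qed.
Lemma Im_sqr_le z : complex.Im z ^+ 2 <= sqnorm z.
Proof. by rewrite lerDr sqr_ge0. Qed.

Lemma conjC_D z w : conjc (z + w) = conjc z + conjc w.
Proof. by case: z => a b; case: w => c d; apply: complexP => //=; rewrite opprD. Qed.
Lemma conjC_M z w : conjc (z * w) = conjc z * conjc w.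
Proof. by case: z => a b; case: w => c d; apply: complexP => /=; ring. Qed.
Lemma conjC_sum I (r : seq I) (P : pred I) (F : I -> R[i]) :
  conjc (\sum_(i <- r | P i) F i) = \sum_(i <- r | P i) conjc (F i).
Proof. by apply: (big_morph _ conjC_D); apply: complexP; rewrite //= oppr0. Qed.

Lemma expiD a b : expi (a + b) = expi a * expi b.
Proof. by apply: complexP; rewrite ?cReM ?cImM/= ?cosD ?sinD//; ring. Qed.
Lemma expi0 : expi 0 = 1 :> R[i].
Proof. by apply: complexP; rewrite /= ?cos0 ?sin0. Qed.
Lemma conj_expi a : conjc (expi a) = expi (- a).
Proof. by apply: complexP; rewrite /= ?cosN ?sinN. Qed.
Lemma expi_periodic (l : int) : periodic (fun x : R => expi (l%:~R * x)).
Proof.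
have c : periodic (@cos R) by move=> x; rewrite mulr_natl cosD2pi.
have s : periodic (@sin R) by move=> x; rewrite mulr_natl sinD2pi.
by move=> x; rewrite mulrDr /expi (periodicDz c) (periodicDz s).
Qed.

End ComplexAlgebra.

Section ComplexMeasurability.
Context (R : realType).

Lemma CmeasurableM d (T : measurableType d) (D : set T) (u w : T -> R[i]) :
  Cmeasurable D u -> Cmeasurable D w -> Cmeasurable D (fun x => u x * w x).
Proof.
move=> [u1 u2] [w1 w2]; split.
- by under eq_fun do rewrite cReM; apply: measurable_funB; exact: measurable_funM.
- by under eq_fun do rewrite cImM; apply: measurable_funD; exact: measurable_funM.
Qed.

Lemma CmeasurableB d (T : measurableType d) (D : set T) (u w : T -> R[i]) :
  Cmeasurable D u -> Cmeasurable D w -> Cmeasurable D (fun x => u x - w x).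
Proof.
move=> [u1 u2] [w1 w2]; split.
- by under eq_fun do rewrite cReD cReN; exact: measurable_funB.
- by under eq_fun do rewrite cImD cImN; exact: measurable_funB.
Qed.

Lemma CmeasurableT_comp d d' (T : measurableType d) (T' : measurableType d')
    (D : set T) (u : T' -> R[i]) (f : T -> T') :
  Cmeasurable setT u -> measurable_fun D f -> Cmeasurable D (fun x => u (f x)).
Proof.
by move=> [u1 u2] mf; split;
  [exact: (measurableT_comp u1 mf)|exact: (measurableT_comp u2 mf)].
Qed.

Lemma measurable_sqnorm d (T : measurableType d) (D : set T) (u : T -> R[i]) :
  Cmeasurable D u -> measurable_fun D (fun x => sqnorm (u x)).
Proof.
by move=> [u1 u2]; apply: measurable_funD; apply: measurable_funX.
Qed.

Lemma measurable_neq d (T : measurableType d) (D : set T) (u w : T -> R[i]) :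
  measurable D -> Cmeasurable D u -> Cmeasurable D w ->
  measurable (D `&` [set p | u p <> w p]).
Proof.
move=> mD mu_ mw; have mh := measurable_sqnorm (CmeasurableB mu_ mw).
rewrite (_ : [set p | _] = (fun p => sqnorm (u p - w p)) @^-1` [set~ 0]).
  by apply: mh => //; apply: measurableC; exact: measurable_set1.
apply/seteqP; split=> p /= H.
- by move=> /sqnorm_eq0 /eqP; rewrite subr_eq0 => /eqP.
- by move=> E; apply: H; rewrite E subrr /sqnorm/= expr0n/= addr0.
Qed.

Lemma measurable_neqT d (T : measurableType d) (u w : T -> R[i]) :
  Cmeasurable setT u -> Cmeasurable setT w -> measurable [set p | u p <> w p].
Proof. by rewrite -[[set p | _]]setTI; exact: measurable_neq. Qed.

Lemma Cmeasurable_pair1 (u : R -> R -> R[i]) x :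
  Cmeasurable setT (fun p : R * R => u p.1 p.2) -> Cmeasurable setT (u x).
Proof.
by move=> m; exact: (CmeasurableT_comp m (pair1_measurable x)).
Qed.

Lemma Cmeasurable_pair2 (u : R -> R -> R[i]) y :
  Cmeasurable setT (fun p : R * R => u p.1 p.2) -> Cmeasurable setT (u^~ y).
Proof.
by move=> m; exact: (CmeasurableT_comp m (pair2_measurable y)).
Qed.

End ComplexMeasurability.

Section ComplexIntegral.
Context (R : realType).
Local Notation mu := (@lebesgue_measure R).
Local Notation torus := (@torus R).
Implicit Types (u w : R -> R[i]) (z : R[i]).

Definition Cintegrable (D : set R) u :=
  mu.-integrable D (fun x => (complex.Re (u x))%:E) /\
  mu.-integrable D (fun x => (complex.Im (u x))%:E).

Lemma Cintegrable_Cmeasurable (A : set (measurableTypeR R)) u : Cintegrable A u -> Cmeasurable A u.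
Proof.
by move=> [u1 u2]; split; apply/measurable_EFinP;
  [exact: measurable_int u1|exact: measurable_int u2].
Qed.

Section Domain.
Variable D : set (measurableTypeR R).
Hypothesis mD : measurable D.

Lemma eq_Cintegral u w : {in D, u =1 w} -> Cintegral D u = Cintegral D w.
Proof.
by move=> E; rewrite /Cintegral; congr (_ +i* _); apply: eq_Rintegral => x xD; rewrite E.
Qed.

Lemma CintegrableD u w : Cintegrable D u -> Cintegrable D w ->
  Cintegrable D (fun x => u x + w x).
Proof.
move=> [u1 u2] [w1 w2]; split.
- by under eq_fun do rewrite cReD; exact: (integrableD mD u1 w1).
- by under eq_fun do rewrite cImD; exact: (integrableD mD u2 w2).
Qed.

Lemma CintegrableZ z u : Cintegrable D u -> Cintegrable D (fun x => z * u x).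
Proof.
move=> [u1 u2]; split.
- under eq_fun do rewrite cReM.
  exact: (integrableB mD (integrableZl mD _ u1) (integrableZl mD _ u2)).
- under eq_fun do rewrite cImM.
  exact: (integrableD mD (integrableZl mD _ u2) (integrableZl mD _ u1)).
Qed.

Lemma Cintegrable_conj u : Cintegrable D u -> Cintegrable D (fun x => conjc (u x)).
Proof.
move=> [h1 h2]; split.
- by move: h1; apply: eq_integrable => // x _; congr (_%:E); case: (u x).
- by have := integrableN h2; apply: eq_integrable => // x _ /=; case: (u x).
Qed.

Lemma CintegralD u w : Cintegrable D u -> Cintegrable D w ->
  Cintegral D (fun x => u x + w x) = Cintegral D u + Cintegral D w.
Proof.
move=> [u1 u2] [w1 w2]; apply: complexP; rewrite ?cReD ?cImD/=.
- by under eq_Rintegral do rewrite cReD; rewrite RintegralD.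
- by under eq_Rintegral do rewrite cImD; rewrite RintegralD.
Qed.

Lemma CintegralZ z u : Cintegrable D u ->
  Cintegral D (fun x => z * u x) = z * Cintegral D u.
Proof.
move=> [u1 u2]; apply: complexP; rewrite ?cReM ?cImM/=.
- under eq_Rintegral do rewrite cReM.
  rewrite RintegralB//; [|exact: (integrableZl mD _ u1)|exact: (integrableZl mD _ u2)].
  by rewrite !RintegralZl.
- under eq_Rintegral do rewrite cImM.
  rewrite RintegralD//; [|exact: (integrableZl mD _ u2)|exact: (integrableZl mD _ u1)].
  by rewrite !RintegralZl.
Qed.

Lemma Cintegral0 : Cintegral D (fun=> 0) = 0.
Proof. by apply: complexP => /=; rewrite Rintegral_cst// mul0r. Qed.

Lemma Cintegrable0 : Cintegrable D (fun=> 0).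
Proof. by split; exact: integrable0. Qed.

Lemma Cintegrable_sum I (r : seq I) (P : pred I) (F : I -> R -> R[i]) :
  (forall i, Cintegrable D (F i)) ->
  Cintegrable D (fun x => \sum_(i <- r | P i) F i x).
Proof.
move=> iF; elim: r => [|i r IH].
  by under eq_fun do rewrite big_nil; exact: Cintegrable0.
by under eq_fun do rewrite big_cons; case: (P i) => //; exact: CintegrableD.
Qed.

Lemma Cintegral_sum I (r : seq I) (P : pred I) (F : I -> R -> R[i]) :
  (forall i, Cintegrable D (F i)) ->
  Cintegral D (fun x => \sum_(i <- r | P i) F i x) =
  \sum_(i <- r | P i) Cintegral D (F i).
Proof.
move=> iF; elim: r => [|i r IH].
  by under eq_fun do rewrite big_nil; rewrite big_nil Cintegral0.
under eq_fun do rewrite big_cons; rewrite big_cons; case: (P i) => //.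
by rewrite CintegralD// ?IH//; exact: Cintegrable_sum.
Qed.

Lemma Cintegral_conj u : Cintegrable D u ->
  Cintegral D (fun x => conjc (u x)) = conjc (Cintegral D u).
Proof.
move=> [u1 u2]; apply: complexP => /=.
- by apply: eq_Rintegral => x _; case: (u x).
- rewrite -mulN1r -RintegralZl//.
  by apply: eq_Rintegral => x _; case: (u x) => a b /=; rewrite mulN1r.
Qed.

End Domain.

Lemma continuous_expi_affine (a b : R) :
  continuous (fun x => complex.Re (expi (a * x + b))) /\
  continuous (fun x => complex.Im (expi (a * x + b))).
Proof.
by split=> x; (apply: continuous_comp; last by
  [exact: continuous_cos|exact: continuous_sin]);
  apply: cvgD; [apply: cvgM; [exact: cvg_cst|exact: cvg_id]|exact: cvg_cst|
   apply: cvgM; [exact: cvg_cst|exact: cvg_id]|exact: cvg_cst].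
Qed.
End ComplexIntegral.

(** * Square-integrable functions on the torus *)
Section L2Completeness.
Context d (T : measurableType d) (R : realType) (nu : {measure set T -> \bar R}).
Variables (D : set T) (u : nat -> T -> R) (tau : nat -> R).
Hypotheses (mD : measurable D) (nuD : (nu D < +oo)%E).
Hypothesis mu_ : forall n, measurable_fun setT (u n).
Hypothesis tau0 : tau n @[n --> \oo] --> (0 : R).
Hypothesis cau : forall m n,
  (\int[nu]_(x in D) ((u m x - u n x) ^+ 2)%:E <= (tau m + tau n)%:E)%E.

Let wt (j : nat) : R := 1 / (2 ^ j.+1)%:R.

Let wt_gt0 j : 0 < wt j.
Proof. by rewrite divr_gt0// ltr0n expn_gt0. Qed.

Let subseq_exists : exists nj : nat -> nat, forall j, tau (nj j) <= wt j ^+ 2.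
Proof.
suff H j : exists n, tau n <= wt j ^+ 2 by have [nj h] := choice H; exists nj.
have w2 : 0 < wt j ^+ 2 by rewrite exprn_gt0.
have /cvgrPdist_le/(_ _ w2) [N _ HN] := tau0.
exists N; have := HN N (leqnn N); rewrite /= sub0r normrN.
exact: le_trans (ler_norm _).
Qed.

Let limit_along (nj : nat -> nat) (s : nat -> R) : R :=
  fine (limn_esup (fun j => (s (nj j))%:E)).

(** A subsequence with summable successive distances converges almost everywhere;
    Fatou's lemma compares its limit with u M. The limit at x is the value of
    an operator L on the sequence of the u n x. As L is the same at all x, a
    limit of periodic functions is periodic everywhere. *)
Lemma L2_complete : exists L : (nat -> R) -> R,
  measurable_fun setT (fun x => L (u^~ x)) /\
  forall M, (\int[nu]_(x in D) ((L (u^~ x) - u M x) ^+ 2)%:E <= (tau M)%:E)%E.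
Proof.
have [nj Hnj] := subseq_exists.
have mL : measurable_fun setT (fun x => limit_along nj (u^~ x)).
  apply: measurableT_comp; first exact: fine_measurable.
  by apply: measurable_fun_limn_esup => j; exact/measurable_EFinP.
exists (limit_along nj); split=> // M.
have mS a b : measurable_fun D (fun x => ((u a x - u b x) ^+ 2)%:E).
  apply/measurable_EFinP; apply: measurable_funTS.
  by apply: measurable_funX; exact: measurable_funB.
pose dl j x := u (nj j.+1) x - u (nj j) x.
have mdl j : measurable_fun D (fun x => (`|dl j x|)%:E).
  apply/measurable_EFinP; apply: measurable_funTS.
  by apply: measurableT_comp => //; exact: measurable_funB.
have mtot : measurable_fun D (fun x => \sum_(0 <= j <oo) (`|dl j x|)%:E)%E.
  by apply: ge0_emeasurable_sum => // j x _ _; rewrite lee_fin.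
have tot : (\int[nu]_(x in D) \sum_(0 <= j <oo) (`|dl j x|)%:E < +oo)%E.
  rewrite integral_nneseries//.
  pose K : R := fine (nu D) + 2.
  have K0 : 0 <= K by rewrite addr_ge0// fine_ge0.
  apply: (@le_lt_trans _ _ K%:E); last by rewrite ltry.
  apply: le_trans (epsilon_trick0 xpredT K0).
  apply: lee_nneseries => [j _ _|j _].
    by apply: integral_ge0 => x _; rewrite lee_fin.
  (* The inequality r <= w + r^2 / w, with w = wt j, turns L^2 bounds of order w^2
     into summable L^1 bounds. *)
  apply: (@le_trans _ _ (\int[nu]_(x in D)
      ((wt j)%:E + ((wt j)^-1)%:E * ((dl j x) ^+ 2)%:E))%E).
    apply: ge0_le_integral => //.
    - apply: emeasurable_funD; first exact: measurable_cst.
      by apply: emeasurable_funM; [exact: measurable_cst|exact: mS].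
    - move=> x _; rewrite -EFinM -EFinD lee_fin.
      rewrite -(ler_pM2l (wt_gt0 j)) mulrDr mulrA mulfV ?gt_eqF// mul1r.
      rewrite -(real_normK (num_real (dl j x))).
      by have := sqr_ge0 (wt j - `|dl j x|); have := normr_ge0 (dl j x); nra.
  rewrite ge0_integralD//; last 3 first.
  - by move=> x _; rewrite lee_fin ltW.
  - by move=> x _; rewrite -EFinM lee_fin mulr_ge0 ?sqr_ge0 ?invr_ge0 ?ltW.
  - by apply: emeasurable_funM; [exact: measurable_cst|exact: mS].
  rewrite integral_cst// ge0_integralZl//; last 3 first.
  - exact: mS.
  - by move=> x _; rewrite lee_fin sqr_ge0.
  - by rewrite lee_fin invr_ge0 ltW.
  apply: (@le_trans _ _ ((wt j)%:E * (fine (nu D))%:E +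
     ((wt j)^-1)%:E * (2 * wt j ^+ 2)%:E)%E).
    apply: leeD; first by rewrite fineK// ge0_fin_numE.
    apply: lee_wpmul2l; first by rewrite lee_fin invr_ge0 ltW.
    apply: le_trans (cau _ _) _; rewrite lee_fin.
    have := Hnj j; have := Hnj j.+1.
    have : wt j.+1 <= wt j.
      by rewrite /wt !div1r lef_pV2 ?posrE ?ltr0n ?expn_gt0// ler_nat leq_exp2l.
    have := wt_gt0 j.+1; have := wt_gt0 j; nra.
  rewrite -!EFinM -EFinD lee_fin (_ : K / _ = wt j * K); last first.
    by rewrite /wt div1r mulrC.
  rewrite /K mulrDr lerD2l (_ : (wt j)^-1 * (2 * wt j ^+ 2) = wt j * 2)//.
  by field; rewrite gt_eqF.
have cvgae : {ae nu, forall x, D x ->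
    u (nj j) x @[j --> \oo] --> limit_along nj (u^~ x)}.
  have itot : nu.-integrable D (fun x => \sum_(0 <= j <oo) (`|dl j x|)%:E)%E.
    apply/integrableP; split=> //; under eq_integral do rewrite gee0_abs ?nneseries_ge0//.
    exact: tot.
  have := integrable_ae mD itot; apply: filterS => x /[apply] fx.
  have cvs : cvgn (series (telescope (fun j => u (nj j) x))).
    apply: (@normed_cvg R R^o); apply: nondecreasing_is_cvgn.
      by apply: nondecreasing_series => n _ _; exact: normr_ge0.
    exists (fine (\sum_(0 <= j <oo) (`|dl j x|)%:E)) => _ [n _ <-].
    rewrite -lee_fin fineK// /series/= -sumEFin.
    exact: nneseries_lim_ge.
  have cv : cvgn (fun j => u (nj j) x).
    rewrite (_ : (fun j => u (nj j) x) =
      cst (u (nj 0%N) x) + series (telescope (fun j => u (nj j) x))).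
      by apply: is_cvgD; [exact: is_cvg_cst|exact: cvs].
    by apply/funext => j; rewrite [LHS](eq_sum_telescope (fun j => u (nj j) x)).
  have cvE : (u (nj j) x)%:E @[j --> \oo] --> (limn (fun j => u (nj j) x))%:E.
    by apply: cvg_EFin; [exact: nearW|exact: cv].
  by rewrite /limit_along; have [_ ->] := cvg_limn_einf_sup cvE.
pose h j x := ((u (nj j) x - u M x) ^+ 2)%:E.
rewrite (ae_eq_integral (fun x => limn_einf (h^~ x)))//; last 3 first.
- apply/measurable_EFinP; apply: measurable_funTS; apply: measurable_funX.
  exact: measurable_funB.
- rewrite (_ : (fun x => _) = (fun x => - limn_esup (fun j => - h j x)))%E.
    apply: measurableT_comp => //; apply: measurable_fun_limn_esup => j.
    by apply: measurableT_comp => //; exact: mS.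
  by apply/funext => x; rewrite -[X in _ = (- X)%E]/(limn_esup (-%E \o h^~ x)) limn_esupN oppeK.
- move: cvgae; apply: filterS => x /[apply] cx.
  have cvE : h j x @[j --> \oo] --> ((limit_along nj (u^~ x) - u M x) ^+ 2)%:E.
    apply: cvg_EFin; first exact: nearW.
    by rewrite /h/=; apply: cvgM; (apply: cvgB; [exact: cx|exact: cvg_cst]).
  by have [-> _] := cvg_limn_einf_sup cvE.
apply: le_trans (fatou nu mD (fun j => mS (nj j) M) _) _.
  by move=> j x _; rewrite /h lee_fin sqr_ge0.
rewrite limn_einf_lim; apply: lime_le; first exact: is_cvg_einfs.
apply: nearW => n; apply/lee_addgt0Pr => e e0.
have [N _ HN] := near_infty_natSinv_lt (PosNum e0).
pose k := maxn n N.
apply: le_trans (_ : (\int[nu]_(x in D) h k x <= _)%E).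
  by apply: ereal_inf_lbound; exists k => //=; exact: leq_maxl.
apply: le_trans (cau _ _) _; rewrite addrC EFinD leeD2l// lee_fin.
apply: le_trans (Hnj k) _.
have wtk : wt k <= k.+1%:R^-1.
  by rewrite /wt div1r lef_pV2 ?posrE ?ltr0n ?expn_gt0// ler_nat ltnW// ltn_expl.
have k1 : k.+1%:R^-1 <= 1 :> R by rewrite invf_le1 ?ltr0n// ler1n.
have /= ke : k.+1%:R^-1 < e by exact: (HN k (leq_maxr _ _)).
apply: (@le_trans _ _ (wt k)); last exact: ltW (le_lt_trans wtk ke).
by rewrite expr2 ler_piMl ?(le_trans wtk)// ltW.
Qed.
End L2Completeness.

Section TrigonometricSeries.
Context (R : realType).
Local Notation mu := (@lebesgue_measure R).
Local Notation torus := (@torus R).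
Let mT : measurable (torus : set (measurableTypeR R)) := @measurable_torus R.

Lemma lebesgue_torus : mu torus = (2 * pi)%:E.
Proof.
by rewrite /torus lebesgue_measure_itv/= lte_fin two_pi_gt0 sube0.
Qed.

Lemma Cintegrable_torus_expi z (a : R) :
  Cintegrable torus (fun x => z * expi (a * x)).
Proof.
have [c1 c2] := continuous_expi_affine a 0.
apply: (CintegrableZ mT); split; under eq_fun do rewrite -[a * _]addr0;
  apply: continuous_compact_integrable; [exact: segment_compact| |exact: segment_compact|];
  by apply: continuous_subspaceT.
Qed.

Lemma expi_int_eq1 (l : int) : expi (l%:~R * (2 * pi)) = 1 :> R[i].
Proof. by rewrite -[2 * pi]add0r expi_periodic mulr0 expi0. Qed.

Lemma Cintegral_torus_expi (l : int) :
  Cintegral torus (fun x => expi (l%:~R * x)) = if l == 0 then (2 * pi)%:C else 0.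
Proof.
have p0 := two_pi_gt0 R.
case: eqP => [->|/eqP l0].
  apply: complexP => /=.
  - under eq_Rintegral do rewrite mul0r cos0.
    by rewrite Rintegral_cst//= lebesgue_torus mul1r.
  - under eq_Rintegral do rewrite mul0r sin0.
    by rewrite Rintegral_cst// mul0r.
have lR : l%:~R != 0 :> R by rewrite intr_eq0.
have /eqP := expi_int_eq1 l; rewrite eq_complex /= => /andP[/eqP c1 /eqP s1].
have dl (x : R) : is_derive x 1 (fun x => l%:~R * x) (l%:~R : R).
  by apply: is_derive_eq; rewrite -[LHS]/(l%:~R *: 1) /GRing.scale/= mulr1.
have cl : continuous (fun x : R => l%:~R * x).
  by move=> x; apply: cvgM; [exact: cvg_cst|exact: cvg_id].
have FTC (f F : R -> R) : continuous f -> continuous F ->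
    (forall x : R, is_derive x 1 F (f (l%:~R * x) * l%:~R)) ->
    F 0 = F (2 * pi) -> \int[mu]_(x in torus) f (l%:~R * x) = 0.
  move=> cf cF dF F02.
  have dF' (x : R) : is_derive x 1 (fun x => F x / l%:~R) (f (l%:~R * x)).
    have := is_deriveM (dF x) (is_derive_cst (l%:~R^-1 : R) x 1).
    rewrite scaler0 add0r => h; apply: is_derive_eq.
    by rewrite /GRing.scale/= mulrC mulfK.
  have C : continuous (fun x => F x / l%:~R).
    by move=> x; apply: cvgM; [exact: cF|exact: cvg_cst].
  rewrite /Rintegral (@continuous_FTC2 _ _ (fun x => F x / l%:~R) _ _ p0).
  - by rewrite F02 subee.
  - by apply: continuous_subspaceT => x; apply: continuous_comp; [exact: cl|exact: cf].
  - split=> [x _||]; first exact: ex_derive.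
      by apply: cvg_at_right_filter; exact: C.
    by apply: cvg_at_left_filter; exact: C.
  - by move=> x _; rewrite derive1E; exact: derive_val.
apply: complexP => /=.
- have D x := is_derive1_comp (is_derive_sin _) (dl x).
  apply: (FTC cos (fun x => sin (l%:~R * x)) _ _ D).
  + exact: continuous_cos.
  + by move=> x; apply: continuous_comp; [exact: cl|exact: continuous_sin].
  + by move: s1 => /= ->; rewrite mulr0 sin0.
- have D (x : R) : is_derive x 1 (fun x => - cos (l%:~R * x)) (sin (l%:~R * x) * l%:~R).
    have := is_deriveN (is_derive1_comp (is_derive_cos _) (dl x)).
    by rewrite mulNr opprK.
  apply: (FTC sin (fun x => - cos (l%:~R * x)) _ _ D).
  + exact: continuous_sin.
  + move=> x; apply: cvgN; apply: continuous_comp; [exact: cl|exact: continuous_cos].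
  + by move: c1 => /= ->; rewrite mulr0 cos0.
Qed.

Section Coefficients.
Variable d : nat -> R[i].

Definition trig_sum (m n : nat) (x : R) : R[i] :=
  \sum_(m <= k < n) d k * expi (k%:R * x).

Lemma measurable_trig_sum m n :
  measurable_fun setT (fun x => complex.Re (trig_sum m n x)) /\
  measurable_fun setT (fun x => complex.Im (trig_sum m n x)).
Proof.
have M (z : R[i]) (a : R) : measurable_fun setT (fun x => complex.Re (z * expi (a * x))) /\
    measurable_fun setT (fun x => complex.Im (z * expi (a * x))).
  have [c1 c2] := continuous_expi_affine a 0.
  have m1 := continuous_measurable_fun c1; have m2 := continuous_measurable_fun c2.
  move: m1 m2; under eq_fun do rewrite addr0.
  move=> m1; under eq_fun do rewrite addr0.
  move=> m2.
  split.
  - under eq_fun do rewrite cReM.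
    by apply: measurable_funB; apply: measurable_funM => //; exact: measurable_cst.
  - under eq_fun do rewrite cImM.
    by apply: measurable_funD; apply: measurable_funM => //; exact: measurable_cst.
split.
- under eq_fun do rewrite Re_sum.
  by apply: measurable_sum => k; exact: (M _ _).1.
- under eq_fun do rewrite Im_sum.
  by apply: measurable_sum => k; exact: (M _ _).2.
Qed.

Lemma Cintegrable_trig_sum_mod m n (a : R) :
  Cintegrable torus (fun x => trig_sum m n x * expi (a * x)).
Proof.
have := @Cintegrable_sum R torus mT _ (index_iota m n) xpredT
  (fun k x => d k * expi ((k%:R + a) * x)) (fun k => Cintegrable_torus_expi _ _).
suff -> : (fun x => trig_sum m n x * expi (a * x)) =
  (fun x => \sum_(m <= k < n) d k * expi ((k%:R + a) * x)) by [].
apply/funext => x; rewrite /trig_sum mulr_suml; apply: eq_bigr => k _.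
by rewrite -mulrA -expiD mulrDl.
Qed.

Lemma Cintegral_trig_sum m n (l : int) :
  Cintegral torus (fun x => trig_sum m n x * expi (- (l%:~R * x))) =
  (2 * pi)%:C * (\sum_(m <= k < n) if k == l :> int then d k else 0).
Proof.
transitivity (Cintegral torus (fun x => \sum_(m <= k < n) d k * expi ((k%:Z - l)%:~R * x))).
  apply: eq_Cintegral => x _; rewrite /trig_sum mulr_suml; apply: eq_bigr => k _.
  by rewrite -mulrA -expiD rmorphB/= mulrBl.
rewrite Cintegral_sum//; last by move=> k; exact: Cintegrable_torus_expi.
rewrite mulr_sumr; apply: eq_bigr => k _.
rewrite CintegralZ//; last first.
  have := Cintegrable_torus_expi 1 (k%:Z - l)%:~R.
  by under eq_fun do rewrite mul1r.
by rewrite Cintegral_torus_expi subr_eq0; case: eqP; rewrite ?mulr0// mulrC.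
Qed.

(** Parseval: one factor of the squared modulus is expanded, and the integral
    against each of its terms extracts a coefficient of the other. *)
Lemma Rintegral_sqnorm_trig_sum m n :
  \int[mu]_(x in torus) sqnorm (trig_sum m n x) =
  2 * pi * \sum_(m <= k < n) sqnorm (d k).
Proof.
transitivity (complex.Re (Cintegral torus (fun x =>
    \sum_(m <= j < n) conjc (d j) * (trig_sum m n x * expi (- (j%:Z%:~R * x)))))).
  apply: eq_Rintegral => x _; rewrite -[LHS]ReC sqnormE; congr complex.Re.
  rewrite {2}/trig_sum conjC_sum mulr_sumr; apply: eq_bigr => j _.
  by rewrite conjC_M conj_expi mulrCA.
have I j : Cintegrable torus (fun x => trig_sum m n x * expi (- (j%:Z%:~R * x))).
  by have := Cintegrable_trig_sum_mod m n (- j%:R); under eq_fun do rewrite mulNr.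
rewrite Cintegral_sum//; last by move=> j; exact: (CintegrableZ mT _ (I j)).
rewrite Re_sum mulr_sumr; apply: eq_big_nat => j jmn.
rewrite CintegralZ// Cintegral_trig_sum.
rewrite (_ : \sum_(m <= k < n) _ = d j); last first.
  rewrite (big_cat_nat _ (n := j))//=; [|lia|lia].
  rewrite [X in _ + X]big_ltn/=; last lia.
  rewrite eqxx big_nat big1 ?add0r; last by move=> k kj; case: eqP => // -[]; lia.
  by rewrite big_nat big1 ?addr0// => k kj; case: eqP => // -[]; lia.
by rewrite mulrCA [conjc _ * _]mulrC -sqnormE cReM/= mul0r subr0.
Qed.

End Coefficients.
End TrigonometricSeries.

Section RieszFischer.
Context (R : realType).
Local Notation mu := (@lebesgue_measure R).
Local Notation torus := (@torus R).
Let mT : measurable (torus : set (measurableTypeR R)) := @measurable_torus R.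

Lemma torus_integrable_cst (r : R) : mu.-integrable torus (fun=> r%:E).
Proof.
apply/integrableP; split; first exact: measurable_cst.
rewrite integral_cst//= lebesgue_torus -EFinM ltry//.
Qed.

(** On a set of finite measure, |u| <= 1 + u^2 suffices. *)
Lemma torus_integrable_sqr (u : R -> R) (r : R -> R) :
  measurable_fun (torus : set (measurableTypeR R)) u ->
  (forall x, torus x -> u x ^+ 2 <= r x) ->
  mu.-integrable torus (EFin \o r) ->
  mu.-integrable torus (EFin \o u).
Proof.
move=> mu_ ur ir.
have I := integrableD mT (torus_integrable_cst 1) ir.
apply: (le_integrable mT _ _ I); first exact/measurable_EFinP.
move=> x Tx /=; rewrite lee_fin.
apply: le_trans (ler_norm _); have := ur x Tx.
rewrite -(real_normK (num_real (u x))); have := normr_ge0 (u x).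
by have := sqr_ge0 (`|u x| - 1); nra.
Qed.

(** From |u| <= e + u^2 / e: an L^2 norm at most e gives an integral of order e. *)
Lemma Rintegral_sqr_small (u : R -> R) (e : R) : 0 < e ->
  measurable_fun (torus : set (measurableTypeR R)) u ->
  (\int[mu]_(x in torus) (u x ^+ 2)%:E <= (e ^+ 2)%:E)%E ->
  mu.-integrable torus (EFin \o u) /\
  `|\int[mu]_(x in torus) u x| <= (2 * pi + 1) * e.
Proof.
move=> e0 mu_ ue.
have mu2 : measurable_fun (torus : set (measurableTypeR R)) (fun x => u x ^+ 2).
  exact: measurable_funX.
have i2 : mu.-integrable torus (fun x => (u x ^+ 2)%:E).
  apply/integrableP; split; first exact/measurable_EFinP.
  under eq_integral do rewrite gee0_abs ?lee_fin ?sqr_ge0//.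
  by rewrite (le_lt_trans ue)// ltry.
have iu : mu.-integrable torus (EFin \o u) by exact: torus_integrable_sqr i2.
split => //; apply: le_trans (le_normr_Rintegral mT iu) _.
have ib : mu.-integrable torus (fun x => (e^-1 * u x ^+ 2)%:E).
  exact: (integrableZl mT e^-1 i2).
apply: (@le_trans _ _ (\int[mu]_(x in torus) (e + e^-1 * u x ^+ 2))).
  apply: le_Rintegral => //.
  - exact: integrable_norm.
  - exact: (integrableD mT (torus_integrable_cst e) ib).
  - move=> x _; rewrite -(ler_pM2l e0) mulrDr mulrA mulfV ?gt_eqF// mul1r.
    rewrite -(real_normK (num_real (u x))).
    by have := sqr_ge0 (`|u x| - e); have := normr_ge0 (u x); nra.
rewrite RintegralD//; last exact: torus_integrable_cst.
rewrite RintegralZl// Rintegral_cst//= lebesgue_torus/=.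
rewrite (_ : (2 * pi + 1) * e = e * (2 * pi) + e); last by ring.
rewrite lerD2l mulrC ler_pdivrMr// -expr2 -lee_fin fineK//.
exact: integrable_fin_num i2.
Qed.

Variable d : nat -> R[i].
Hypothesis dsum : square_summable d.

Let S N := trig_sum d 1 N.+1.

Lemma integrable_sqnorm_trig_sum m n :
  mu.-integrable torus (fun x => (sqnorm (trig_sum d m n x))%:E).
Proof.
have H := @Cintegrable_sum R torus mT _ (index_iota m n) xpredT
  (fun j x => conjc (d j) * (trig_sum d m n x * expi (- j%:R * x)))
  (fun j => CintegrableZ mT _ (Cintegrable_trig_sum_mod d m n (- j%:R))).
have [+ _] := H; apply: eq_integrable => // x _; congr (_%:E).
rewrite -[RHS]ReC sqnormE; congr complex.Re.
rewrite {3}/trig_sum conjC_sum mulr_sumr; apply: eq_bigr => j _.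
by rewrite conjC_M conj_expi mulrCA mulNr.
Qed.

Lemma integral_sqnorm_trig_sum m n :
  (\int[mu]_(x in torus) (sqnorm (trig_sum d m n x))%:E =
   (2 * pi * \sum_(m <= k < n) sqnorm (d k))%:E)%E.
Proof.
rewrite -Rintegral_sqnorm_trig_sum /Rintegral fineK//.
exact: integrable_fin_num (integrable_sqnorm_trig_sum m n).
Qed.

Let p N := \sum_(1 <= k < N.+1) sqnorm (d k).
Let Stot := fine (\sum_(1 <= k <oo) (sqnorm (d k))%:E)%E.
Let tau N : R := 2 * pi * (Stot - p N).

Let p_le N : p N <= Stot.
Proof.
rewrite -lee_fin fineK; last first.
  by rewrite ge0_fin_numE// nneseries_ge0// => k _ _; rewrite lee_fin sqnorm_ge0.
rewrite /p -sumEFin; apply: nneseries_lim_ge => k _ _.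
by rewrite lee_fin sqnorm_ge0.
Qed.

Let tau_ge0 N : 0 <= tau N.
Proof. by rewrite mulr_ge0 ?subr_ge0// ltW// two_pi_gt0. Qed.

Let tau_cvg : tau N @[N --> \oo] --> (0 : R).
Proof.
rewrite -(mulr0 (2 * pi)) -[X in 2 * pi * X](subrr Stot).
apply: cvgM; first exact: cvg_cst.
apply: cvgB; first exact: cvg_cst.
have Sfin : (\sum_(1 <= k <oo) (sqnorm (d k))%:E)%E \is a fin_num.
  by rewrite ge0_fin_numE// nneseries_ge0// => k _ _; rewrite lee_fin sqnorm_ge0.
have H : (\sum_(1 <= k < n) (sqnorm (d k))%:E)%E @[n --> \oo] --> Stot%:E.
  rewrite /Stot fineK//.
  by apply: is_cvg_nneseries => k _ _; rewrite lee_fin sqnorm_ge0.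
have := fine_cvg H; rewrite -cvg_shiftS.
have -> : p = (fun n => fine (\sum_(1 <= k < n.+1) (sqnorm (d k))%:E)%E).
  by apply/funext => n /=; rewrite sumEFin.
exact.
Qed.

Let cauchy m n (f : R[i] -> R) : (forall z w, f (z - w) = f z - f w) ->
  (forall z, f z ^+ 2 <= sqnorm z) ->
  (forall m n, measurable_fun (torus : set (measurableTypeR R))
     (fun x => f (trig_sum d m n x))) ->
  (\int[mu]_(x in torus) ((f (S m x) - f (S n x)) ^+ 2)%:E <= (tau m + tau n)%:E)%E.
Proof.
move=> fB fle mf; wlog mn : m n / (m <= n)%N.
  move=> H; have [mn|/ltnW nm] := leqP m n; first exact: H.
  rewrite addrC; under eq_integral do rewrite -sqrrN opprB.
  exact: H.
apply: (@le_trans _ _ (\int[mu]_(x in torus) (sqnorm (trig_sum d m.+1 n.+1 x))%:E)%E).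
  apply: ge0_le_integral => //.
  - by move=> x _; rewrite lee_fin sqr_ge0.
  - apply/measurable_EFinP; apply: measurable_funX; apply: measurable_funB; exact: mf.
  - by have /integrableP[] := integrable_sqnorm_trig_sum m.+1 n.+1.
  - move=> x _; rewrite lee_fin -sqrrN opprB -fB.
    by rewrite /S /trig_sum (big_cat_nat (n := m.+1))//= addrAC subrr add0r.
rewrite integral_sqnorm_trig_sum lee_fin.
have -> : \sum_(m.+1 <= k < n.+1) sqnorm (d k) = p n - p m.
  by rewrite /p [in RHS](big_cat_nat (n := m.+1))//= addrAC subrr add0r.
apply: (@le_trans _ _ (tau m)); last by rewrite lerDl.
by rewrite /tau ler_wpM2l// ?lerD2r// ltW// two_pi_gt0.
Qed.

(** By Parseval the partial sums form a Cauchy sequence with modulus [tau], the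
    tails of the series of squared coefficients. Real and imaginary parts are
    completed separately, hence the factor 2 in the bound. *)
Theorem riesz_fischer : exists G : R -> R[i],
  [/\ Cmeasurable setT G, periodic G &
    (\int[mu]_(x in torus) (sqnorm (G x - S N x))%:E)%E @[N --> \oo] --> 0%E].
Proof.
have mS m n := measurable_trig_sum d m n.
have tfin : (mu torus < +oo)%E by rewrite /= lebesgue_torus ltry.
have [LR [mR HR]] := @L2_complete _ (measurableTypeR R) R mu torus
  (fun n x => complex.Re (S n x)) tau mT tfin (fun n => (mS _ _).1) tau_cvg
  (fun m n => @cauchy m n (fun z => complex.Re z)
     (fun z w => etrans (cReD _ _) (congr1 _ (cReN _))) (@Re_sqr_le R)
     (fun m n => measurable_funTS (mS m n).1)).
have [LI [mI HI]] := @L2_complete _ (measurableTypeR R) R mu torus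
  (fun n x => complex.Im (S n x)) tau mT tfin (fun n => (mS _ _).2) tau_cvg
  (fun m n => @cauchy m n (fun z => complex.Im z)
     (fun z w => etrans (cImD _ _) (congr1 _ (cImN _))) (@Im_sqr_le R)
     (fun m n => measurable_funTS (mS m n).2)).
exists (fun x => LR (fun n => complex.Re (S n x)) +i* LI (fun n => complex.Im (S n x))).
split.
- by split.
- move=> x; have E n : S n (x + 2 * pi) = S n x.
    by apply: eq_bigr => k _; rewrite (expi_periodic k%:Z).
  by congr (_ +i* _); [congr LR|congr LI]; apply/funext => n; rewrite E.
have T2 : (2 * tau N)%:E @[N --> \oo] --> (0 : \bar R)%E.
  apply: cvg_EFin; first exact: nearW.
  by rewrite -(mulr0 2); apply: cvgM; [exact: cvg_cst|exact: tau_cvg].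
apply: (squeeze_cvge _ (cvg_cst 0%E) T2); apply: nearW => N.
rewrite integral_ge0//=; last by move=> x _; rewrite lee_fin sqnorm_ge0.
under eq_integral do rewrite /sqnorm cReD cReN cImD cImN EFinD/=.
rewrite ge0_integralD//; last 4 first.
- by move=> x _; rewrite lee_fin sqr_ge0.
- apply/measurable_EFinP; apply: measurable_funX; apply: measurable_funTS.
  by apply: measurable_funB => //; exact: (mS _ _).1.
- by move=> x _; rewrite lee_fin sqr_ge0.
- apply/measurable_EFinP; apply: measurable_funX; apply: measurable_funTS.
  by apply: measurable_funB => //; exact: (mS _ _).2.
by rewrite mulr_natl mulr2n EFinD leeD.
Qed.

End RieszFischer.

Lemma sin_norm_le1 (R : realType) (x : R) : `|sin x| <= 1.
Proof. by rewrite ler_norml sin_geN1 sin_le1. Qed.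

Section Modulation.
Context d (T : measurableType d) (R : realType) (nu : {measure set T -> \bar R}).
Variables (D : set T) (u : T -> R[i]) (theta : T -> R).
Hypotheses (mD : measurable D) (mtheta : measurable_fun D theta).

Let mcos : measurable_fun D (fun x => cos (theta x)).
Proof.
by apply: measurableT_comp mtheta; apply: continuous_measurable_fun; exact: continuous_cos.
Qed.

Let msin : measurable_fun D (fun x => sin (theta x)).
Proof.
by apply: measurableT_comp mtheta; apply: continuous_measurable_fun; exact: continuous_sin.
Qed.

Lemma Cmeasurable_mul_expi : Cmeasurable D u ->
  Cmeasurable D (fun x => u x * expi (theta x)).
Proof.
move=> [u1 u2]; split.
- by under eq_fun do rewrite cReM; apply: measurable_funB; exact: measurable_funM.
- by under eq_fun do rewrite cImM; apply: measurable_funD; exact: measurable_funM.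
Qed.

Lemma integrable_mul_expi :
  nu.-integrable D (fun x => (complex.Re (u x))%:E) ->
  nu.-integrable D (fun x => (complex.Im (u x))%:E) ->
  nu.-integrable D (fun x => (complex.Re (u x * expi (theta x)))%:E) /\
  nu.-integrable D (fun x => (complex.Im (u x * expi (theta x)))%:E).
Proof.
move=> u1 u2.
have C (f : T -> R) : nu.-integrable D (fun x => (f x)%:E) ->
    nu.-integrable D (fun x => (f x * cos (theta x))%:E).
  move=> If; apply: (integrable_mulr_bounded (M := 1)) => //.
  by move=> x _; exact: cos_norm_le1.
have S (f : T -> R) : nu.-integrable D (fun x => (f x)%:E) ->
    nu.-integrable D (fun x => (f x * sin (theta x))%:E).
  move=> If; apply: (integrable_mulr_bounded (M := 1)) => //.
  by move=> x _; exact: sin_norm_le1.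
split.
- by under eq_fun do rewrite cReM; exact: (integrableB mD (C _ u1) (S _ u2)).
- by under eq_fun do rewrite cImM; exact: (integrableD mD (S _ u1) (C _ u2)).
Qed.
End Modulation.

Section AffineModulation.
Context (R : realType).

Lemma measurable_affine (a b : R) (D : set R) : measurable_fun D (fun x => a * x + b).
Proof.
by apply: measurable_funD; [apply: measurable_funM => //|]; exact: measurable_cst.
Qed.

Lemma measurable_sin_affine (a b : R) (D : set R) :
  measurable_fun D (fun x => sin (a * x + b)).
Proof.
apply: measurable_funTS; apply: continuous_measurable_fun => x.
apply: continuous_comp; last exact: continuous_sin.
by apply: cvgD; [apply: cvgM; [exact: cvg_cst|exact: cvg_id]|exact: cvg_cst].
Qed.

Lemma Cintegrable_modulate (D : set (measurableTypeR R)) (u : R -> R[i]) (a b : R) :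
  measurable D -> Cintegrable D u ->
  Cintegrable D (fun x => u x * expi (a * x + b)).
Proof.
by move=> mD [u1 u2]; exact: (integrable_mul_expi mD (@measurable_affine a b D) u1 u2).
Qed.

Lemma Cmeasurable_modulate (D : set R) (u : R -> R[i]) (a b : R) :
  Cmeasurable D u -> Cmeasurable D (fun x => u x * expi (a * x + b)).
Proof. exact: (Cmeasurable_mul_expi (@measurable_affine a b D)). Qed.

End AffineModulation.

Lemma cvge0_small (R : realType) (h : nat -> \bar R) : h N @[N --> \oo] --> 0%E ->
  forall e, 0 < e -> \forall N \near \oo, (h N <= e%:E)%E.
Proof.
move=> /fine_cvgP[Hf /cvgrPdist_le H] e e0.
have := H e e0; move: Hf; apply: filterS2 => N hN.
rewrite sub0r normrN /= => he; rewrite -(fineK hN) lee_fin.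
exact: le_trans (ler_norm _) he.
Qed.

Section Coefficients.
Context (R : realType).
Local Notation mu := (@lebesgue_measure R).
Local Notation torus := (@torus R).
Let mT : measurable (torus : set (measurableTypeR R)) := @measurable_torus R.
Variables (d : nat -> R[i]) (G : R -> R[i]).
Hypothesis mG : Cmeasurable setT G.
Hypothesis G_lim :
  (\int[mu]_(x in torus) (sqnorm (G x - trig_sum d 1 N.+1 x))%:E)%E
    @[N --> \oo] --> 0%E.

Let mD N : Cmeasurable setT (fun x => G x - trig_sum d 1 N.+1 x).
Proof.
have [s1 s2] := measurable_trig_sum d 1 N.+1; case: mG => g1 g2.
split; [under eq_fun do rewrite cReD cReN|under eq_fun do rewrite cImD cImN].
- exact: measurable_funB.
- exact: measurable_funB.
Qed.

Let small e : 0 < e -> \forall N \near \oo,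
  (\int[mu]_(x in torus) (sqnorm (G x - trig_sum d 1 N.+1 x))%:E <= (e ^+ 2)%:E)%E.
Proof. by move=> e0; apply: (cvge0_small G_lim); rewrite exprn_gt0. Qed.

Let small_mod (N : nat) (e a : R) : 0 < e ->
  (\int[mu]_(x in torus) (sqnorm (G x - trig_sum d 1 N.+1 x))%:E <= (e ^+ 2)%:E)%E ->
  let D := fun x => (G x - trig_sum d 1 N.+1 x) * expi (a * x) in
  [/\ Cintegrable torus D, `|complex.Re (Cintegral torus D)| <= (2 * pi + 1) * e &
      `|complex.Im (Cintegral torus D)| <= (2 * pi + 1) * e].
Proof.
move=> e0 He D.
have mDa : Cmeasurable (torus : set (measurableTypeR R)) D.
  have [m1 m2] := Cmeasurable_modulate a 0 (mD N).
  by split; [move: m1|move: m2]; under eq_fun do rewrite addr0; exact: measurable_funTS.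
have sq (f : R[i] -> R) : (forall z, f z ^+ 2 <= sqnorm z) ->
    measurable_fun (torus : set (measurableTypeR R)) (f \o D) ->
    mu.-integrable torus (EFin \o (f \o D)) /\
    `|\int[mu]_(x in torus) (f \o D) x| <= (2 * pi + 1) * e.
  move=> fle mf; apply: Rintegral_sqr_small => //; apply: le_trans He.
  apply: ge0_le_integral => //.
  - by move=> x _; rewrite lee_fin sqr_ge0.
  - by apply/measurable_EFinP; exact: measurable_funX.
  - apply/measurable_EFinP; apply: measurable_funTS; exact: measurable_sqnorm (mD N).
  - move=> x _; rewrite lee_fin (le_trans (fle _))// sqnormM sqnorm_expi mulr1.
    exact: lexx.
have [I1 B1] := sq _ (@Re_sqr_le R) mDa.1.
have [I2 B2] := sq _ (@Im_sqr_le R) mDa.2.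
by split.
Qed.

Lemma Cintegrable_trig_sum m n : Cintegrable torus (trig_sum d m n).
Proof.
have := Cintegrable_trig_sum_mod d m n 0.
by under eq_fun do rewrite mul0r expi0 mulr1.
Qed.

Lemma Cintegrable_L2_limit : Cintegrable torus G.
Proof.
have [N _ /(_ N (leqnn N)) HN] := small ltr01.
have [H _ _] := small_mod 0 ltr01 HN.
have := CintegrableD mT H (Cintegrable_trig_sum 1 N.+1).
by under eq_fun do rewrite mul0r expi0 mulr1 subrK.
Qed.

Lemma integrable_sqnorm_L2_limit :
  mu.-integrable torus (fun x => (sqnorm (G x))%:E).
Proof.
have [N _ /(_ N (leqnn N)) HN] := small ltr01.
have iD : mu.-integrable torus (fun x => (sqnorm (G x - trig_sum d 1 N.+1 x))%:E).
  apply/integrableP; split.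
    by apply/measurable_EFinP; apply: measurable_funTS; exact: measurable_sqnorm (mD N).
  under eq_integral do rewrite gee0_abs ?lee_fin ?sqnorm_ge0//.
  by rewrite (le_lt_trans HN)// ltry.
have I := integrableD mT (integrableZl mT 2 iD)
   (integrableZl mT 2 (integrable_sqnorm_trig_sum d 1 N.+1)).
apply: (le_integrable mT _ _ I).
  by apply/measurable_EFinP; apply: measurable_funTS; exact: measurable_sqnorm mG.
move=> x _ /=; rewrite lee_fin !ger0_norm ?sqnorm_ge0 ?addr_ge0 ?mulr_ge0 ?sqnorm_ge0//.
by apply: le_trans (sqnormD_le _ _); rewrite subrK.
Qed.

(** The l-th coefficient of a partial sum does not change beyond |l|, and that
    of the remainder is small by [Rintegral_sqr_small]. *)
Lemma L2_limit_coef (l : int) :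
  Cintegral torus (fun x => G x * expi (- (l%:~R * x))) =
  (2 * pi)%:C * (if 0 < l then d `|l|%N else 0).
Proof.
set V := RHS.
suff B e : 0 < e ->
    `|complex.Re (Cintegral torus (fun x => G x * expi (- (l%:~R * x))) - V)| <=
      (2 * pi + 1) * e /\
    `|complex.Im (Cintegral torus (fun x => G x * expi (- (l%:~R * x))) - V)| <=
      (2 * pi + 1) * e.
  have p1 : 0 < 2 * pi + 1 :> R by rewrite addr_gt0// two_pi_gt0.
  have Z (r : R) : (forall e, 0 < e -> `|r| <= (2 * pi + 1) * e) -> r = 0.
    move=> H; apply/eqP; rewrite -normr_eq0 eq_le normr_ge0 andbT.
    apply/ler_addgt0Pr => e e0; rewrite add0r.
    have := H (e / (2 * pi + 1)); rewrite mulrCA mulfV ?gt_eqF// mulr1; apply.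
    by rewrite divr_gt0.
  apply/eqP; rewrite -subr_eq0; apply/eqP; apply: complexP; apply: Z => e /B [].
  - by [].
  - by [].
move=> e0.
have [N [/= Nl HN]] : exists N, (`|l|%N <= N)%N /\
    (\int[mu]_(x in torus) (sqnorm (G x - trig_sum d 1 N.+1 x))%:E <= (e ^+ 2)%:E)%E.
  have [N0 _ H0] := small e0; exists (maxn `|l|%N N0); split; first exact: leq_maxl.
  by apply: H0; exact: leq_maxr.
have [ID B1 B2] := small_mod (- l%:~R) e0 HN.
have IS := Cintegrable_trig_sum_mod d 1 N.+1 (- l%:~R).
have E : Cintegral torus (fun x => G x * expi (- (l%:~R * x))) =
    Cintegral torus (fun x => (G x - trig_sum d 1 N.+1 x) * expi (- l%:~R * x)) + V.
  have -> : V = Cintegral torus (fun x => trig_sum d 1 N.+1 x * expi (- l%:~R * x)).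
    under eq_Cintegral => x _ do rewrite mulNr.
    rewrite Cintegral_trig_sum /V; congr (_ * _).
    case: ifPn => l0.
      rewrite (bigD1_seq `|l|%N)/= ?iota_uniq//; last by rewrite mem_index_iota; lia.
      rewrite gtz0_abs// eqxx big1 ?addr0// => k /eqP kl.
      by case: eqP => // kl'; exfalso; apply: kl; rewrite -kl'.
    by rewrite big_nat big1// => k k1; case: eqP => //; lia.
  rewrite -CintegralD//; apply: eq_Cintegral => x _.
  by rewrite -mulrDl subrK mulNr.
by rewrite E addrK.
Qed.
End Coefficients.

(** * Schwartz functions and the Fourier transform *)
Section SchwartzFunctions.
Context (R : realType).
Local Notation mu := (@lebesgue_measure R).

Lemma integrable_oneDsqrV :
  mu.-integrable setT (fun x : R => ((oneDsqr x)^-1)%:E).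
Proof.
have p0 (x : R) : 0 <= (oneDsqr x)^-1.
  by rewrite invr_ge0 (le_trans ler01)// oneDsqr_ge1.
apply/integrableP; split.
  by apply/measurable_EFinP; apply: continuous_measurable_fun; exact: continuous_oneDsqrV.
under eq_integral do rewrite gee0_abs ?lee_fin//.
rewrite ge0_symfun_integralT//; last 2 first.
- exact: continuous_oneDsqrV.
- by move=> x /=; rewrite /oneDsqr sqrrN.
by rewrite -set_itvcy integral0y_oneDsqr -EFinM ltry.
Qed.

Variable u : R -> R.
Hypothesis su : Rschwartz u.

Lemma Rschwartz_continuous : continuous u.
Proof.
move=> x; have := su.1 0%N x; rewrite derive1n0 => /derivable1_diffP.
exact: differentiable_continuous.
Qed.

Lemma Rschwartz_measurable (D : set R) : measurable_fun D u.
Proof.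
by apply: measurable_funTS; apply: continuous_measurable_fun; exact: Rschwartz_continuous.
Qed.

Lemma Rschwartz_bounded : exists M, forall x, `|u x| <= M.
Proof.
have [M HM] := su.2 0%N 0%N; exists M => x.
by have := HM x; rewrite expr0 mul1r derive1n0.
Qed.

Lemma Rschwartz_integrable : mu.-integrable setT (EFin \o u).
Proof.
have [M0 H0] := Rschwartz_bounded; have [M2 H2] := su.2 2%N 0%N.
have I := integrableZl measurableT (M0 + M2) integrable_oneDsqrV.
apply: (le_integrable measurableT _ _ I).
  by apply/measurable_EFinP; exact: Rschwartz_measurable.
move=> x _ /=; rewrite lee_fin; apply: le_trans (ler_norm _).
rewrite ler_pdivlMr; last by rewrite (lt_le_trans ltr01)// oneDsqr_ge1.
rewrite /oneDsqr mulrDr mulr1 lerD//.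
by have := H2 x; rewrite derive1n0 real_normK ?num_real// mulrC.
Qed.
End SchwartzFunctions.

Section FourierTransform.
Context (R : realType).
Local Notation mu := (@lebesgue_measure R).
Implicit Types (u w phi : R -> R[i]) (A B : set (measurableTypeR R)).

Lemma Cfubini A B (K : R -> R -> R[i]) : measurable A -> measurable B ->
  (mu \x mu)%E.-integrable (A `*` B) (fun z => (complex.Re (K z.1 z.2))%:E) ->
  (mu \x mu)%E.-integrable (A `*` B) (fun z => (complex.Im (K z.1 z.2))%:E) ->
  Cintegral A (fun x => Cintegral B (K x)) =
  Cintegral B (fun y => Cintegral A (K^~ y)).
Proof.
move=> mA mB i1 i2; apply: complexP => /=.
- exact: (Rfubini mA mB i1).
- exact: (Rfubini mA mB i2).
Qed.

Lemma Cintegrable_tensor A B u w : measurable A -> measurable B ->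
  Cintegrable A u -> Cintegrable B w ->
  (mu \x mu)%E.-integrable (A `*` B) (fun z => (complex.Re (u z.1 * w z.2))%:E) /\
  (mu \x mu)%E.-integrable (A `*` B) (fun z => (complex.Im (u z.1 * w z.2))%:E).
Proof.
move=> mA mB [u1 u2] [w1 w2]; have mAB : measurable (A `*` B) by exact: measurableX.
have T := fun (f g : R -> R) => @integrable_tensor _ _ _ _ R mu mu A B mA mB f g.
split.
- under eq_fun do rewrite cReM.
  exact: (integrableB mAB (T _ _ u1 w1) (T _ _ u2 w2)).
- under eq_fun do rewrite cImM.
  exact: (integrableD mAB (T _ _ u1 w2) (T _ _ u2 w1)).
Qed.

Lemma schwartz_Cintegrable u : schwartz u -> Cintegrable setT u.
Proof. by move=> [u1 u2]; split; exact: Rschwartz_integrable. Qed.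

Lemma schwartz_Cmeasurable u : schwartz u -> Cmeasurable setT u.
Proof. by move=> [u1 u2]; split; exact: Rschwartz_measurable. Qed.

Lemma Cintegrable_character u xi : Cintegrable setT u ->
  Cintegrable setT (fun v => u v * expi (- (xi * v))).
Proof.
move=> iu; have := Cintegrable_modulate (- xi) 0 measurableT iu.
by under eq_fun do rewrite mulNr addr0.
Qed.

Lemma measurable_phase : measurable_fun setT (fun z : R * R => - (z.1 * z.2)).
Proof.
apply: measurable_funN; apply: measurable_funM; [exact: measurable_fst|exact: measurable_snd].
Qed.

Lemma fourier_measurable u : Cintegrable setT u -> Cmeasurable setT (fourier u).
Proof.
move=> /Cintegrable_Cmeasurable [m1 m2].
have mu2 : Cmeasurable [set: R * R] (fun z => u z.2).
  by split; [apply: measurableT_comp m1 _|apply: measurableT_comp m2 _];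
    exact: measurable_snd.
have [k1 k2] := Cmeasurable_mul_expi measurable_phase mu2.
split.
- apply: (@measurable_fun_param_Rintegral _ _ (measurableTypeR R) (measurableTypeR R) R mu setT
    (fun xi v => complex.Re (u v * expi (- (xi * v))))) => //.
  by rewrite setXTT.
- apply: (@measurable_fun_param_Rintegral _ _ (measurableTypeR R) (measurableTypeR R) R mu setT
    (fun xi v => complex.Im (u v * expi (- (xi * v))))) => //.
  by rewrite setXTT.
Qed.

Lemma fourier_bounded u : Cintegrable setT u ->
  exists M, forall xi, sqnorm (fourier u xi) <= M.
Proof.
move=> iu; have [u1 u2] := iu.
pose K := \int[mu]_x (`|complex.Re (u x)| + `|complex.Im (u x)|).
have iK := integrableD measurableT (integrable_norm u1) (integrable_norm u2).
have K0 : 0 <= K by apply: Rintegral_ge0 => x _; rewrite addr_ge0.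
exists (2 * K ^+ 2) => xi; rewrite mulr_natl mulr2n.
have [e1 e2] := Cintegrable_character xi iu.
have H (f : R[i] -> R) : mu.-integrable setT (fun v => (f (u v * expi (- (xi * v))))%:E) ->
   (forall z, f z = complex.Re z) \/ (forall z, f z = complex.Im z) ->
   (\int[mu]_v f (u v * expi (- (xi * v)))) ^+ 2 <= K ^+ 2.
  move=> fi fE; rewrite -[X in X ^+ 2]/(\int[mu]_v _) -(real_normK (num_real (\int[mu]_v _))).
  rewrite lerXn2r ?nnegrE//; apply: le_trans (le_normr_Rintegral measurableT fi) _.
  apply: le_Rintegral => //; first exact: integrable_norm.
  move=> v _; have a := cos_norm_le1 (- (xi * v)); have b := sin_norm_le1 (- (xi * v)).
  case: fE => ->; rewrite ?cReM ?cImM/=;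
  (apply: le_trans (ler_normD _ _) _; rewrite ?normrN !normrM;
  by rewrite lerD// ler_piMr).
by apply: lerD; apply: H => //; [left|right].
Qed.

(** The kernel phi(xi) u(v) e^{-i xi v} is integrable on the plane, and exchanging
    the two integrations is the multiplication formula. *)
Lemma fourier_is_fourier u : Cintegrable setT u -> is_fourier u (fourier u).
Proof.
move=> iu phi sphi; have iphi := schwartz_Cintegrable sphi.
have [t1 t2] := Cintegrable_tensor measurableT measurableT iphi iu.
have mth : measurable_fun ([set: measurableTypeR R] `*` [set: measurableTypeR R])
    (fun z => - ((z.1 : R) * (z.2 : R))).
  by rewrite setXTT; exact: measurable_phase.
have [k1 k2] := integrable_mul_expi (measurableX measurableT measurableT) mth t1 t2.
transitivity (Cintegral setT (fun xi => Cintegral setT (fun v =>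
    phi xi * u v * expi (- (xi * v))))).
  apply: eq_Cintegral => xi _; rewrite /fourier mulrC -CintegralZ//.
    by apply: eq_Cintegral => v _; rewrite mulrA.
  exact: Cintegrable_character.
rewrite (@Cfubini setT setT (fun xi v => phi xi * u v * expi (- (xi * v))))//.
apply: eq_Cintegral => v _; rewrite /fourier -CintegralZ//; last exact: Cintegrable_character.
by apply: eq_Cintegral => xi _; rewrite mulrAC mulrC [v * xi]mulrC.
Qed.

Lemma fourier_modulate u b xi :
  fourier (fun v => u v * expi (- (b * v))) xi = fourier u (xi + b).
Proof.
apply: eq_Cintegral => v _; rewrite -mulrA -expiD; congr (_ * expi _); ring.
Qed.

Lemma fourier_conj u xi : Cintegrable setT u ->
  fourier (fun v => conjc (u v)) xi = conjc (fourier u (- xi)).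
Proof.
move=> iu; rewrite /fourier -Cintegral_conj//; last exact: Cintegrable_character.
apply: eq_Cintegral => v _; rewrite conjC_M conj_expi; congr (_ * expi _); ring.
Qed.

Lemma fourierD u w xi : Cintegrable setT u -> Cintegrable setT w ->
  fourier (fun v => u v + w v) xi = fourier u xi + fourier w xi.
Proof.
move=> iu iw; rewrite /fourier -CintegralD//; [|exact: Cintegrable_character..].
by apply: eq_Cintegral => v _; rewrite mulrDl.
Qed.

Lemma fourierZ z u xi : Cintegrable setT u ->
  fourier (fun v => z * u v) xi = z * fourier u xi.
Proof.
move=> iu; rewrite /fourier -CintegralZ//; last exact: Cintegrable_character.
by apply: eq_Cintegral => v _; rewrite mulrA.
Qed.

End FourierTransform.

(** * The sum of the waves *)
Section WaveSums.
Context (R : realType).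
Local Notation mu := (@lebesgue_measure R).
Local Notation torus := (@torus R).
Let mT : measurable (torus : set (measurableTypeR R)) := @measurable_torus R.
Variables (psi : R -> R[i]) (s : R) (c : nat -> R[i]).
Hypotheses (psi_schwartz : schwartz psi) (s_ge0 : 0 <= s) (c_l2 : square_summable c).

Definition wave_coef (k : nat) : R[i] :=
  c k * ((1 + k%:R ^+ 2) `^ (- (s / 2)))%:C.

Lemma ge1_1Dsqr (x : R) : 1 <= 1 + x ^+ 2.
Proof. by rewrite lerDl sqr_ge0. Qed.

Lemma wave_coef_summable : square_summable wave_coef.
Proof.
apply: le_lt_trans c_l2; apply: lee_nneseries => [k _ _|k _].
  by rewrite lee_fin sqnorm_ge0.
rewrite lee_fin /wave_coef sqnormM sqnormC ler_piMr ?sqnorm_ge0//.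
rewrite exprn_ile1 ?powR_ge0// -[leRHS](powRr0 (1 + k%:R ^+ 2)).
by rewrite ler_powR ?ge1_1Dsqr// oppr_le0 divr_ge0.
Qed.

(** The phases k x and (- k - k t) v add up to k (x - (1 + t) v). *)
Lemma sum_waveE N t x v : \sum_(1 <= k < N) wave psi s c k t x v =
  trig_sum wave_coef 1 N (x - (1 + t) * v) * psi v.
Proof.
rewrite /trig_sum mulr_suml; apply: eq_bigr => k _; rewrite /wave -/(wave_coef k).
rewrite -[_ * expi _ * expi _]mulrA -expiD; congr (_ * expi _ * _); ring.
Qed.

Lemma psi_sqnorm_integrable : mu.-integrable setT (fun v => (sqnorm (psi v))%:E).
Proof.
have H (u : R -> R) : Rschwartz u -> mu.-integrable setT (fun v => (u v ^+ 2)%:E).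
  move=> su; have [M HM] := Rschwartz_bounded su.
  under eq_fun do rewrite expr2.
  apply: (integrable_mulr_bounded (M := M)) => //.
  - exact: Rschwartz_integrable.
  - exact: Rschwartz_measurable.
by case: psi_schwartz => /H h1 /H h2; exact: (integrableD measurableT h1 h2).
Qed.

Variable G : R -> R[i].
Hypotheses (mG : Cmeasurable setT G) (pG : periodic G).
Hypothesis G_lim :
  (\int[mu]_(x in torus) (sqnorm (G x - trig_sum wave_coef 1 N.+1 x))%:E)%E
    @[N --> \oo] --> 0%E.

(** The number x - (1 + t) v is the position at time - 1 of the free particle
    that is at x with velocity v at time t. *)
Definition profile (t x v : R) : R[i] := G (x - (1 + t) * v) * psi v.

Lemma measurable_shear3 :
  measurable_fun setT (fun p : R * R * R => p.1.2 - (1 + p.1.1) * p.2).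
Proof.
apply: measurable_funB.
  by apply: measurableT_comp; [exact: measurable_snd|exact: measurable_fst].
apply: measurable_funM; last exact: measurable_snd.
apply: measurable_funD; first exact: measurable_cst.
by apply: measurableT_comp; [exact: measurable_fst|exact: measurable_fst].
Qed.

Lemma measurable_shear2 (a : R) :
  measurable_fun setT (fun p : R * R => p.1 - a * p.2).
Proof.
apply: measurable_funB; first exact: measurable_fst.
by apply: measurable_funM; [exact: measurable_cst|exact: measurable_snd].
Qed.

Lemma measurable_profile3 :
  Cmeasurable setT (fun p : R * R * R => profile p.1.1 p.1.2 p.2).
Proof.
apply: CmeasurableM; first exact: (CmeasurableT_comp mG measurable_shear3).
exact: CmeasurableT_comp (schwartz_Cmeasurable psi_schwartz) measurable_snd.
Qed.

Lemma measurable_profile2 t :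
  Cmeasurable setT (fun p : R * R => profile t p.1 p.2).
Proof.
apply: CmeasurableM; first exact: (CmeasurableT_comp mG (measurable_shear2 _)).
exact: CmeasurableT_comp (schwartz_Cmeasurable psi_schwartz) measurable_snd.
Qed.

Lemma measurable_trig_sumT N : Cmeasurable setT (trig_sum wave_coef 1 N).
Proof. by have [] := measurable_trig_sum wave_coef 1 N. Qed.

(** For fixed v the shear is a translation of the torus. *)
Lemma integral_shear (h : R -> R) (q : R -> R) (a : R) :
  measurable_fun setT h -> (forall x, 0 <= h x) -> periodic h ->
  measurable_fun setT q -> (forall x, 0 <= q x) ->
  (\int[mu \x mu]_(p in torus `*` setT) (h (p.1 - a * p.2)%R * q p.2)%:E =
   (\int[mu]_(x in torus) (h x)%:E) * (\int[mu]_v (q v)%:E))%E.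
Proof.
move=> mh h0 ph mq q0.
rewrite (tonelli2 mu mu mT measurableT); last 2 first.
- apply: measurable_funTS; apply/measurable_EFinP; apply: measurable_funM.
    exact: (measurableT_comp mh (measurable_shear2 a)).
  exact: (measurableT_comp mq measurable_snd).
- by move=> p _; rewrite lee_fin mulr_ge0.
rewrite -ge0_integralZl//; last 3 first.
- exact/measurable_EFinP.
- by move=> v _; rewrite lee_fin.
- by apply: integral_ge0 => x _; rewrite lee_fin.
apply: eq_integral => v _ /=.
under eq_integral do rewrite EFinM.
rewrite ge0_integralZr//; last 3 first.
- apply/measurable_EFinP; apply: measurable_funTS; apply: (measurableT_comp mh).
  by apply: measurable_funB => //; exact: measurable_cst.
- by move=> x _; rewrite lee_fin.
- by rewrite lee_fin.
congr (_ * _)%E.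
have := @ge0_integral_periodic R (fun x => (h x)%:E) (- (a * v)); apply.
- exact/measurable_EFinP.
- by move=> x; rewrite lee_fin.
- by move=> x; rewrite ph.
Qed.

Lemma trig_sum_periodic N : periodic (trig_sum wave_coef 1 N).
Proof. by move=> x; apply: eq_bigr => k _; rewrite (expi_periodic k%:Z). Qed.

Lemma wave_sum_profile : is_wave_sum psi s c profile.
Proof.
split.
- by move=> t v _ x; rewrite /profile addrAC pG.
- by have [h1 h2] := measurable_profile3; split; exact: measurable_funTS.
- move=> t t0.
  set q := (\int[mu]_v (sqnorm (psi v))%:E)%E.
  have qfin : q \is a fin_num by exact: integrable_fin_num psi_sqnorm_integrable.
  have := cvgeZr qfin G_lim; rewrite mul0e; apply: cvg_trans.
  apply: near_eq_cvg; apply: nearW => N /=.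
  rewrite -(integral_shear (h := fun x => sqnorm (G x - trig_sum wave_coef 1 N.+1 x)) (1 + t)).
  + by apply: eq_integral => p _; rewrite sum_waveE /profile -mulrBl sqnormM.
  + by apply: measurable_sqnorm; apply: CmeasurableB => //; exact: measurable_trig_sumT.
  + by move=> x; exact: sqnorm_ge0.
  + by move=> x; rewrite pG trig_sum_periodic.
  + exact: (measurable_sqnorm (schwartz_Cmeasurable psi_schwartz)).
  + by move=> x; exact: sqnorm_ge0.
Qed.

Section Uniqueness.
Variable g : R -> R -> R -> R[i].
Hypothesis gsum : is_wave_sum psi s c g.

Lemma measurable_wave_section (h : R -> R -> R -> R[i]) t : 0 <= t ->
  is_wave_sum psi s c h -> Cmeasurable setT (fun p : R * R => h t p.1 p.2).
Proof.
move=> t0 [_ [m1 m2] _].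
have mD : measurable [set p : R * R * R | 0 <= p.1.1].
  rewrite (_ : [set _ | _] = (fst \o fst) @^-1` `[0, +oo[%classic); last first.
    by apply/seteqP; split=> p /=; rewrite in_itv/= andbT.
  rewrite -[X in measurable X]setTI.
  by apply: (measurableT_comp (f := fst) measurable_fst measurable_fst).
have mS : measurable_fun setT (fun p : R * R => (t, p.1, p.2)).
  apply: measurable_fun_pair; last exact: measurable_snd.
  by apply: measurable_fun_pair; [exact: measurable_cst|exact: measurable_fst].
have sub : range (fun p : R * R => (t, p.1, p.2)) `<=` [set p : R * R * R | 0 <= p.1.1].
  by move=> _ [p _ <-].
split; [exact: (measurable_comp mD sub m1 mS)|exact: (measurable_comp mD sub m2 mS)].
Qed.

(** By |g - p|^2 <= 2 |g - S_N|^2 + 2 |p - S_N|^2, where p is the profile and S_N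
    is the N-th partial sum of the waves. *)
Lemma wave_sum_profile_dist0 t : 0 <= t ->
  (\int[mu \x mu]_(p in torus `*` setT)
    (sqnorm (g t p.1 p.2 - profile t p.1 p.2))%:E = 0)%E.
Proof.
move=> t0; apply/eqP; rewrite eq_le; apply/andP; split; last first.
  by apply: integral_ge0 => p _; rewrite lee_fin sqnorm_ge0.
have mTT : measurable ((torus : set (measurableTypeR R)) `*` [set: measurableTypeR R]).
  exact: measurableX.
have [_ _ L1] := gsum; have [_ _ L2] := wave_sum_profile.
have mW N : Cmeasurable setT (fun p : R * R => \sum_(1 <= k < N.+1) wave psi s c k t p.1 p.2).
  under eq_fun do rewrite sum_waveE; apply: CmeasurableM.
    exact: (CmeasurableT_comp (measurable_trig_sumT _) (measurable_shear2 _)).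
  exact: CmeasurableT_comp (schwartz_Cmeasurable psi_schwartz) measurable_snd.
have mg := measurable_wave_section t0 gsum; have mp := measurable_profile2 t.
have mS (u w : R * R -> R[i]) : Cmeasurable setT u -> Cmeasurable setT w ->
    measurable_fun ((torus : set (measurableTypeR R)) `*` [set: measurableTypeR R])
      (fun p => (2 * sqnorm (u p - w p))%:E).
  move=> mu_ mw; apply: measurable_funTS; apply/measurable_EFinP.
  apply: measurable_funM; first exact: measurable_cst.
  by apply: measurable_sqnorm; exact: CmeasurableB.
have mS1 (u w : R * R -> R[i]) : Cmeasurable setT u -> Cmeasurable setT w ->
    measurable_fun ((torus : set (measurableTypeR R)) `*` [set: measurableTypeR R])
      (fun p => (sqnorm (u p - w p))%:E).
  move=> mu_ mw; apply: measurable_funTS; apply/measurable_EFinP.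
  by apply: measurable_sqnorm; exact: CmeasurableB.
have f2 : (2%:E : \bar R)%E \is a fin_num by [].
have L1' := cvgeZl f2 (L1 t t0); have L2' := cvgeZl f2 (L2 t t0).
rewrite mule0 in L1' L2'.
have L := (fun H => cvgeD H L1' L2') isT; rewrite adde0 in L.
apply: (cvge_to_ge (L _)); apply: nearW => N /=.
rewrite -!ge0_integralZl//; last 4 first.
- by apply: mS1.
- by move=> p _; rewrite lee_fin sqnorm_ge0.
- by apply: mS1.
- by move=> p _; rewrite lee_fin sqnorm_ge0.
rewrite -ge0_integralD//; last 4 first.
- by move=> p _; rewrite -EFinM lee_fin mulr_ge0// sqnorm_ge0.
- by under eq_fun do rewrite -EFinM; exact: mS.
- by move=> p _; rewrite -EFinM lee_fin mulr_ge0// sqnorm_ge0.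
- by under eq_fun do rewrite -EFinM; exact: mS.
apply: ge0_le_integral => //.
- by move=> p _; rewrite lee_fin sqnorm_ge0.
- exact: mS1.
- by apply: emeasurable_funD; under eq_fun do rewrite -EFinM; exact: mS.
move=> p _; rewrite -!EFinM -EFinD lee_fin.
rewrite -[X in _ <= _ + 2 * X]sqnormN opprB.
by apply: le_trans (sqnormD_le _ _); rewrite addrA subrK.
Qed.

(** The L^2 distance only sees one period in x; periodicity extends the
    conclusion to all positions. *)
Lemma wave_sum_unique t : 0 <= t ->
  (mu \x mu)%E [set p | g t p.1 p.2 <> profile t p.1 p.2] = 0%E.
Proof.
move=> t0.
have mg := measurable_wave_section t0 gsum; have mp := measurable_profile2 t.
have [pg _ _] := gsum.
pose h (p : R * R) := sqnorm (g t p.1 p.2 - profile t p.1 p.2).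
have mh : measurable_fun setT h by apply: measurable_sqnorm; exact: CmeasurableB.
apply/(product_null2 mu mu (measurable_neqT mg mp)).
have mhE : measurable_fun ((torus : set (measurableTypeR R)) `*` [set: measurableTypeR R]) 
    (fun p => (h p)%:E).
  by apply: measurable_funTS; exact/measurable_EFinP.
have h0 p : (0 <= (h p)%:E)%E by rewrite lee_fin sqnorm_ge0.
have := wave_sum_profile_dist0 t0; rewrite (tonelli2 mu mu mT measurableT mhE)//.
have mI := measurable_tonelli2 mu mT measurableT mhE (fun p _ => h0 p).
have I0 v : (0 <= \int[mu]_(x in torus) (h (x, v))%:E)%E by exact: integral_ge0.
move=> Z.
have /(ae_eq_integral_abs _ measurableT mI) :
    (\int[mu]_v `|\int[mu]_(x in torus) (h (x, v))%:E| = 0)%E.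
  by rewrite -[RHS]Z; apply: eq_integral => v _; rewrite gee0_abs.
apply: filterS => v /(_ I) /= Iv.
have mhv : measurable_fun (torus : set (measurableTypeR R)) (fun x => (h (x, v))%:E).
  exact: (measurable_section2 mT measurableT mhE).
have /(ae_eq_integral_abs _ mT mhv) H : (\int[mu]_(x in torus) `|(h (x, v))%:E| = 0)%E.
  by rewrite -[RHS]Iv; apply: eq_integral => x _; rewrite gee0_abs.
have mNv : measurable [set x | g t x v <> profile t x v].
  by apply: measurable_neqT; [exact: Cmeasurable_pair2 mg|exact: Cmeasurable_pair2 mp].
apply/negligibleP => //; apply: negligible_periodic.
  by move=> x /=; rewrite pg// /profile addrAC pG.
apply: negligibleS H => x [/= hx xT]; apply/not_implyP; split => //.
by move=> [/sqnorm_eq0/eqP]; rewrite subr_eq0 => /eqP.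
Qed.

End Uniqueness.
End WaveSums.

(** * Fourier coefficients *)
Section SumsOverIntegers.
Context (R : realType).

(** Each natural number is the absolute value of at most two integers. *)
Lemma esum_int_absz (b : nat -> R) (K : R) : (forall k, 0 <= b k) -> 0 <= K ->
  (\sum_(0 <= k <oo) (b k)%:E < +oo)%E ->
  (\esum_(l in [set: int]) (K * b `|l|%N)%:E < +oo)%E.
Proof.
move=> b0 K0 bfin.
have Kb0 k : (0 <= (K * b k)%:E)%E by rewrite lee_fin mulr_ge0.
have Kfin : (\esum_(k in [set: nat]) (K * b k)%:E < +oo)%E.
  rewrite -nneseries_esumT//; under eq_eseriesr do rewrite EFinM.
  rewrite nneseriesZl//; last by move=> k _; rewrite lee_fin.
  by rewrite lte_mul_pinfty// ge0_fin_numE// nneseries_ge0// => k _ _; rewrite lee_fin.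
rewrite (esumID [set l | 0 <= l])//.
rewrite !setTI; apply: lte_add_pinfty.
- rewrite (@reindex_esum _ _ _ [set: nat] _ Posz).
    by under eq_esum do rewrite absz_nat.
  split=> //; first by move=> x y _ _ [].
  by case=> // n _; exists n.
- rewrite (@reindex_esum _ _ _ [set n | (0 < n)%N] _ (fun n : nat => - n%:Z)).
    apply: le_lt_trans Kfin; rewrite esum_mkcond; apply: le_esum => n _.
    by rewrite abszN absz_nat; case: ifP.
  split=> [n /= n0|x y _ _ /oppr_inj[]//|l /= l0].
    by lia.
  by exists `|l|%N => /=; lia.
Qed.
End SumsOverIntegers.

Section FourierCoefficients.
Context (R : realType).
Local Notation mu := (@lebesgue_measure R).
Local Notation torus := (@torus R).
Let mT : measurable (torus : set (measurableTypeR R)) := @measurable_torus R.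

Lemma Cintegral_ae_eq (D : set (measurableTypeR R)) (u w : R -> R[i]) :
  measurable D -> Cmeasurable D u -> Cmeasurable D w ->
  {ae mu, forall x, u x = w x} -> Cintegral D u = Cintegral D w.
Proof.
move=> mD [u1 u2] [w1 w2] uw; apply: complexP => /=; congr fine.
- apply: ae_eq_integral => //; [exact/measurable_EFinP|exact/measurable_EFinP|].
  by apply: (@filterS _ _ (ae_filter_ringOfSetsType mu) _ _ _ uw) => x /= ->.
- apply: ae_eq_integral => //; [exact/measurable_EFinP|exact/measurable_EFinP|].
  by apply: (@filterS _ _ (ae_filter_ringOfSetsType mu) _ _ _ uw) => x /= ->.
Qed.

Lemma Cintegral_periodic (u : R -> R[i]) (a : R) :
  Cmeasurable setT u -> periodic u ->
  Cintegral torus (fun x => u (x + a)) = Cintegral torus u.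
Proof.
move=> [u1 u2] pu; apply: complexP => /=.
- by apply: (Rintegral_periodic a u1) => x; rewrite pu.
- by apply: (Rintegral_periodic a u2) => x; rewrite pu.
Qed.

Lemma Cintegrable_periodic (u : R -> R[i]) (a : R) :
  Cmeasurable setT u -> periodic u -> Cintegrable torus u ->
  Cintegrable torus (fun x => u (x + a)).
Proof.
move=> [u1 u2] pu [i1 i2]; split.
- by apply: (integrable_periodic a u1) => // x; rewrite pu.
- by apply: (integrable_periodic a u2) => // x; rewrite pu.
Qed.

(** The l-th coefficient of the conjugate of z is the conjugate of the (- l)-th
    coefficient of z. *)
Lemma fourier_coef_Re (z : R -> R[i]) (l : int) : Cintegrable torus z ->
  fourier_coef (fun x => complex.Re (z x)) l =
  ((2 * pi)^-1)%:C * (2^-1)%:C *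
  (Cintegral torus (fun x => z x * expi (- (l%:~R * x))) +
   conjc (Cintegral torus (fun x => z x * expi (- ((- l)%:~R * x))))).
Proof.
move=> iz.
have i1 : Cintegrable torus (fun x => z x * expi (- (l%:~R * x))).
  have := Cintegrable_modulate (- l%:~R) 0 mT iz.
  by under eq_fun do rewrite mulNr addr0.
have i2 : Cintegrable torus (fun x => z x * expi (- ((- l)%:~R * x))).
  have := Cintegrable_modulate (l%:~R) 0 mT iz.
  under eq_fun do rewrite addr0.
  by under [X in _ -> Cintegrable _ X]eq_fun do rewrite rmorphN/= mulNr opprK.
have ic : Cintegrable torus (fun x => conjc (z x * expi (- ((- l)%:~R * x)))).
  case: i2 => h1 h2; split.
  - by move: h1; apply: eq_integrable => // x _; congr (_%:E); case: (_ * _).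
  - by have := integrableN h2; apply: eq_integrable => // x _ /=; case: (z x * _).
rewrite /fourier_coef -mulrA; congr (_ * _).
rewrite -Cintegral_conj// -CintegralD// -CintegralZ//; last exact: CintegrableD.
apply: eq_Cintegral => x _; rewrite conjC_M conj_expi opprK rmorphN/= mulNr -mulrDl mulrA.
congr (_ * _); apply: complexP; rewrite ?cReM ?cImM ?cReD ?cImD/=; case: (z x) => a b /=.
  by field.
by ring.
Qed.

Lemma fourier_coef_eq0_moments (u : R -> R) (l : int) : mu.-integrable torus (EFin \o u) ->
  fourier_coef u l = 0 ->
  \int[mu]_(x in torus) (u x * cos (l%:~R * x)) = 0 /\
  \int[mu]_(x in torus) (u x * sin (l%:~R * x)) = 0.
Proof.
move=> iu /eqP; rewrite mulf_eq0 => /orP[/eqP/(congr1 (@complex.Re R))/= /eqP|/eqP H].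
  by rewrite invr_eq0 gt_eqF// two_pi_gt0.
split.
- move/(congr1 (@complex.Re R)): H => /= <-; apply: eq_Rintegral => x _.
  by rewrite /= cosN mul0r subr0.
- move/(congr1 (@complex.Im R))/(congr1 (fun r => - r)): H => /=; rewrite oppr0 => <-.
  under [in RHS]eq_Rintegral do rewrite sinN mul0r addr0.
  rewrite -mulN1r -RintegralZl//.
    by apply: eq_Rintegral => x _; rewrite mulN1r mulrN opprK.
  have ms : measurable_fun (torus : set (measurableTypeR R)) (fun x => - sin (l%:~R * x)).
    apply: measurable_funN; have := @measurable_sin_affine R l%:~R 0 torus.
    by under eq_fun do rewrite addr0.
  apply: (integrable_mulr_bounded (M := 1) mT iu ms) => x _.
  by rewrite normrN sin_norm_le1.
Qed.

(** Coefficients of a real function are its moments against cosines and sines,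
    and cos (l x + b) is a combination of cos (l x) and sin (l x). *)
Theorem ae_eq0_fourier_coef (u : R -> R) : mu.-integrable torus (EFin \o u) ->
  periodic u -> (forall l, fourier_coef u l = 0) -> {ae mu, forall x, u x = 0}.
Proof.
move=> iu pu u0.
have : {ae mu, forall x, torus x -> u x = 0}.
  apply: ae_eq0_cos_moments => // l b.
  have [c0 s0] := fourier_coef_eq0_moments iu (u0 l).
  have mc : measurable_fun (torus : set (measurableTypeR R)) (fun x => cos (l%:~R * x)).
    by have := @measurable_cos_affine R l%:~R 0 torus; under eq_fun do rewrite addr0.
  have ms : measurable_fun (torus : set (measurableTypeR R)) (fun x => sin (l%:~R * x)).
    by have := @measurable_sin_affine R l%:~R 0 torus; under eq_fun do rewrite addr0.
  have ic := integrable_mulr_bounded (M := 1) mT iu mc (fun x _ => cos_norm_le1 _).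
  have is_ := integrable_mulr_bounded (M := 1) mT iu ms (fun x _ => sin_norm_le1 _).
  transitivity (\int[mu]_(x in torus) (cos b * (u x * cos (l%:~R * x)) -
      sin b * (u x * sin (l%:~R * x)))).
    by apply: eq_Rintegral => x _; rewrite cosD; ring.
  rewrite RintegralB//; last 2 first.
  - exact: (integrableZl mT _ ic).
  - exact: (integrableZl mT _ is_).
  by rewrite !RintegralZl// c0 s0 !mulr0 subrr.
move=> H; apply: negligible_periodic.
  by move=> x /=; rewrite pu.
by apply: negligibleS H => x /= [ux xT] /(_ xT).
Qed.

End FourierCoefficients.

Section Solution.
Context (R : realType).
Local Notation mu := (@lebesgue_measure R).
Local Notation torus := (@torus R).
Let mT : measurable (torus : set (measurableTypeR R)) := @measurable_torus R.
Variables (psi : R -> R[i]) (s : R) (c : nat -> R[i]).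
Hypotheses (psi_schwartz : schwartz psi) (s_ge0 : 0 <= s) (c_l2 : square_summable c).
Variable G : R -> R[i].
Hypotheses (mG : Cmeasurable setT G) (pG : periodic G).
Hypothesis G_lim :
  (\int[mu]_(x in torus) (sqnorm (G x - trig_sum (wave_coef s c) 1 N.+1 x))%:E)%E
    @[N --> \oo] --> 0%E.
Variable g : R -> R -> R -> R[i].
Hypothesis gsum : is_wave_sum psi s c g.

Let iG : Cintegrable torus G := Cintegrable_L2_limit mG G_lim.
Let mpsi : Cmeasurable setT psi := schwartz_Cmeasurable psi_schwartz.
Let ipsi : Cintegrable setT psi := schwartz_Cintegrable psi_schwartz.

Section FixedTime.
Variables (t : R) (t_ge0 : 0 <= t).

Let mg : Cmeasurable setT (fun p : R * R => g t p.1 p.2) :=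
  measurable_wave_section t_ge0 gsum.
Let mp : Cmeasurable setT (fun p : R * R => profile psi G t p.1 p.2) :=
  measurable_profile2 psi_schwartz mG t.
Let N0 := wave_sum_unique psi_schwartz mG pG G_lim gsum t_ge0.
Let mN : measurable [set p : R * R | g t p.1 p.2 <> profile psi G t p.1 p.2] :=
  measurable_neqT mg mp.

Lemma wave_sum_fiber2 :
  {ae mu, forall v, {ae mu, forall x, g t x v = profile psi G t x v}}.
Proof.
have := (product_null2 mu mu mN).1 N0; apply: filterS => v /=.
have mNv : measurable [set x | g t x v <> profile psi G t x v].
  by apply: measurable_neqT; [exact: Cmeasurable_pair2 mg|exact: Cmeasurable_pair2 mp].
by move=> H; apply/(negligibleP mu).
Qed.

Lemma wave_sum_fiber1 :
  {ae mu, forall x, {ae mu, forall v, g t x v = profile psi G t x v}}.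
Proof.
have := (product_null1 mu mu mN).1 N0; apply: filterS => x /=.
have mNx : measurable [set v | g t x v <> profile psi G t x v].
  by apply: measurable_neqT; [exact: Cmeasurable_pair1 mg|exact: Cmeasurable_pair1 mp].
by move=> H; apply/(negligibleP mu).
Qed.

(** The l-th Fourier coefficient of G. *)
Definition mode (l : int) : R[i] := if 0 < l then wave_coef s c `|l|%N else 0.

(** The l-th Fourier coefficient in x of the real part of the profile at time t,
    as a function of v. *)
Definition amplitude (l : int) (v : R) : R[i] :=
  (2^-1)%:C * (mode l * (psi v * expi (- (l%:~R * (1 + t) * v))) +
    conjc (mode (- l) * (psi v * expi (- ((- l)%:~R * (1 + t) * v))))).

Lemma Cintegrable_profile_fiber v : Cintegrable torus (profile psi G t ^~ v).
Proof.
have := CintegrableZ mT (psi v) (Cintegrable_periodic (- ((1 + t) * v)) mG pG iG).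
by under eq_fun do rewrite mulrC.
Qed.

Lemma Cintegral_profile_fiber v (l : int) :
  Cintegral torus (fun x => profile psi G t x v * expi (- (l%:~R * x))) =
  (2 * pi)%:C * (mode l * (psi v * expi (- (l%:~R * (1 + t) * v)))).
Proof.
pose H x := G x * expi (- (l%:~R * x)).
have mH : Cmeasurable setT H.
  have := Cmeasurable_modulate (- l%:~R) 0 mG.
  by under eq_fun do rewrite mulNr addr0.
have pH : periodic H by move=> x; rewrite /H pG -!mulNr -rmorphN/= expi_periodic.
have iH : Cintegrable torus H.
  have := Cintegrable_modulate (- l%:~R) 0 mT iG.
  by under eq_fun do rewrite mulNr addr0.
transitivity (Cintegral torus (fun x =>
    (psi v * expi (- (l%:~R * (1 + t) * v))) * H (x + - ((1 + t) * v)))).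
  apply: eq_Cintegral => x _; rewrite /profile /H.
  rewrite (_ : - (l%:~R * x) =
    - (l%:~R * (1 + t) * v) + - (l%:~R * (x + - ((1 + t) * v)))); last by ring.
  by rewrite expiD; ring.
rewrite CintegralZ//; last exact: Cintegrable_periodic.
rewrite Cintegral_periodic// (L2_limit_coef mG G_lim) -/(mode l).
by ring.
Qed.

(** For almost every v the section of g is that of the profile, a translate of G
    times psi(v); translating by (1 + t) v multiplies the l-th coefficient
    by e^{-il(1 + t)v}, and the real part mixes the modes l and - l. *)
Lemma fourier_coef_wave_sum (l : int) :
  {ae mu, forall v, fourier_coef (fun x => complex.Re (g t x v)) l = amplitude l v}.
Proof.
apply: (@filterS _ _ (ae_filter_ringOfSetsType mu) _ _ _ wave_sum_fiber2) => v gv.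
have p0 : 2 * pi != 0 :> R by rewrite gt_eqF// two_pi_gt0.
transitivity (fourier_coef (fun x => complex.Re (profile psi G t x v)) l).
  rewrite /fourier_coef; congr (_ * _).
  have M (h : R -> R -> R -> R[i]) : Cmeasurable setT (fun p : R * R => h t p.1 p.2) ->
      Cmeasurable (torus : set (measurableTypeR R))
        (fun x => (complex.Re (h t x v))%:C * expi (- (l%:~R * x))).
    move=> [m1 m2]; have [mh _] := Cmeasurable_pair2 v (conj m1 m2).
    have mth : measurable_fun [set: R] (fun x : R => - (l%:~R * x)).
      by apply: measurable_funN; apply: measurable_funM => //; exact: measurable_cst.
    have [a b] := @Cmeasurable_mul_expi _ R R setT (fun x => (complex.Re (h t x v))%:C)
      _ mth (conj mh (measurable_cst (0 : R))).
    by split; exact: measurable_funTS.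
  apply: Cintegral_ae_eq => //; [exact: M|exact: (M (profile psi G))|].
  by apply: (@filterS _ _ (ae_filter_ringOfSetsType mu) _ _ _ gv) => x /= ->.
rewrite fourier_coef_Re; last exact: Cintegrable_profile_fiber.
rewrite !Cintegral_profile_fiber /amplitude [conjc ((2 * pi)%:C * _)]conjC_M.
rewrite (_ : conjc (2 * pi)%:C = (2 * pi)%:C); last by apply: complexP; rewrite //= oppr0.
have inv : ((2 * pi)^-1)%:C * (2 * pi)%:C = 1 :> R[i].
  by apply: complexP; rewrite ?cReM ?cImM/= ?mul0r ?mulr0 ?addr0 ?subr0// mulVf.
by rewrite -mulrDr mulrACA inv mul1r.
Qed.

End FixedTime.
End Solution.

Lemma measurable_fourier_coef (R : realType) (u : R -> R -> R) (l : int) :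
  measurable_fun setT (fun p : R * R => u p.1 p.2) ->
  Cmeasurable setT (fun v => fourier_coef (u^~ v) l).
Proof.
move=> mu_; have mT := @measurable_torus R.
have mth : measurable_fun setT (fun p : R * R => - (l%:~R * p.2)).
  apply: measurable_funN; apply: measurable_funM; first exact: measurable_cst.
  exact: measurable_snd.
have msw : measurable_fun setT (fun p : R * R => (p.2, p.1)).
  by apply: measurable_fun_pair; [exact: measurable_snd|exact: measurable_fst].
have mu2 : measurable_fun setT (fun p : R * R => u p.2 p.1).
  exact: (measurableT_comp mu_ msw).
have mus : Cmeasurable setT (fun p : R * R => (u p.2 p.1)%:C).
  by split; [exact: mu2|exact: measurable_cst].
have [k1 k2] := Cmeasurable_mul_expi mth mus.
apply: CmeasurableM; first by split; exact: measurable_cst.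
split.
- apply: (@measurable_fun_param_Rintegral _ _ (measurableTypeR R) (measurableTypeR R) R
    (@lebesgue_measure R) (@torus R)
    (fun v x => complex.Re ((u x v)%:C * expi (- (l%:~R * x))))) => //.
  exact: measurable_funTS.
- apply: (@measurable_fun_param_Rintegral _ _ (measurableTypeR R) (measurableTypeR R) R
    (@lebesgue_measure R) (@torus R)
    (fun v x => complex.Im ((u x v)%:C * expi (- (l%:~R * x))))) => //.
  exact: measurable_funTS.
Qed.

(** * Sobolev regularity *)
Section Regularity.
Context (R : realType).
Local Notation mu := (@lebesgue_measure R).
Local Notation torus := (@torus R).
Let mT : measurable (torus : set (measurableTypeR R)) := @measurable_torus R.
Variables (psi : R -> R[i]) (s : R) (c : nat -> R[i]).
Hypotheses (psi_schwartz : schwartz psi) (s_ge0 : 0 <= s) (c_l2 : square_summable c).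
Hypothesis psi_supp : forall xi, 10^-1 < `|xi| -> fourier psi xi = 0.
Let ipsi : Cintegrable setT psi := schwartz_Cintegrable psi_schwartz.

Section FixedTime.
Variables (t : R) (t_ge0 : 0 <= t).

Lemma Cintegrable_amplitude (l : int) : Cintegrable setT (amplitude psi s c t l).
Proof.
have I (k : int) := CintegrableZ measurableT (mode s c k)
  (Cintegrable_character (k%:~R * (1 + t)) ipsi).
exact: (CintegrableZ measurableT _ (CintegrableD measurableT (I l)
  (Cintegrable_conj measurableT (I (- l))))).
Qed.

(** Modulation in v translates the Fourier transform. *)
Lemma fourier_amplitude (l : int) xi : fourier (amplitude psi s c t l) xi =
  (2^-1)%:C * (mode s c l * fourier psi (xi + l%:~R * (1 + t)) +
    conjc (mode s c (- l) * fourier psi (- (xi + l%:~R * (1 + t))))).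
Proof.
have I (k : int) := Cintegrable_character (k%:~R * (1 + t)) ipsi.
have I1 := CintegrableZ measurableT (mode s c l) (I l).
have I2 := CintegrableZ measurableT (mode s c (- l)) (I (- l)).
rewrite /amplitude fourierZ; last first.
  exact: (CintegrableD measurableT I1 (Cintegrable_conj measurableT I2)).
rewrite fourierD//; last exact: (Cintegrable_conj measurableT I2).
rewrite fourier_conj// !fourierZ// !fourier_modulate.
by congr (_ * (_ + conjc (_ * fourier _ _))); rewrite rmorphN/=; ring.
Qed.

Definition coef_sqnorm (l : int) : R := if l == 0 then 0 else sqnorm (c `|l|%N).

Lemma powR_mode (l : int) : (1 + l%:~R ^+ 2) `^ s * sqnorm (mode s c l) =
  if 0 < l then sqnorm (c `|l|%N) else 0.
Proof.
rewrite /mode; case: ifPn => l0; last by rewrite /sqnorm/= expr0n/= addr0 mulr0.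
have e : (`|l|%N%:R : R) = l%:~R by rewrite -[in RHS](gtz0_abs l0).
rewrite /wave_coef e sqnormM sqnormC mulrCA -[RHS]mulr1; congr (_ * _).
have w0 : 0 < (1 + l%:~R ^+ 2 : R) by rewrite (lt_le_trans ltr01)// ge1_1Dsqr.
rewrite [X in _ * X = _]expr2 -powRD; last by rewrite (gt_eqF w0) implybT.
rewrite -powRD; last by rewrite (gt_eqF w0) implybT.
by rewrite (_ : s + _ = 0) ?powRr0//; field.
Qed.

Lemma fourier_amplitude_far (l : int) xi : 10^-1 < `|xi + l%:~R * (1 + t)| ->
  fourier (amplitude psi s c t l) xi = 0.
Proof.
move=> far; rewrite fourier_amplitude !psi_supp ?normrN// !mulr0.
by apply: complexP; rewrite /=; ring.
Qed.

(** At most one of the modes l and - l is not 0, and its weighted square is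
    |c_|l||^2. *)
Lemma sqnorm_fourier_amplitude (M : R) : (forall xi, sqnorm (fourier psi xi) <= M) ->
  forall (l : int) xi, (1 + l%:~R ^+ 2) `^ s * sqnorm (fourier (amplitude psi s c t l) xi) <=
    2^-1 * M * coef_sqnorm l.
Proof.
move=> HM l xi; rewrite fourier_amplitude sqnormM sqnormC.
set A := mode s c l * _; set B := conjc _.
apply: (@le_trans _ _ ((1 + l%:~R ^+ 2) `^ s * (2^-1 ^+ 2 * (2 * sqnorm A + 2 * sqnorm B)))).
  by rewrite ler_wpM2l ?powR_ge0// ler_wpM2l ?sqr_ge0// sqnormD_le.
have M0 : 0 <= M by rewrite (le_trans _ (HM 0))// sqnorm_ge0.
have W : (1 + l%:~R ^+ 2) `^ s * sqnorm (mode s c l) +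
    (1 + l%:~R ^+ 2) `^ s * sqnorm (mode s c (- l)) = coef_sqnorm l.
  rewrite powR_mode -[X in (1 + X) `^ s * sqnorm (mode _ _ (- l))]sqrrN.
  rewrite -[X in X ^+ 2]rmorphN/= powR_mode.
  rewrite /coef_sqnorm abszN oppr_gt0; case: ltgtP => //; rewrite ?addr0 ?add0r//.
have -> : (1 + l%:~R ^+ 2) `^ s * (2^-1 ^+ 2 * (2 * sqnorm A + 2 * sqnorm B)) =
   2^-1 * ((1 + l%:~R ^+ 2) `^ s * sqnorm A + (1 + l%:~R ^+ 2) `^ s * sqnorm B) by field.
have B1 (k : int) z : (1 + l%:~R ^+ 2) `^ s * sqnorm (mode s c k * fourier psi z) <=
    M * ((1 + l%:~R ^+ 2) `^ s * sqnorm (mode s c k)).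
  by rewrite sqnormM mulrA mulrC ler_wpM2r// mulr_ge0 ?powR_ge0 ?sqnorm_ge0.
rewrite -mulrA ler_wpM2l// -W [leRHS]mulrDr; apply: lerD; first exact: B1.
by rewrite /B sqnorm_conj; exact: B1.
Qed.

(** On the support, |xi + l (1 + t)| <= 1/10, the two weights compare:
    1 + l^2 + xi^2 <= C (1 + l^2) with C = 2 + 2 (1 + t)^2. The support is an
    interval of length 1/5, whatever l is. *)
Lemma integral_fourier_amplitude : exists2 K : R, 0 <= K & forall l : int,
  (\int[mu]_xi ((1 + l%:~R ^+ 2 + xi ^+ 2) `^ s *
    sqnorm (fourier (amplitude psi s c t l) xi))%:E <= (K * coef_sqnorm l)%:E)%E.
Proof.
have [M HM] := fourier_bounded ipsi.
have M0 : 0 <= M by rewrite (le_trans _ (HM 0))// sqnorm_ge0.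
pose C : R := 2 + 2 * (1 + t) ^+ 2.
have C0 : 0 <= C by rewrite addr_ge0// mulr_ge0// sqr_ge0.
pose r : R := 10^-1.
have r0 : 0 < r by rewrite invr_gt0.
exists (C `^ s * (2^-1 * M) * (2 * r)).
  by rewrite !mulr_ge0 ?powR_ge0// ltW.
move=> l; have wl0 : 0 <= coef_sqnorm l.
  by rewrite /coef_sqnorm; case: ifP => // _; exact: sqnorm_ge0.
pose b := l%:~R * (1 + t); pose I : set (measurableTypeR R) := `[- b - r, - b + r]%classic.
pose k := C `^ s * (2^-1 * M * coef_sqnorm l).
have k0 : 0 <= k by rewrite !mulr_ge0 ?powR_ge0.
have mI : measurable I by exact: measurable_itv.
have [m1 m2] := fourier_measurable (Cintegrable_amplitude l).
have mw : measurable_fun [set: R] (fun xi : R => (1 + l%:~R ^+ 2 + xi ^+ 2) `^ s).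
  apply: (measurableT_comp (measurable_powR s)).
  by apply: measurable_funD; [exact: measurable_cst|exact: measurable_funX].
apply: (@le_trans _ _ (\int[mu]_xi (k * \1_I xi)%:E)%E).
  apply: ge0_le_integral => //.
  - by move=> xi _; rewrite lee_fin mulr_ge0 ?powR_ge0 ?sqnorm_ge0.
  - apply/measurable_EFinP; apply: measurable_funM => //.
    exact: (measurable_sqnorm (conj m1 m2)).
  - apply/measurable_EFinP; apply: measurable_funM => //.
  - move=> xi _; rewrite lee_fin indicE; case: (boolP (xi \in I)) => xiI; last first.
      rewrite fourier_amplitude_far ?mulr0 ?[sqnorm _]/sqnorm/= ?expr0n/= ?addr0 ?mulr0//.
      rewrite ltNge; apply: contra xiI => h; rewrite inE /I/= in_itv/=.
      by move: h; rewrite ler_norml -/b -/r; lra.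
    rewrite mulr1 /k; apply: le_trans (_ : C `^ s * ((1 + l%:~R ^+ 2) `^ s *
       sqnorm (fourier (amplitude psi s c t l) xi)) <= _); last first.
      by rewrite ler_wpM2l ?powR_ge0// sqnorm_fourier_amplitude.
    rewrite mulrA ler_wpM2r ?sqnorm_ge0// -powRM//; last by rewrite addr_ge0// sqr_ge0.
    have l20 : 0 <= l%:~R ^+ 2 :> R by exact: sqr_ge0.
    have n1 : 0 <= 1 + l%:~R ^+ 2 + xi ^+ 2 by rewrite !addr_ge0// sqr_ge0.
    have n2 : 0 <= C * (1 + l%:~R ^+ 2) by rewrite mulr_ge0// addr_ge0.
    apply: ge0_ler_powR => //.
    move: xiI; rewrite inE /I/= in_itv/= => /andP[h1 h2].
    have hx : xi ^+ 2 <= 2 * b ^+ 2 + 2 * r ^+ 2.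
      (* The inequality (xi + 2 b)^2 >= 0 is xi^2 <= 2 (xi + b)^2 + 2 b^2. *)
      by have := sqr_ge0 (xi + 2 * b); have : (xi + b) ^+ 2 <= r ^+ 2; nra.
    have r1 : 2 * r ^+ 2 <= 1 by rewrite /r; lra.
    by rewrite /b exprMn in hx; rewrite /C; have := sqr_ge0 (1 + t); nra.
under eq_integral do rewrite EFinM.
rewrite ge0_integralZl//; last first.
  by apply/measurable_EFinP; exact: measurable_indic.
rewrite integral_indic// setIT /I /= lebesgue_measure_itv/= lte_fin.
rewrite (_ : - b - r < - b + r); last by lra.
rewrite -EFinB -EFinM lee_fin /k le_eqVlt; apply/orP; left; apply/eqP; ring.
Qed.

Variable g : R -> R -> R -> R[i].
Hypothesis gsum : is_wave_sum psi s c g.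

(** Square integrability is that of the profile, whose squared norm is the
    product of those of G and psi; the Fourier transform is that of the
    amplitudes. *)
Theorem wave_sum_sobolev : sobolev s (fun x v => complex.Re (g t x v)).
Proof.
have [G [mG pG G_lim]] := riesz_fischer (wave_coef_summable s_ge0 c_l2).
have mg := measurable_wave_section t_ge0 gsum.
have mTT : measurable ((torus : set (measurableTypeR R)) `*` [set: measurableTypeR R]).
  exact: measurableX.
split.
- by move=> v x; have [pg _ _] := gsum; rewrite pg.
- exact: mg.1.
- have mp := measurable_profile2 psi_schwartz mG t.
  have h0 := wave_sum_profile_dist0 psi_schwartz mG pG G_lim gsum t_ge0.
  have mS (u w : R * R -> R[i]) : Cmeasurable setT u -> Cmeasurable setT w ->
      measurable_fun ((torus : set (measurableTypeR R)) `*` [set: measurableTypeR R])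
      (fun p => (sqnorm (u p - w p))%:E).
    move=> mu_ mw; apply: measurable_funTS; apply/measurable_EFinP.
    by apply: measurable_sqnorm; exact: CmeasurableB.
  have mS0 : measurable_fun ((torus : set (measurableTypeR R)) `*` [set: measurableTypeR R])
      (fun p => (sqnorm (profile psi G t p.1 p.2))%:E).
    by apply: measurable_funTS; apply/measurable_EFinP; exact: measurable_sqnorm.
  apply: (@le_lt_trans _ _ (\int[mu \x mu]_(p in torus `*` setT)
     (2%:E * (sqnorm (g t p.1 p.2 - profile psi G t p.1 p.2))%:E +
      2%:E * (sqnorm (profile psi G t p.1 p.2))%:E))%E).
    apply: ge0_le_integral => //.
    + by move=> p _; rewrite lee_fin sqr_ge0.
    + apply: measurable_funTS; apply/measurable_EFinP; apply: measurable_funX.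
      exact: mg.1.
    + apply: emeasurable_funD; apply: emeasurable_funM => //; try exact: measurable_cst.
      exact: mS.
    + move=> p _; rewrite -!EFinM -EFinD lee_fin.
      apply: le_trans (Re_sqr_le _) _; apply: le_trans (sqnormD_le _ _).
      by rewrite subrK.
  rewrite ge0_integralD//; last 4 first.
  + by move=> p _; rewrite -EFinM lee_fin mulr_ge0// sqnorm_ge0.
  + by apply: emeasurable_funM; [exact: measurable_cst|exact: mS].
  + by move=> p _; rewrite -EFinM lee_fin mulr_ge0// sqnorm_ge0.
  + by apply: emeasurable_funM; [exact: measurable_cst|exact: mS0].
  rewrite !ge0_integralZl//; last 3 first.
  + by move=> p _; rewrite lee_fin sqnorm_ge0.
  + exact: mS.
  + by move=> p _; rewrite lee_fin sqnorm_ge0.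
  rewrite h0 mule0 add0e.
  under eq_integral do rewrite /profile sqnormM.
  have E := @integral_shear R (fun x => sqnorm (G x)) (fun v => sqnorm (psi v))
    (1 + t) (measurable_sqnorm mG) (fun x => sqnorm_ge0 _)
    (fun x => congr1 _ (pG x)) (measurable_sqnorm (schwartz_Cmeasurable psi_schwartz))
    (fun x => sqnorm_ge0 _).
  rewrite /= in E; rewrite E.
  have f1 := integrable_fin_num mT (integrable_sqnorm_L2_limit mG G_lim).
  have f2 := integrable_fin_num measurableT (psi_sqnorm_integrable psi_schwartz).
  by rewrite -(fineK f1) -(fineK f2) -!EFinM ltry.
- exists (fun l => fourier (amplitude psi s c t l)); split.
  + by move=> l; apply: fourier_measurable; exact: Cintegrable_amplitude.
  + move=> l phi sphi; rewrite (fourier_is_fourier (Cintegrable_amplitude l) sphi).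
    have mphi := fourier_measurable (schwartz_Cintegrable sphi).
    apply: Cintegral_ae_eq => //.
    * apply: CmeasurableM => //; apply: Cintegrable_Cmeasurable.
      exact: Cintegrable_amplitude.
    * apply: CmeasurableM => //.
      exact: (measurable_fourier_coef l mg.1).
    have := fourier_coef_wave_sum psi_schwartz mG pG G_lim gsum t_ge0 l.
    move=> H; apply: (@filterS _ _ (ae_filter_ringOfSetsType mu) _ _ _ H) => v /= ->.
    by [].
  + have [K K0 HK] := integral_fourier_amplitude.
    apply: (@le_lt_trans _ _ (\esum_(l in [set: int]) (K * coef_sqnorm l)%:E)).
      by apply: le_esum => l _; exact: HK.
    pose b (k : nat) := if k == 0%N then 0 else sqnorm (c k).
    have bl l : coef_sqnorm l = b `|l|%N by rewrite /coef_sqnorm /b absz_eq0.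
    under eq_esum do rewrite bl.
    apply: esum_int_absz => //.
      by move=> k; rewrite /b; case: eqP => // _; exact: sqnorm_ge0.
    rewrite (nneseries_split 0 1); last first.
      by move=> k _; rewrite lee_fin /b; case: eqP => // _; exact: sqnorm_ge0.
    rewrite big_nat1 add0e; apply: le_lt_trans c_l2.
    apply: lee_nneseries => k.
      by move=> _ _; rewrite lee_fin /b; case: eqP => // _; exact: sqnorm_ge0.
    by move=> _; rewrite lee_fin /b; case: eqP => // _; exact: sqnorm_ge0.
Qed.

End FixedTime.
End Regularity.

(** * The force *)
Section Force.
Context (R : realType).
Local Notation mu := (@lebesgue_measure R).
Local Notation torus := (@torus R).
Let mT : measurable (torus : set (measurableTypeR R)) := @measurable_torus R.
Let mTT : measurable ((torus : set (measurableTypeR R)) `*` [set: measurableTypeR R]).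
Proof. exact: measurableX. Qed.

Lemma integrable_shear_tensor (A a : R -> R) (k : R) :
  measurable_fun setT A -> periodic A -> mu.-integrable torus (EFin \o A) ->
  measurable_fun setT a -> mu.-integrable setT (EFin \o a) ->
  (mu \x mu)%E.-integrable (torus `*` setT) (fun p => (A (p.1 - k * p.2) * a p.2)%:E).
Proof.
move=> mA pA iA ma ia.
have mk : measurable_fun setT (fun p : R * R => A (p.1 - k * p.2) * a p.2).
  apply: measurable_funM; first exact: (measurableT_comp mA (measurable_shear2 k)).
  exact: (measurableT_comp ma measurable_snd).
apply/integrableP; split; first by apply: measurable_funTS; exact/measurable_EFinP.
under eq_integral do rewrite /= normrM.
have nA : measurable_fun setT (fun x => `|A x|) by exact: measurableT_comp.
have na : measurable_fun setT (fun x => `|a x|) by exact: measurableT_comp.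
have E := @integral_shear R (fun x => `|A x|) (fun v => `|a v|) k
  nA (fun x => normr_ge0 _) (fun x => congr1 _ (pA x)) na
  (fun x => normr_ge0 _).
rewrite /= in E; rewrite E.
have f1 := integrable_fin_num mT (integrable_norm iA).
have f2 := integrable_fin_num measurableT (integrable_norm ia).
by rewrite -(fineK f1) -(fineK f2) -EFinM ltry.
Qed.

Variables (psi : R -> R[i]) (s : R) (c : nat -> R[i]).
Hypotheses (psi_schwartz : schwartz psi) (s_ge0 : 0 <= s) (c_l2 : square_summable c).
Hypothesis psi_supp : forall xi, 10^-1 < `|xi| -> fourier psi xi = 0.
Variable g : R -> R -> R -> R[i].
Hypothesis gsum : is_wave_sum psi s c g.
Let f t x v := complex.Re (g t x v).

Section FixedTime.
Variables (t : R) (t_ge0 : 0 <= t).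
Let mg := measurable_wave_section t_ge0 gsum.

Lemma integrable_Re_profile (G : R -> R[i]) : Cmeasurable setT G -> periodic G ->
  Cintegrable torus G ->
  (mu \x mu)%E.-integrable (torus `*` setT) (fun p => (complex.Re (profile psi G t p.1 p.2))%:E).
Proof.
move=> [m1 m2] pG [i1 i2]; have [p1 p2] := schwartz_Cintegrable psi_schwartz.
have [q1 q2] := schwartz_Cmeasurable psi_schwartz.
under eq_fun do rewrite /profile cReM EFinB.
apply: (integrableB mTT).
- apply: (integrable_shear_tensor (1 + t) m1 _ i1 q1 p1) => x; by rewrite pG.
- apply: (integrable_shear_tensor (1 + t) m2 _ i2 q2 p2) => x; by rewrite pG.
Qed.

Lemma integrable_wave_sum :
  (mu \x mu)%E.-integrable (torus `*` setT) (fun p => (f t p.1 p.2)%:E).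
Proof.
have [G [mG pG G_lim]] := riesz_fischer (wave_coef_summable s_ge0 c_l2).
have := integrable_Re_profile mG pG (Cintegrable_L2_limit mG G_lim).
have mp := measurable_profile2 psi_schwartz mG t.
have N0 := wave_sum_unique psi_schwartz mG pG G_lim gsum t_ge0.
have mN := measurable_neqT mg mp.
move=> /integrableP[_ ip]; apply/integrableP; split.
  by apply: measurable_funTS; apply/measurable_EFinP; exact: mg.1.
apply: le_lt_trans ip; rewrite le_eqVlt; apply/orP; left; apply/eqP.
apply: ae_eq_integral => //.
- by apply: measurable_funTS; do 2 apply: measurableT_comp => //; exact: mg.1.
- by apply: measurable_funTS; do 2 apply: measurableT_comp => //; exact: mp.1.
exists [set p | g t p.1 p.2 <> profile psi G t p.1 p.2]; split => //.
by move=> p /=; apply: contra_not => E _; rewrite /f E.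
Qed.

Lemma ae_integrable_fiber :
  {ae mu, forall x, mu.-integrable setT (fun v => (f t x v)%:E)}.
Proof.
have H := rect_ae_integrable1 mT measurableT integrable_wave_sum.
apply: negligible_periodic.
  have [pg _ _] := gsum.
  by move=> x /=; under eq_fun do rewrite /f pg//.
by apply: negligibleS H => x /= [ux xT] /(_ xT).
Qed.

Lemma integrable_density : mu.-integrable torus (fun x => (density f t x)%:E).
Proof. exact: (integrable_Rfubini1 mT measurableT integrable_wave_sum). Qed.

(** By Fubini the l-th coefficient of the density is the integral in v of the
    amplitude, that is, its Fourier transform at 0. This point is outside the
    support because |l| (1 + t) >= 1 > 1/10; the phase - k v of the waves makes
    this true from time 0 on. *)
Lemma fourier_coef_density (l : int) : l != 0 -> fourier_coef (density f t) l = 0.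
Proof.
move=> l0; have [G [mG pG G_lim]] := riesz_fischer (wave_coef_summable s_ge0 c_l2).
pose e x : R[i] := expi (- (l%:~R * x)).
have mth : measurable_fun ([set: measurableTypeR R]) (fun x : R => - (l%:~R * x)).
  by apply: measurable_funN; apply: measurable_funM => //; exact: measurable_cst.
have mth2 : measurable_fun ((torus : set (measurableTypeR R)) `*` [set: measurableTypeR R])
    (fun p => - (l%:~R * p.1)).
  apply: measurable_funTS; apply: measurable_funN; apply: measurable_funM.
    exact: measurable_cst.
  exact: measurable_fst.
have i0 : (mu \x mu)%E.-integrable (torus `*` setT) (cst 0%E).
  exact: integrable0.
have [k1 k2] := @integrable_mul_expi _ _ R (mu \x mu)%E _
  (fun p => (f t p.1 p.2)%:C) _ mTT mth2 integrable_wave_sum i0.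
rewrite /fourier_coef.
transitivity (((2 * pi)^-1)%:C * Cintegral torus (fun x =>
    Cintegral setT (fun v => (f t x v)%:C * e x))).
  congr (_ * _); apply: Cintegral_ae_eq => //.
  - apply: (Cmeasurable_mul_expi (measurable_funTS mth)); split; last exact: measurable_cst.
    by apply/measurable_EFinP; exact: measurable_int integrable_density.
  - have mus : Cmeasurable setT (fun p : R * R => (f t p.1 p.2)%:C).
      by split; [exact: mg.1|exact: measurable_cst].
    have mthT : measurable_fun setT (fun p : R * R => - (l%:~R * p.1)).
      apply: measurable_funN; apply: measurable_funM; first exact: measurable_cst.
      exact: measurable_fst.
    have [j1 j2] := Cmeasurable_mul_expi mthT mus.
    split; apply: measurable_funTS.
    + apply: (@measurable_fun_param_Rintegral _ _ (measurableTypeR R) (measurableTypeR R) R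
        mu setT (fun x v => complex.Re ((f t x v)%:C * e x))) => //.
      exact: measurable_funTS.
    + apply: (@measurable_fun_param_Rintegral _ _ (measurableTypeR R) (measurableTypeR R) R
        mu setT (fun x v => complex.Im ((f t x v)%:C * e x))) => //.
      exact: measurable_funTS.
  have := ae_integrable_fiber; apply: (@filterS _ _ (ae_filter_ringOfSetsType mu)) => x ix.
  have icx : Cintegrable setT (fun v => (f t x v)%:C) by split => //; exact: integrable0.
  rewrite mulrC; under [in RHS]eq_Cintegral => v _ do rewrite mulrC.
  rewrite CintegralZ//; congr (_ * _); apply: complexP => //=.
  by rewrite Rintegral_cst// mul0r.
rewrite (@Cfubini R torus setT (fun x v => (f t x v)%:C * e x))//.
have p0 : 2 * pi != 0 :> R by rewrite gt_eqF// two_pi_gt0.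
have E : (fun v => Cintegral torus (fun x => (f t x v)%:C * e x)) =
    (fun v => (2 * pi)%:C * fourier_coef (fun x => f t x v) l).
  have inv : (2 * pi)%:C * ((2 * pi)^-1)%:C = 1 :> R[i].
    by apply: complexP; rewrite ?cReM ?cImM/= ?mul0r ?mulr0 ?addr0 ?subr0// mulfV.
  by apply/funext => v; rewrite /fourier_coef mulrA inv mul1r.
rewrite E (@Cintegral_ae_eq R setT _ (fun v => (2 * pi)%:C * amplitude psi s c t l v))//.
- rewrite CintegralZ//; last exact: Cintegrable_amplitude.
  have -> : Cintegral setT (amplitude psi s c t l) = fourier (amplitude psi s c t l) 0.
    by apply: eq_Cintegral => v _; rewrite mul0r oppr0 expi0 mulr1.
  rewrite fourier_amplitude_far ?mulr0// add0r normrM.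
  have l1 : 1 <= `|l%:~R : R| by rewrite -intr_norm ler1z -gtz0_ge1 normr_gt0.
  have t1 : 1 <= `|1 + t| by rewrite ger0_norm ?lerDl// addr_ge0.
  rewrite (@lt_le_trans _ _ 1)//; first by rewrite invf_lt1// ltr1n.
  by rewrite -[leLHS]mulr1 ler_pM.
- apply: CmeasurableM; first by split; exact: measurable_cst.
  exact: (measurable_fourier_coef l mg.1).
- apply: CmeasurableM; first by split; exact: measurable_cst.
  by apply: Cintegrable_Cmeasurable; exact: Cintegrable_amplitude.
have := fourier_coef_wave_sum psi_schwartz mG pG G_lim gsum t_ge0 l.
by apply: (@filterS _ _ (ae_filter_ringOfSetsType mu)) => v /= ->.
Qed.

End FixedTime.

Theorem wave_sum_force0 : is_force f (fun _ _ => 0).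
Proof.
split; first exact: measurable_cst.
move=> t t0; have t0' := ltW t0; split.
- exact: ae_integrable_fiber.
- exact: integrable_density.
- by [].
- exact: integrable0.
- move=> l; have -> : fourier_coef (fun=> 0 : R) l = 0.
    rewrite /fourier_coef (_ : Cintegral _ _ = 0) ?mulr0//.
    by rewrite -[RHS](Cintegral0 mT); apply: eq_Cintegral => x _; rewrite mul0r.
  by case: eqP => // /eqP l0; rewrite fourier_coef_density// mulr0.
Qed.

Theorem wave_sum_force_unique F : is_force f F -> forall t, 0 < t ->
  {ae mu, forall x, F t x = 0}.
Proof.
move=> [_ HF] t t0; have [_ _ pF iF F0] := HF t t0.
apply: ae_eq0_fourier_coef => // l; rewrite F0; case: eqP => // /eqP l0.
by rewrite fourier_coef_density ?mulr0// ltW.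
Qed.

End Force.

(** * Transport along characteristics *)
Section ChainRule.
Context (R : realType).

Lemma MVT_at (f df : R -> R) (t0 h : R) : (forall t : R, is_derive t 1 f (df t)) ->
  exists2 c, `|c - t0| <= `|h| & f (h + t0) - f t0 = df c * h.
Proof.
move=> fd.
have cf (i : interval R) : {within [set` i], continuous f}.
  by apply: derivable_within_continuous => x _; exact: ex_derive.
have [h0|h0] := lerP 0 h.
- have le : t0 <= h + t0 by rewrite lerDr.
  have [c + E] := MVT_segment le (fun x _ => fd x) (cf _).
  rewrite in_itv/= => /andP[c1 c2]; exists c; last by rewrite E addrK.
  by rewrite ger0_norm ?subr_ge0// (ger0_norm h0) lerBlDr.
- have le : h + t0 <= t0 by rewrite gerDr ltW.
  have [c + E] := MVT_segment le (fun x _ => fd x) (cf _).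
  rewrite in_itv/= => /andP[c1 c2]; exists c.
    by rewrite ler0_norm ?subr_le0// (ltr0_norm h0); lra.
  by rewrite -opprB E; ring.
Qed.

Lemma is_derive_lim (f : R -> R) (t0 L : R) :
  h^-1 *: (f (h *: 1 + t0) - f t0) @[h --> 0^'] --> L -> is_derive t0 1 f L.
Proof.
move=> H; apply: DeriveDef; first by apply/cvg_ex; exists L.
exact: (cvg_lim _ H).
Qed.

(** The increment of [ph t (X t)] is split into a change of the first argument at
    the moved point, controlled by the mean value theorem and the joint
    continuity of D1, and a change of the second argument at the fixed t0; hence
    the asymmetry between the two hypotheses on derivatives. *)
Lemma is_derive_along (ph D1 : R -> R -> R) (D2 t0 y w : R) :
  (forall x t : R, is_derive t 1 (ph ^~ x) (D1 t x)) ->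
  continuous (fun p : R * R => D1 p.1 p.2) ->
  let X := fun t => y + (1 + t) * w in
  is_derive (X t0) 1 (ph t0) D2 ->
  is_derive t0 1 (fun t => ph t (X t)) (D1 t0 (X t0) + w * D2).
Proof.
move=> d1 cD1 X d2.
have dX : is_derive t0 1 X w.
  by apply: is_derive_eq; rewrite /GRing.scale/=; ring.
have dB : is_derive t0 1 (fun t => ph t0 (X t)) (D2 * w) := is_derive1_comp d2 dX.
have dA : is_derive t0 1 (fun t => ph t (X t) - ph t0 (X t)) (D1 t0 (X t0)).
  apply: is_derive_lim; apply/cvgrPdist_le => e e0.
  have /cvgrPdist_le/(_ e e0) := cD1 (t0, X t0).
  move=> /nbhs_ballP[d /= dp Hd].
  have w0 : 0 < 1 + `|w| by rewrite ltr_pwDl.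
  near=> h.
  have h0 : h != 0 by near: h; exact: nbhs_dnbhs_neq.
  have hd : `|h| < d / (1 + `|w|) by near: h; apply: dnbhs0_lt; rewrite divr_gt0.
  have [c c1 E] := MVT_at t0 h (d1 (X (h + t0))).
  rewrite -[h%:A]/(h * 1) mulr1 subrr subr0 E /GRing.scale/= mulrCA mulVf// mulr1.
  have hd' : `|h| * (1 + `|w|) < d by rewrite -ltr_pdivlMr.
  have hw : 0 <= `|h| * `|w| by rewrite mulr_ge0.
  apply: (Hd (c, X (h + t0))); split; rewrite /ball/= distrC.
    by apply: le_lt_trans c1 _; move: hd'; rewrite mulrDr mulr1; lra.
  rewrite /X (_ : _ - _ = h * w); last by ring.
  by rewrite normrM; move: hd'; rewrite mulrDr mulr1; have := normr_ge0 h; lra.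
have -> : (fun t => ph t (X t)) =
    (fun t => ph t (X t) - ph t0 (X t)) + (fun t => ph t0 (X t)).
  by apply/funext => t; rewrite fctE subrK.
by rewrite (mulrC w); exact: is_deriveD.
Unshelve. all: by end_near. Qed.

End ChainRule.

Section TestFunctions.
Context (R : realType).
Local Notation mu := (@lebesgue_measure R).
Local Notation torus := (@torus R).
Variable phi : R -> R -> R -> R.
Hypothesis tphi : test_function phi.

Definition transport_derivative (t x v : R) : R := dt phi t x v + v * dx phi t x v.

Let C1 : [/\ forall t x v, derivable (fun t' => phi t' x v) t 1 /\
                           derivable (fun x' => phi t x' v) x 1,
  continuous (fun p : R * R * R => dt phi p.1.1 p.1.2 p.2) &
  continuous (fun p : R * R * R => dx phi p.1.1 p.1.2 p.2)].
Proof.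
have [/(_ 1%N) /= [_ [d [[c1 _] [c2 _] _]]] _ _] := tphi.
by split => // t x v; have [] := d t x v.
Qed.

Lemma continuous_transport_derivative :
  continuous (fun p : R * R * R => transport_derivative p.1.1 p.1.2 p.2).
Proof.
have [_ c1 c2] := C1; move=> p; apply: cvgD; first exact: c1.
by apply: cvgM; [exact: cvg_snd|exact: c2].
Qed.

Lemma continuous_slice (u : R * R * R -> R) (f h k : R -> R) : continuous u ->
  continuous f -> continuous h -> continuous k ->
  continuous (fun r => u (f r, h r, k r)).
Proof.
move=> cu cf ch ck r.
apply: (@continuous_comp _ _ _ (fun r => (f r, h r, k r)) u); last exact: cu.
exact: continuous_triple_at (cf r) (ch r) (ck r).
Qed.

Lemma derive_along_characteristic (y v t : R) :
  is_derive t 1 (fun t => phi t (y + (1 + t) * v) v)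
    (transport_derivative t (y + (1 + t) * v) v).
Proof.
have [d c1 c2] := C1.
apply: (@is_derive_along R (fun t x => phi t x v) (fun t x => dt phi t x v)).
- move=> x r; have [h _] := d r x v.
  by rewrite /dt derive1E; exact/derivableP.
- move=> p.
  apply: (@continuous_comp _ _ _ (fun p : R * R => (p, v))
    (fun p : R * R * R => dt phi p.1.1 p.1.2 p.2)); last exact: c1.
  apply: (@continuous_pair_at _ _ _ id (fun=> v) p); first exact: cvg_id.
  exact: cvg_cst.
- have [_ h] := d t (y + (1 + t) * v) v.
  by rewrite /dx derive1E; exact/derivableP.
Qed.

Lemma transport_derivative_periodic t v :
  periodic (fun x => transport_derivative t x v).
Proof.
have [_ pphi _] := tphi.
move=> x; rewrite /transport_derivative; congr (_ + _ * _).
  by rewrite /dt; congr (derive1 _ t); apply/funext => t'; rewrite pphi.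
rewrite /dx; set F := fun x' => phi t x' v.
have E : (fun h => h^-1 *: (F (h + (x + 2 * pi)) - F (x + 2 * pi))) =
    (fun h => h^-1 *: (F (h + x) - F x)).
  by apply/funext => h; rewrite addrA /F !pphi.
by rewrite /derive1 E.
Qed.

(** The interval of times is enlarged so that phi itself vanishes at its ends. *)
Lemma transport_derivative_support : exists a b M : R, [/\ 0 < a, a < b,
  forall x v, phi a x v = 0, forall x v, phi b x v = 0 &
  forall t x v, ~ (a <= t <= b /\ `|v| <= M) -> transport_derivative t x v = 0].
Proof.
have [_ _ [a [b [M [a0 H]]]]] := tphi.
pose b' := Num.max a b + 1.
have ba : a < b' by rewrite /b' ltr_pwDr// le_max lexx.
have bb : b < b' by rewrite /b' ltr_pwDr// le_max lexx orbT.
exists (a / 2), b', M; split.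
- by rewrite divr_gt0.
- by lra.
- by move=> x v; apply: H => -[]; lra.
- by move=> x v; apply: H => -[]; lra.
have out t x v : ~ (a <= t <= b /\ `|v| <= M) -> dx phi t x v = 0.
  move=> h; rewrite /dx (_ : (fun _ => _) = cst 0) ?derive1_cst//.
  by apply/funext => x'; exact: H.
move=> t x v h; rewrite /transport_derivative out ?mulr0 ?addr0; last first.
  by move=> [h1 h2]; apply: h; split => //; lra.
have [vM|vM] := lerP `|v| M; last first.
  rewrite /dt (_ : (fun _ => _) = cst 0) ?derive1_cst//.
  by apply/funext => t'; apply: H => -[_]; lra.
have near0 : \forall t' \near t, phi t' x v = cst 0 t'.
  have [ta|ta] := ltP t a.
    near=> t'; apply: H => -[/andP[h1 _] _].
    have : t' < a by near: t'; exact: lt_nbhsl.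
    by rewrite ltNge h1.
  have [tb|tb] := ltP b t.
    near=> t'; apply: H => -[/andP[_ h1] _].
    have : b < t' by near: t'; exact: lt_nbhsr.
    by rewrite ltNge h1.
  by exfalso; apply: h; split => //; lra.
by rewrite /dt derive1E (@near_eq_derive R _ _ _ _ t 1 near0) -derive1E derive1_cst.
Unshelve. all: by end_near. Qed.

(** Compactness in one period, then periodicity. *)
Lemma transport_derivative_bounded : exists K : R,
  forall t x v, `|transport_derivative t x v| <= K.
Proof.
have [a [b [M [a0 ab _ _ out]]]] := transport_derivative_support.
pose B : set (R * R * R) := `[a, b] `*` torus `*` `[- M, M].
have cB : compact B.
  by apply: compact_setX; [apply: compact_setX|]; exact: segment_compact.
pose u (p : R * R * R) := transport_derivative p.1.1 p.1.2 p.2.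
have cu : {within B, continuous u}.
  by apply: continuous_subspaceT; exact: continuous_transport_derivative.
have /compact_bounded[K [_ HK]] := continuous_compact cu cB.
exists (`|K| + 1) => t x v.
have [h|h] := pselect (a <= t <= b /\ `|v| <= M); last first.
  by rewrite out// normr0 addr_ge0.
have [k [y [-> /andP[y0 y2]]]] := torus_decomp x.
rewrite (periodicDz (@transport_derivative_periodic t v)).
apply: (HK (`|K| + 1)).
  by rewrite (le_lt_trans (ler_norm _))// ltrDl.
exists (t, y, v) => //; rewrite /B/= /torus/= !in_itv/=.
by case: h => -> vM; rewrite y0 (ltW y2) -ler_norml vM.
Qed.

End TestFunctions.

Section Characteristics.
Context (R : realType).
Local Notation mu := (@lebesgue_measure R).
Local Notation torus := (@torus R).
Let mT : measurable (torus : set (measurableTypeR R)) := @measurable_torus R.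
Variable P : R -> R.
Hypotheses (mP : measurable_fun setT P) (pP : periodic P).
Hypothesis iP : mu.-integrable torus (EFin \o P).

Section Boxes.
Variables (a b M : R).
Let I : set (measurableTypeR R) := `[a, b]%classic.
Let J : set (measurableTypeR R) := `[- M, M]%classic.
Let mI : measurable I. Proof. exact: measurable_itv. Qed.
Let mJ : measurable J. Proof. exact: measurable_itv. Qed.
Let mIT : measurable (I `*` (torus : set (measurableTypeR R))).
Proof. exact: measurableX. Qed.

Let finI : (mu I < +oo)%E.
Proof. by rewrite /= lebesgue_measure_itv/=; case: ifP => // _; rewrite -EFinB ltry. Qed.

Let finJ : (mu J < +oo)%E.
Proof. by rewrite /= lebesgue_measure_itv/=; case: ifP => // _; rewrite -EFinB ltry. Qed.

Let C := (\int[mu]_(x in torus) `|(P x)%:E|)%E.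

Let C_fin : C \is a fin_num.
Proof.
rewrite /C ge0_fin_numE; first by have /integrableP[] := iP.
by apply: integral_ge0 => x _.
Qed.

Let measurable_slice v : measurable_fun setT (fun z : R * R => P (z.2 - (1 + z.1) * v)).
Proof.
apply: (measurableT_comp mP); apply: measurable_funB; first exact: measurable_snd.
apply: measurable_funM; last exact: measurable_cst.
by apply: measurable_funD; [exact: measurable_cst|exact: measurable_fst].
Qed.

Let shift_abs r : (\int[mu]_(x in torus) `|(P (x + r)%R)%:E| = C)%E.
Proof.
rewrite /C; apply: (@ge0_integral_periodic R (fun x => `|(P x)%:E|)%E r) => //.
- by apply: measurableT_comp => //; exact/measurable_EFinP.
- by move=> x; rewrite pP.
Qed.

Let norm_slice v :
  (\int[mu \x mu]_(z in I `*` torus) `|(P (z.2 - (1 + z.1) * v)%R)%:E| = C * mu I)%E.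
Proof.
rewrite (tonelli1 mu mu mI mT)//; last first.
  apply: measurable_funTS; apply: measurableT_comp => //.
  by apply/measurable_EFinP; exact: measurable_slice.
by under eq_integral do rewrite /= shift_abs; rewrite -(fineK C_fin) integral_cst.
Qed.

(** At each time the integral over the torus of |P| is independent of the
    translation by (1 + t) v. *)
Lemma integrable_slice v :
  (mu \x mu)%E.-integrable (I `*` torus) (fun z => (P (z.2 - (1 + z.1) * v))%:E).
Proof.
apply/integrableP; split.
  by apply: measurable_funTS; apply/measurable_EFinP; exact: measurable_slice.
by rewrite norm_slice lte_mul_pinfty// integral_ge0.
Qed.

Lemma integrable_box :
  ((mu \x mu) \x mu)%E.-integrable (I `*` torus `*` J)
    (fun p => (P (p.1.2 - (1 + p.1.1) * p.2))%:E).
Proof.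
have m3 : measurable_fun setT (fun p : R * R * R => P (p.1.2 - (1 + p.1.1) * p.2)).
  by apply: (measurableT_comp mP); exact: measurable_shear3.
apply/integrableP; split.
  by apply: measurable_funTS; exact/measurable_EFinP.
rewrite (tonelli2 (product_measure mu mu) mu mIT mJ)//; last first.
  by apply: measurable_funTS; apply: measurableT_comp => //; exact/measurable_EFinP.
under eq_integral do rewrite /= norm_slice.
have CI : (C * mu I)%E \is a fin_num.
  by rewrite fin_numM// ge0_fin_numE.
by rewrite integral_cst//= lte_mul_pinfty// mule_ge0// integral_ge0.
Qed.

End Boxes.

Variable phi : R -> R -> R -> R.
Hypothesis tphi : test_function phi.

(** The integrand is the derivative of phi along the characteristic, which starts
    and ends where phi vanishes. *)
Lemma integral_along_characteristic (a b y v : R) : a < b ->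
  (forall x v, phi a x v = 0) -> (forall x v, phi b x v = 0) ->
  \int[mu]_(t in `[a, b]) transport_derivative phi t (y + (1 + t) * v) v = 0.
Proof.
move=> ab fa fb.
have D t := derive_along_characteristic tphi y v t.
have cX : continuous (fun t : R => y + (1 + t) * v).
  move=> t; apply: cvgD; first exact: cvg_cst.
  by apply: cvgM; [apply: cvgD; [exact: cvg_cst|exact: cvg_id]|exact: cvg_cst].
have cI : continuous (@id R) by move=> ?; exact: cvg_id.
have cD := continuous_slice (continuous_transport_derivative tphi) cI cX (@cst_continuous R R v).
have cF : continuous (fun t => phi t (y + (1 + t) * v) v).
  by move=> t; apply: differentiable_continuous; apply/derivable1_diffP; exact: ex_derive.
rewrite /Rintegral (@continuous_FTC2 _ _ (fun t => phi t (y + (1 + t) * v) v) _ _ ab).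
- by rewrite fa fb subee.
- by apply: continuous_subspaceT; exact: cD.
- split=> [x _||]; first exact: ex_derive.
    by apply: cvg_at_right_filter; exact: cF.
  by apply: cvg_at_left_filter; exact: cF.
- by move=> x _; rewrite derive1E; exact: derive_val.
Qed.

Lemma measurable_transport_derivative :
  measurable_fun setT (fun p : R * R * R => transport_derivative phi p.1.1 p.1.2 p.2).
Proof.
by apply: continuous_measurable_fun3; exact: continuous_transport_derivative.
Qed.

Lemma measurable_transport_slice v :
  measurable_fun setT (fun z : R * R => transport_derivative phi z.1 z.2 v).
Proof.
exact: (measurableT_comp measurable_transport_derivative (pair2_measurable v)).
Qed.

(** Substituting x = y + (1 + t) v in the integral over the torus frees P(y) from
    t; Fubini then puts the integral along the characteristics inside. *)
Lemma integral_slice_eq0 (a b v : R) : a < b ->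
  (forall x v, phi a x v = 0) -> (forall x v, phi b x v = 0) ->
  \int[(mu \x mu)%E]_(z in `[a, b] `*` torus)
    (P (z.2 - (1 + z.1) * v) * transport_derivative phi z.1 z.2 v) = 0.
Proof.
move=> ab fa fb; have [K HK] := transport_derivative_bounded tphi.
have mI : measurable (`[a, b]%classic : set (measurableTypeR R)) by exact: measurable_itv.
have mIT : measurable ((`[a, b]%classic : set (measurableTypeR R)) `*`
    (torus : set (measurableTypeR R))).
  exact: measurableX.
have i1 := integrable_mulr_bounded (M := K) mIT (integrable_slice a b v)
  (measurable_funTS (measurable_transport_slice v)) (fun z _ => HK z.1 z.2 v).
rewrite (@Rfubini1 _ _ _ _ R mu mu _ _ mI mT
  (fun t x => P (x - (1 + t) * v) * transport_derivative phi t x v) i1).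
pose W t y := P y * transport_derivative phi t (y + (1 + t) * v) v.
transitivity (\int[mu]_(t in `[a, b]) \int[mu]_(y in torus) W t y).
  apply: eq_Rintegral => t _.
  have mW : measurable_fun setT (W t).
    apply: measurable_funM => //; apply: continuous_measurable_fun.
    have cX : continuous (fun y : R => y + (1 + t) * v).
      by move=> y; apply: cvgD; [exact: cvg_id|exact: cvg_cst].
    exact: (continuous_slice (continuous_transport_derivative tphi)
      (@cst_continuous R R t) cX (@cst_continuous R R v)).
  have pW : periodic (W t).
    move=> y; rewrite /W pP addrAC; congr (_ * _).
    exact: (transport_derivative_periodic tphi t v).
  rewrite -(Rintegral_periodic (- ((1 + t) * v)) mW pW).
  by apply: eq_Rintegral => x _; rewrite /W subrK.
have mPhi : measurable_fun setT (fun z : R * R =>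
    transport_derivative phi z.1 (z.2 + (1 + z.1) * v) v).
  have mX : measurable_fun setT (fun z : R * R => z.2 + (1 + z.1) * v).
    apply: measurable_funD; first exact: measurable_snd.
    apply: measurable_funM; last exact: measurable_cst.
    by apply: measurable_funD; [exact: measurable_cst|exact: measurable_fst].
  have mp : measurable_fun setT (fun z : R * R => (z.1, z.2 + (1 + z.1) * v)).
    by apply: measurable_fun_pair => //; exact: measurable_fst.
  exact: (measurableT_comp (measurable_transport_slice v) mp).
have finI : (mu (`[a, b]%classic : set (measurableTypeR R)) < +oo)%E.
  by rewrite /= lebesgue_measure_itv/=; case: ifP => // _; rewrite -EFinB ltry.
have i0 : mu.-integrable `[a, b] (EFin \o (cst 1 : R -> R)).
  apply: measurable_bounded_integrable => //.
  by exists 1; split => // N N1 x _; rewrite /= normr1 ltW.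
have iW : (mu \x mu)%E.-integrable (`[a, b] `*` torus) (fun z => (W z.1 z.2)%:E).
  have := integrable_mulr_bounded (M := K) mIT (integrable_tensor mI mT i0 iP)
    (measurable_funTS mPhi) (fun z _ => HK _ _ _).
  by apply: eq_integrable => // z _; rewrite /W/= /cst mul1r.
rewrite (@Rfubini _ _ _ _ R mu mu _ _ mI mT W iW).
under eq_Rintegral => y _.
  rewrite RintegralZl//; last first.
    have cX : continuous (fun t : R => y + (1 + t) * v).
      move=> r; apply: cvgD; first exact: cvg_cst.
      by apply: cvgM; [apply: cvgD; [exact: cvg_cst|exact: cvg_id]|exact: cvg_cst].
    have cI : continuous (@id R) by move=> ?; exact: cvg_id.
    apply: continuous_compact_integrable; first exact: segment_compact.
    apply: continuous_subspaceT.
    exact: (continuous_slice (continuous_transport_derivative tphi) cI cX (@cst_continuous R R v)).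
  rewrite integral_along_characteristic// mulr0.
  over.
by rewrite Rintegral_cst// mul0r.
Qed.

End Characteristics.

Section TransportedIntegral.
Context (R : realType).
Local Notation mu := (@lebesgue_measure R).
Local Notation torus := (@torus R).
Local Notation halfspace := (`]0, +oo[ `*` torus `*` [set: R]).
Let mT : measurable (torus : set (measurableTypeR R)) := @measurable_torus R.
Variables (P q : R -> R) (Q : R).
Hypotheses (mP : measurable_fun setT P) (pP : periodic P).
Hypothesis iP : mu.-integrable torus (EFin \o P).
Hypotheses (mq : measurable_fun setT q) (q_bound : forall v, `|q v| <= Q).
Variable phi : R -> R -> R -> R.
Hypothesis tphi : test_function phi.

Lemma measurable_halfspace :
  measurable ((`]0, +oo[%classic : set (measurableTypeR R)) `*`
    (torus : set (measurableTypeR R)) `*` (setT : set (measurableTypeR R))).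
Proof. by apply: measurableX => //; apply: measurableX. Qed.

Let K (t x v : R) := P (x - (1 + t) * v) * (q v * transport_derivative phi t x v).

Let transported_box (a b M : R) : 0 < a -> a < b ->
  (forall x v, phi a x v = 0) -> (forall x v, phi b x v = 0) ->
  (forall t x v, ~ (a <= t <= b /\ `|v| <= M) -> transport_derivative phi t x v = 0) ->
  ((mu \x mu) \x mu)%E.-integrable halfspace (fun p => (K p.1.1 p.1.2 p.2)%:E) /\
  \int[((mu \x mu) \x mu)%E]_(p in halfspace) K p.1.1 p.1.2 p.2 = 0.
Proof.
move=> a0 ab fa fb out.
pose I : set (measurableTypeR R) := `[a, b]%classic.
pose J : set (measurableTypeR R) := `[- M, M]%classic.
have mI : measurable I by exact: measurable_itv.
have mJ : measurable J by exact: measurable_itv.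
have mIT : measurable (I `*` (torus : set (measurableTypeR R))) by exact: measurableX.
have mB : measurable (I `*` (torus : set (measurableTypeR R)) `*` J) by exact: measurableX.
have [C HC] := transport_derivative_bounded tphi.
have iB : ((mu \x mu) \x mu)%E.-integrable (I `*` torus `*` J) (fun p => (K p.1.1 p.1.2 p.2)%:E).
  apply: (integrable_mulr_bounded (M := Q * C)) => //.
  - exact: integrable_box.
  - apply: measurable_funTS; apply: measurable_funM.
      exact: (measurableT_comp mq measurable_snd).
    exact: measurable_transport_derivative.
  - by move=> p _; rewrite normrM ler_pM.
have E : (fun p : R * R * R => K p.1.1 p.1.2 p.2) \_ halfspace =
    (fun p : R * R * R => K p.1.1 p.1.2 p.2) \_ (I `*` torus `*` J).
  apply/funext => -[[t x] v]; rewrite !patchE /=.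
  case: ifPn => [|nD]; case: ifPn => //.
  - move=> nB; rewrite inE => -[[_ Tx] _].
    rewrite /K out ?mulr0// => -[tab vM]; move/negP: nB; apply.
    by rewrite inE /I /J/=; split; [split|]; rewrite //= in_itv//= -ler_norml.
  - rewrite inE => -[[It Tx] _]; exfalso; move/negP: nD; apply.
    rewrite inE; split => //=; split => //=.
    by move: It; rewrite /I/= !in_itv/= andbT => /andP[+ _]; exact: lt_le_trans.
split.
  apply/(integrable_mkcond _ measurable_halfspace).
  rewrite -[X in _.-integrable _ X]/
    ((EFin \o (fun p : R * R * R => K p.1.1 p.1.2 p.2)) \_ halfspace).
  rewrite restrict_EFin E -restrict_EFin.
  exact/(integrable_mkcond _ mB).
rewrite Rintegral_mkcond E -Rintegral_mkcond.
transitivity (\int[mu]_(v in J) \int[(mu \x mu)%E]_(z in I `*` torus) K z.1 z.2 v).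
  exact: (@Rfubini2 _ _ _ _ R (product_measure mu mu) mu _ _ mIT mJ (fun z v => K z.1 z.2 v) iB).
transitivity (\int[mu]_(v in J) 0); last by rewrite Rintegral_cst// mul0r.
apply: eq_Rintegral => v _.
transitivity (\int[(mu \x mu)%E]_(z in I `*` torus)
    (q v * (P (z.2 - (1 + z.1) * v) * transport_derivative phi z.1 z.2 v))).
  by apply: eq_Rintegral => z _; rewrite /K mulrCA.
rewrite RintegralZl//; first by rewrite integral_slice_eq0// mulr0.
apply: (integrable_mulr_bounded (M := C)) => //.
- exact: integrable_slice.
- exact: measurable_funTS (measurable_transport_slice tphi v).
Qed.

(** In the region of all positive times the integrand vanishes outside a box; in
    the box, the integral at each velocity is [integral_slice_eq0] times q(v). *)
Lemma transported_integral :
  ((mu \x mu) \x mu)%E.-integrable halfspace (fun p => (K p.1.1 p.1.2 p.2)%:E) /\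
  \int[((mu \x mu) \x mu)%E]_(p in halfspace) K p.1.1 p.1.2 p.2 = 0.
Proof.
have [a [b [M [a0 ab fa fb out]]]] := transport_derivative_support tphi.
exact: transported_box ab fa fb out.
Qed.

End TransportedIntegral.

(** * The sum of the waves solves the Vlasov-Poisson equations *)
Section WeakSolution.
Context (R : realType).
Local Notation mu := (@lebesgue_measure R).
Local Notation torus := (@torus R).
Let mT : measurable (torus : set (measurableTypeR R)) := @measurable_torus R.
Variables (psi : R -> R[i]) (s : R) (c : nat -> R[i]).
Hypotheses (psi_schwartz : schwartz psi) (s_ge0 : 0 <= s) (c_l2 : square_summable c).
Variable G : R -> R[i].
Hypotheses (mG : Cmeasurable setT G) (pG : periodic G).
Hypothesis G_lim :
  (\int[mu]_(x in torus) (sqnorm (G x - trig_sum (wave_coef s c) 1 N.+1 x))%:E)%E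
    @[N --> \oo] --> 0%E.
Variable g : R -> R -> R -> R[i].
Hypothesis gsum : is_wave_sum psi s c g.

Let iG : Cintegrable torus G := Cintegrable_L2_limit mG G_lim.
Let mpsi : Cmeasurable setT psi := schwartz_Cmeasurable psi_schwartz.

Let pos_time : set (measurableTypeR R * measurableTypeR R * measurableTypeR R) :=
  [set p | 0 < p.1.1].
Let mpos : measurable pos_time.
Proof.
rewrite (_ : pos_time = (`]0, +oo[ `*` setT) `*` setT).
  by apply: measurableX => //; apply: measurableX.
by apply/seteqP; split=> -[[t x] v] /=; rewrite in_itv/= andbT; tauto.
Qed.

Let mnonneg : measurable ([set p | 0 <= p.1.1] :
  set (measurableTypeR R * measurableTypeR R * measurableTypeR R)).
Proof.
rewrite (_ : [set _ | _] = (`[0, +oo[ `*` setT) `*` setT).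
  by apply: measurableX => //; apply: measurableX.
by apply/seteqP; split=> -[[t x] v] /=; rewrite in_itv/= andbT; tauto.
Qed.

Let mg : Cmeasurable pos_time (fun p => g p.1.1 p.1.2 p.2).
Proof.
have [_ [m1 m2] _] := gsum.
split; [move: m1|move: m2]; apply: measurable_funS => //.
- by move=> p /ltW.
- by move=> p /ltW.
Qed.

Let mp : Cmeasurable setT (fun p : R * R * R => profile psi G p.1.1 p.1.2 p.2) :=
  measurable_profile3 psi_schwartz mG.

Let bad := [set p : R * R * R | 0 < p.1.1 /\ g p.1.1 p.1.2 p.2 <> profile psi G p.1.1 p.1.2 p.2].

Let mbad : measurable (bad : set (measurableTypeR R * measurableTypeR R * measurableTypeR R)).
Proof.
have [p1 p2] := mp.
exact: (measurable_neq mpos mg (conj (measurable_funTS p1) (measurable_funTS p2))).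
Qed.

(** The identity at each time becomes one in (t, x, v): for every t > 0, almost
    every x has an exceptional set of velocities of measure 0. *)
Lemma wave_sum_ae_profile :
  {ae ((mu \x mu) \x mu)%E, forall p : R * R * R, 0 < p.1.1 ->
     g p.1.1 p.1.2 p.2 = profile psi G p.1.1 p.1.2 p.2}.
Proof.
exists bad; split => //; last first.
  by move=> p /=; apply: contra_notP => H p0; apply: contrapT => E; apply: H.
apply/(product_null1 (product_measure mu mu) mu mbad).
pose S : set (R * R) := [set z | mu (xsection bad z) != 0%E].
have bE z : [set v | bad (z, v)] = xsection bad z.
  by apply/seteqP; split=> v; rewrite /xsection/= inE.
have mS : measurable (S : set (measurableTypeR R * measurableTypeR R)).
  have := measurable_fun_xsection mu mbad.
  move=> /(_ measurableT [set~ 0%E]); rewrite setTI => H.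
  rewrite (_ : S = (mu \o xsection bad) @^-1` [set~ 0%E]); last first.
    by apply/seteqP; split=> z /eqP.
  by apply: H; apply: measurableC; exact: emeasurable_set1.
exists S; split => //; last first.
  by move=> z /= H; apply/eqP => E; apply: H; rewrite bE.
apply/(product_null1 mu mu mS).
apply: nearW => t.
have [t0|t0] := ltP 0 t; last first.
  rewrite (_ : [set _ | _] = set0) ?measure0//.
  apply/seteqP; split=> x // /eqP; apply.
  rewrite (_ : xsection _ _ = set0) ?measure0// -bE.
  by apply/seteqP; split=> v // [/=]; rewrite ltNge t0.
apply/(negligibleP mu).
  rewrite (_ : [set _ | _] = xsection S t); first exact: measurable_xsection.
  by apply/seteqP; split=> x; rewrite /xsection/= inE.
have := wave_sum_fiber1 psi_schwartz mG pG G_lim gsum (ltW t0).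
move=> [B [mB B0 HB]]; exists B; split=> // x /= /eqP Hx; apply: HB => /= -[B' [mB' B'0 HB']].
apply: Hx; apply/(negligibleP mu); first exact: measurable_xsection.
exists B'; split=> // v; rewrite -bE => -[/= _ E]; exact: HB'.
Qed.

Let f t x v := complex.Re (g t x v).

Let f_profile t x v : g t x v = profile psi G t x v ->
  f t x v = complex.Re (G (x - (1 + t) * v)) * complex.Re (psi v)
          - complex.Im (G (x - (1 + t) * v)) * complex.Im (psi v).
Proof. by move=> E; rewrite /f E cReM. Qed.

Let reG := fun y => complex.Re (G y).
Let imG := fun y => complex.Im (G y).
Let pre : periodic reG. Proof. by move=> y; rewrite /reG pG. Qed.
Let pim : periodic imG. Proof. by move=> y; rewrite /imG pG. Qed.

(** Almost everywhere f is Re G(y) Re psi(v) - Im G(y) Im psi(v), and both terms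
    are integrable on boxes. *)
Lemma wave_sum_locally_integrable : locally_integrable_tor f.
Proof.
move=> a b M a0; have [i1 i2] := iG; have [m1 m2] := mG; have [q1 q2] := mpsi.
have [b1 b2] := psi_schwartz.
have [M1 HM1] := Rschwartz_bounded b1; have [M2 HM2] := Rschwartz_bounded b2.
have mB : measurable ((`[a, b]%classic : set (measurableTypeR R)) `*`
    (torus : set (measurableTypeR R)) `*` (`[- M, M]%classic : set (measurableTypeR R))).
  by apply: measurableX => //; apply: measurableX.
have sub : `[a, b]%classic `*` torus `*` `[- M, M]%classic `<=` pos_time.
  by move=> -[[t x] v] [[/= + _] _]; rewrite in_itv/= => /andP[+ _]; exact: lt_le_trans.
have j1 := integrable_mulr_bounded (M := M1) mB (integrable_box m1 pre i1 a b M)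
  (measurable_funTS (measurableT_comp q1 measurable_snd)) (fun p _ => HM1 p.2).
have j2 := integrable_mulr_bounded (M := M2) mB (integrable_box m2 pim i2 a b M)
  (measurable_funTS (measurableT_comp q2 measurable_snd)) (fun p _ => HM2 p.2).
apply: (@ae_eq_integrable _ _ R ((mu \x mu) \x mu)%E _
  (fun p : R * R * R => f p.1.1 p.1.2 p.2) (fun p : R * R * R =>
  reG (p.1.2 - (1 + p.1.1) * p.2) * complex.Re (psi p.2)
  - imG (p.1.2 - (1 + p.1.1) * p.2) * complex.Im (psi p.2)) mB).
- by have [h _] := mg; exact: measurable_funS h.
- exact: (integrableB mB j1 j2).
- apply: (@filterS _ _ (ae_filter_ringOfSetsType ((mu \x mu) \x mu)%E) _ _ _ wave_sum_ae_profile).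
  by move=> p H /sub p0; rewrite f_profile//; exact: H.
Qed.

(** With the same decomposition, [transported_integral] applies to the pairs
    (Re G, Re psi) and (Im G, Im psi). *)
Lemma wave_sum_weak_transport : weak_transport f (fun _ _ => 0).
Proof.
split.
- move=> t v t0 x; have [pg _ _] := gsum.
  by rewrite /f (pg t v (ltW t0)).
- exact: wave_sum_locally_integrable.
- move=> a b M a0; rewrite [X in _.-integrable _ X](_ : _ = cst 0%E); last first.
    by apply/funext => p; rewrite mul0r.
  by apply: integrable0; apply: measurableX => //; apply: measurableX.
move=> phi tphi.
have mD := @measurable_halfspace R.
have [i1 i2] := iG; have [m1 m2] := mG; have [q1 q2] := mpsi.
have [b1 b2] := psi_schwartz.
have [M1 HM1] := Rschwartz_bounded b1; have [M2 HM2] := Rschwartz_bounded b2.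
have [j1 z1] := transported_integral m1 pre i1 q1 HM1 tphi.
have [j2 z2] := transported_integral m2 pim i2 q2 HM2 tphi.
have E := RintegralB mD j1 j2; rewrite z1 z2 subr0 in E; rewrite -[RHS]E.
transitivity (\int[((mu \x mu) \x mu)%E]_(p in `]0, +oo[ `*` torus `*` setT)
    (f p.1.1 p.1.2 p.2 * transport_derivative phi p.1.1 p.1.2 p.2)).
  by apply: eq_Rintegral => -[[t x] v] _; rewrite /transport_derivative/= mul0r mul0r addr0; ring.
have sub : `]0, +oo[%classic `*` torus `*` [set: R] `<=` pos_time.
  by move=> -[[t x] v] [[/= + _] _]; rewrite in_itv/= andbT.
apply: ae_eq_Rintegral => //.
- apply: measurable_funM; last exact: measurable_funTS (measurable_transport_derivative tphi).
  by have [h _] := mg; exact: measurable_funS h.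
- exact: (integrableB mD j1 j2).
- apply: (@filterS _ _ (ae_filter_ringOfSetsType ((mu \x mu) \x mu)%E) _ _ _ wave_sum_ae_profile).
  move=> p H /sub p0; rewrite f_profile; last exact: H.
  by rewrite /reG /imG; ring.
Qed.

(** At almost every velocity both sides equal the profile for almost every x,
    null sets being preserved by the translation by t v; and the profile at time
    t and position x + t v is the one at time 0 and position x. *)
Lemma wave_sum_free_transport t : 0 <= t ->
  {ae (mu \x mu)%E, forall p : R * R, f t (p.1 + t * p.2) p.2 = f 0 p.1 p.2}.
Proof.
move=> t0.
have mt := measurable_wave_section t0 gsum.
have m0 := measurable_wave_section (lexx 0) gsum.
have mX : measurable_fun setT (fun p : R * R => (p.1 + t * p.2, p.2)).
  apply: measurable_fun_pair; last exact: measurable_snd.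
  apply: measurable_funD; first exact: measurable_fst.
  by apply: measurable_funM; [exact: measurable_cst|exact: measurable_snd].
have mN := measurable_neqT (CmeasurableT_comp mt mX) m0.
set N := [set _ | _] in mN.
exists N; split=> //; last first.
  by move=> p /=; apply: contra_notP => H; rewrite /f; congr complex.Re; apply: contrapT.
apply/(product_null2 mu mu mN).
have H1 := wave_sum_fiber2 psi_schwartz mG pG G_lim gsum t0.
have H0 := wave_sum_fiber2 psi_schwartz mG pG G_lim gsum (lexx 0).
apply: (@filterS2 _ _ (ae_filter_ringOfSetsType mu) _ _ _ _ H1 H0) => v Ht Hz /=.
apply/(negligibleP mu).
  rewrite (_ : [set _ | _] = ysection N v); first exact: measurable_ysection.
  by apply/seteqP; split=> x; rewrite /ysection/= inE.
apply: (negligibleS _ (negligibleU (negligible_shift (t * v) Ht) Hz)) => x /= E.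
apply: contrapT => /not_orP[/contrapT e1 /contrapT e0]; apply: E; rewrite e1 e0.
by rewrite /profile; congr (G _ * _); ring.
Qed.

End WeakSolution.

Lemma eq0_off_support (R : realType) (u : R -> R[i]) (A : set R) :
  closure [set xi | u xi != 0] `<=` A -> forall xi, ~ A xi -> u xi = 0.
Proof.
move=> sub xi nA; apply/eqP; apply: contrapT => /negP u0.
by apply: nA; apply: sub; exact: subset_closure.
Qed.

Unset Implicit Arguments.

Theorem lemma1p2 (R : realType) (psi : R -> R[i]) (s : R) (c : nat -> R[i])
    (psi_schwartz : schwartz psi)
    (psi_supp : closure [set xi | fourier psi xi != 0]
                  `<=` [set xi | `|xi| <= 10^-1])
    (s_ge0 : 0 <= s)
    (c_l2 : square_summable c) :
  (exists g, is_wave_sum psi s c g) /\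
  forall g, is_wave_sum psi s c g ->
    let f := fun t x v : R => complex.Re (g t x v) in
    [/\ forall t, 0 < t -> sobolev s (f t),
        exists F, vlasov_poisson f F,
        forall t, 0 <= t ->
          {ae (@lebesgue_measure R \x @lebesgue_measure R)%E,
             forall p : R * R, f t (p.1 + t * p.2) p.2 = f 0 p.1 p.2} &
        forall F, is_force f F -> forall t, 0 < t ->
          {ae @lebesgue_measure R, forall x, F t x = 0}].
Proof.
have supp xi : 10^-1 < `|xi| -> fourier psi xi = 0.
  by move=> h; apply: (eq0_off_support psi_supp); apply/negP; rewrite -ltNge.
have [G [mG pG G_lim]] := riesz_fischer (wave_coef_summable s_ge0 c_l2).
split; first by exists (profile psi G); exact: wave_sum_profile G_lim.
move=> g gsum f; split.
- by move=> t t0; exact: (wave_sum_sobolev psi_schwartz s_ge0 c_l2 supp (ltW t0) gsum).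
- exists (fun _ _ => 0); split.
    exact: (wave_sum_force0 psi_schwartz s_ge0 c_l2 supp gsum).
  exact: (wave_sum_weak_transport psi_schwartz mG pG G_lim gsum).
- exact: (wave_sum_free_transport psi_schwartz mG pG G_lim gsum).
- exact: (wave_sum_force_unique psi_schwartz s_ge0 c_l2 supp gsum).
Qed.
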